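(* On the torus $\mathbb{T}^6$ there exist (at least) $652$ distinct homotopy classes of closed, extendible $\mathrm{SL}(3;\mathbb{R})^2$ $3$-forms; likewise, in any given degree $3$ de Rham cohomology class on $\mathbb{T}^6$ there exist (at least) $652$ distinct homotopy classes of closed, extendible $\mathrm{SL}(3;\mathbb{R})^2$ $3$-forms.
   Context: Let $\theta^1,\dots,\theta^6$ be the standard basis of $(\mathbb{R}^6)^*$, $\theta^{ijk}=\theta^i\wedge\theta^j\wedge\theta^k$, and $\rho_+=\theta^{123}+\theta^{456}$. An $\mathrm{SL}(3;\mathbb{R})^2$ $3$-form on an oriented $6$-manifold $N$ is a smooth $3$-form $\rho$ such that for each $x\in N$ there is an orientation-preserving isomorphism $\alpha:\mathrm{T}_xN\to\mathbb{R}^6$ with $\alpha^*\rho_+=\rho|_x$; homotopies are through $\mathrm{SL}(3;\mathbb{R})^2$ $3$-forms. Such $\rho$ induces a para-complex structure $I_\rho$ on $N$, obtained pointwise by pulling back along $\alpha$ the endomorphism $I_0$ of $\mathbb{R}^6$ with $I_0e_i=e_i$ for $i=1,2,3$ and $I_0e_i=-e_i$ for $i=4,5,6$. For a $2$-form $\omega$ define the symmetric bilinear form $(\mathscr{I}_\rho\omega)(a,b)=\tfrac12[\omega(I_\rho a,b)+\omega(I_\rho b,a)]$. The form $\rho$ is extendible if there is a $2$-form $\omega$ on $N$ such that at every point $\mathscr{I}_\rho\omega$ has signature $(3,3)$ and $\omega^3<0$ (with respect to the orientation of $N$). *)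

(* Defs.v *)
From HB Require Import structures.
From mathcomp Require Import all_boot all_order all_algebra all_fingroup.
From mathcomp Require Import all_classical all_reals all_analysis.

Set Implicit Arguments.
Unset Strict Implicit.
Unset Printing Implicit Defensive.

Import Order.TTheory GRing.Theory Num.Theory.
Import numFieldNormedType.Exports.
Local Open Scope classical_set_scope.
Local Open Scope ring_scope.

(* Vectors of R^n are rows; a linear map R^n -> R^m with matrix A acts by
   u |-> u *m A.  A function of k vectors is a function of the k x n matrix
   whose rows are these vectors. *)
Definition multivec (R : realType) (n k : nat) := 'M[R]_(k, n) -> R.

(* The first two conditions are those of [determinant_multilinear] and
   [determinant_alternate]. *)
Definition alternating_form (R : realType) (n k : nat) (w : multivec R n k) :
    Prop :=
  (forall (A B C : 'M[R]_(k, n)) (i0 : 'I_k) (b c : R),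
     row i0 A = b *: row i0 B + c *: row i0 C ->
     row' i0 B = row' i0 A -> row' i0 C = row' i0 A ->
     w A = b * w B + c * w C) /\
  (forall (A : 'M[R]_(k, n)) (i1 i2 : 'I_k),
     i1 != i2 -> A i1 =1 A i2 -> w A = 0).

Definition pullback (R : realType) (m n k : nat) (A : 'M[R]_(m, n))
    (w : multivec R n k) : multivec R m k :=
  fun v => w (v *m A).

(* Normalised so that (u1 /\ ... /\ uk)(v) = \det (uj (vi)) for 1-forms uj. *)
Definition wedge (R : realType) (n k l : nat) (a : multivec R n k)
    (b : multivec R n l) : multivec R n (k + l) :=
  fun v => (k`! * l`!)%:R^-1 *
    \sum_(s : 'S_(k + l)) (-1) ^+ s *
       a (usubmx (row_perm s v)) * b (dsubmx (row_perm s v)).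

(* The dual basis of (R^6)^*, indexed from 0. *)
Definition theta (R : realType) (i : nat) : multivec R 6 1 :=
  fun v => v 0 (inord i).

Definition theta3 (R : realType) (i j k : nat) : multivec R 6 3 :=
  wedge (wedge (@theta R i) (@theta R j)) (@theta R k).

Definition rho_plus (R : realType) : multivec R 6 3 :=
  fun v => @theta3 R 0 1 2 v + @theta3 R 3 4 5 v.

Definition I0 (R : realType) : 'M[R]_6 :=
  @block_mx R 3 3 3 3 1%:M 0 0 (- 1%:M).

Definition SL3_frame (R : realType) (w : multivec R 6 3) (A : 'M[R]_6) : Prop :=
  0 < \det A /\ pullback A (@rho_plus R) =1 w.

(* The endomorphism alpha^{-1} o I0 o alpha for an SL3_frame alpha of w.  It
   does not depend on alpha: the orientation-preserving stabiliser of rho_plus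
   is SL(3) x SL(3), which commutes with I0.  It is 0 if there is no frame. *)
Definition para_complex (R : realType) (w : multivec R 6 3) : 'M[R]_6 :=
  xget 0 [set J | exists A, SL3_frame w A /\ J = A *m I0 R *m invmx A].

Definition Iform (R : realType) (w : multivec R 6 3) (o : multivec R 6 2)
    (a b : 'rV[R]_6) : R :=
  2^-1 * (o (col_mx (a *m para_complex w) b) + o (col_mx (b *m para_complex w) a)).

(* g has p times 1 and q times -1 on the diagonal in some orthogonal basis of
   R^(p+q), whose vectors are the rows of B. *)
Definition signature (R : realType) (p q : nat)
    (g : 'rV[R]_(p + q) -> 'rV[R]_(p + q) -> R) : Prop :=
  exists2 B : 'M[R]_(p + q), B \in unitmx &
    forall i j, g (row i B) (row j B) =
      (block_mx 1%:M 0 0 (- 1%:M) : 'M[R]_(p + q)) i j.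

Definition negative_top (R : realType) (n : nat) (w : multivec R n n) : Prop :=
  forall B : 'M[R]_n, 0 < \det B -> w B < 0.

Fixpoint Ck (R : realType) (n k : nat) (f : 'rV[R]_n -> R) : Prop :=
  match k with
  | 0 => continuous f
  | j.+1 => (forall x, differentiable f x) /\ forall v, Ck j ('D_v f)
  end.

Definition smooth (R : realType) (n : nat) (f : 'rV[R]_n -> R) : Prop :=
  forall k, Ck k f.

(* A differential k-form on the torus T^n = R^n / Z^n is given by its pullback
   to R^n, i.e. by a Z^n-periodic differential k-form on R^n; w x v is its value
   at the point x on the tangent vectors v.  T^n is oriented by the standard
   orientation of R^n. *)
Definition dform (R : realType) (n k : nat) := 'rV[R]_n -> multivec R n k.

Definition torus_form (R : realType) (n k : nat) (w : dform R n k) : Prop :=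
  [/\ forall x, alternating_form (w x),
      forall x (m : 'rV[int]_n), w (x + map_mx intr m) =1 w x
    & forall v, smooth (fun x => w x v)].

(* The exterior derivative, evaluated on constant vector fields. *)
Definition extd (R : realType) (n k : nat) (w : dform R n k) :
    dform R n k.+1 :=
  fun x v => \sum_(i < k.+1)
    (-1) ^+ i * 'D_(row i v) (fun y => w y (row' i v)) x.

Definition closed_form (R : realType) (n k : nat) (w : dform R n k) : Prop :=
  forall x v, extd w x v = 0.

(* The de Rham class of the closed (k+1)-form xi. *)
Definition deRham_class (R : realType) (n k : nat) (xi : dform R n k.+1) :
    set (dform R n k.+1) :=
  [set w | [/\ torus_form w, closed_form w &
    exists2 eta : dform R n k, torus_form eta &
      forall x v, w x v - xi x v = extd eta x v]].

Definition SL3_form (R : realType) (w : dform R 6 3) : Prop :=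
  torus_form w /\ forall x, exists A, SL3_frame (w x) A.

Definition extendible (R : realType) (w : dform R 6 3) : Prop :=
  exists2 o : dform R 6 2, torus_form o &
    forall x, @signature R 3 3 (Iform (w x) (o x)) /\
      @negative_top R 6 (wedge (wedge (o x) (o x)) (o x)).

Definition homotopic (R : realType) (w0 w1 : dform R 6 3) : Prop :=
  exists H : R -> dform R 6 3,
    [/\ forall t, t \in `[0, 1] -> SL3_form (H t),
        forall v, {within `[0, 1]%classic `*` setT, continuous
                     (fun p : R * 'rV[R]_6 => H p.1 p.2 v)},
        H 0 = w0
      & H 1 = w1].

Definition at_least_homotopy_classes (R : realType) (N : nat)
    (P : set (dform R 6 3)) : Prop :=
  exists rho : 'I_N -> dform R 6 3,
    (forall i, SL3_form (rho i) /\ P (rho i)) /\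
    (forall i j, i != j -> ~ homotopic (rho i) (rho j)).

(* Main.v *)
From HB Require Import structures.
Require Import Defs.
From mathcomp Require Import all_boot all_order all_algebra all_fingroup.
From mathcomp Require Import ring lra.
From mathcomp Require Import all_classical all_reals all_analysis.

Set Implicit Arguments.
Unset Strict Implicit.
Unset Printing Implicit Defensive.
Import Order.TTheory GRing.Theory Num.Theory.
Import numFieldNormedType.Exports.
Local Open Scope classical_set_scope.
Local Open Scope ring_scope.

(** The forms are distinguished by the restriction of the eigenbundle E+ of the para-complex structure to
the fifteen coordinate 2-tori of T^6: a homotopy of forms is a homotopy of fields of involutions, and
conjugates the fields at its ends continuously ([path_torus_iso]).

Write s and t for the first two coordinates, taken as angles, and consider forms
ds /\ (P + K) + dt /\ f, where the 2-forms P (self-dual) and K, f (anti-self-dual) on the remaining R^4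
are constant in R^4 and depend on s and t only.  Such a form is in the orbit of rho_plus if |K| < |P| and
f is not 0, because it then splits into two products of 1-forms ([pencil_frame]).  Trigonometric
polynomials P, K and f are chosen so that the form is exact ([rho_eta]) and that its values at (s, t) and
(-s, -t) correspond under a linear reflection g, which is 1 on E+ at the origin but not at the three other
half periods.  Then E+ is not trivial over the torus of s and t: in a global orthonormal frame, g would be
a map B to SO(3) with B (-x) inverse to B x, and its lift to a field of lines of quaternions would have an
odd number of sign changes ([line_field_parity], [no_constant_model], [nontrivial_plane]).

Now pull back by a matrix M whose first two columns are vectors a and b of zeros and ones.  Over the
coordinate torus of the indices k and l, (s, t) is a linear function with matrix the rows k and l of
(a, b).  If the minor is odd it is 1 or -1 and the argument above applies.  If it is even it is 0; then s
and t run over one of the lines s = 0, t = 0 and s = t, over which the form deforms to a constant one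
([trivial_plane]).  The form thus determines all minors of (a, b) modulo 2, hence the plane spanned by a
and b in F_2^6.  There are 651 planes, and a variant of the form for which every restriction is trivial is
the last one of the 652.

The constant 2-form - ds /\ dt + w3, for a self-dual w3 orthogonal to P, has negative cube, and both
eigenbundles are Lagrangian for it.  The symmetric form is therefore nondegenerate with two complementary
isotropic subspaces, hence of signature (3, 3) ([pencil_gram], [Iform_signature]).  Finally, being in the
orbit of rho_plus and having this signature are open conditions ([local_section]), so by compactness
k^3 rho + xi has all properties for every closed xi and large k, and it is cohomologous to xi
([realization]). *)

(** * Alternating forms and wedge products *)

(** Both sides expand over permutations of the k + l rows: a block of permutations of the first k
and of the last l rows can be absorbed in the outer one, which gives k! l! equal copies. *)
Lemma wedge_det (R : realType) n k l (C : 'M[R]_(n, k)) (D : 'M[R]_(n, l)) :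
  wedge (fun v => \det (v *m C)) (fun v => \det (v *m D)) =1
  (fun v : 'M[R]_(k + l, n) => \det (v *m row_mx C D)).
Proof.
move=> v; rewrite /wedge; set X := v *m row_mx C D.
have key (a : 'S_k) (b : 'S_l) :
    \sum_(s : 'S_(k + l)) (-1) ^+ s *
      ((\prod_i X (s (lshift l i)) (lshift l (a i))) *
       (\prod_j X (s (rshift k j)) (rshift k (b j)))) =
    (-1) ^+ a * (-1) ^+ b * \det X.
  transitivity (\det (X *m block_mx (perm_mx a^-1) 0 0 (perm_mx b^-1))).
    rewrite -[in RHS]det_tr; apply: eq_bigr => s _; congr (_ * _).
    rewrite big_split_ord -[X in X *m _]hsubmxK mul_row_block !mulmx0 addr0 add0r.
    rewrite -!col_permE; congr (_ * _); apply: eq_bigr => i _.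
      by rewrite [RHS]mxE row_mxEl !mxE.
    by rewrite [RHS]mxE row_mxEr !mxE.
  by rewrite det_mulmx det_ublock !det_perm !odd_permV mulrC.
have expand (s : 'S_(k + l)) :
    \det (usubmx (row_perm s v) *m C) * \det (dsubmx (row_perm s v) *m D) =
    \sum_(a : 'S_k) \sum_(b : 'S_l) (-1) ^+ a * (-1) ^+ b *
      ((\prod_i X (s (lshift l i)) (lshift l (a i))) *
       (\prod_j X (s (rshift k j)) (rshift k (b j)))).
  rewrite /determinant big_distrl /=; apply: eq_bigr => a _.
  rewrite big_distrr /=; apply: eq_bigr => b _.
  rewrite mulrACA; congr (_ * (_ * _));
    last first; apply: eq_bigr => i _;
    rewrite /X mul_mx_row ?row_mxEl ?row_mxEr !mxE; apply: eq_bigr => m _;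
    by rewrite !mxE.
under eq_bigr => s _ do rewrite -mulrA expand big_distrr /=.
rewrite exchange_big /=.
under eq_bigr => a _.
  under eq_bigr => s _ do rewrite big_distrr /=.
  rewrite exchange_big /=.
  under eq_bigr => b _.
    under eq_bigr => s _ do rewrite mulrCA.
    rewrite -big_distrr /= key !mulrA -[_ * _ * (-1) ^+ a]mulrA.
    rewrite [(-1) ^+ b * (-1) ^+ a]mulrC mulrA -[_ * _ * _ * (-1) ^+ b]mulrA.
    rewrite -!expr2 !sqrr_sign !mul1r.
    over.
  rewrite sumr_const card_Sn.
  over.
rewrite /= sumr_const card_Sn -mulrnA -(mulr_natr (\det X)) mulnC mulrCA.
by rewrite mulVf ?mulr1 // pnatr_eq0 muln_eq0 negb_or -!lt0n !fact_gt0.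
Qed.

Definition detform (R : realType) n k (C : 'M[R]_(n, k)) : multivec R n k :=
  fun v => \det (v *m C).

Lemma wedge_detform (R : realType) n k l (C : 'M[R]_(n, k)) (D : 'M[R]_(n, l)) :
  wedge (detform C) (detform D) = detform (row_mx C D).
Proof. by apply/funext => v; exact: wedge_det. Qed.

Lemma thetaE (R : realType) i : @theta R i = detform (delta_mx (inord i) 0).
Proof.
apply/funext => v; rewrite /detform det_mx11 -colE !mxE.
by congr (v _ _); apply/val_inj.
Qed.

Lemma ord3P (i : 'I_3) : [\/ i = 0, i = 1 | i = 2].
Proof.
by case: i => -[|[|[|//]]] h; [apply: Or31|apply: Or32|apply: Or33]; apply/val_inj.
Qed.

Lemma theta3E (R : realType) (i j k : nat) (f : 'I_3 -> 'I_6) (v : 'M[R]_(3, 6)) :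
  f 0 = inord i -> f 1 = inord j -> f 2 = inord k ->
  theta3 i j k v = \det (colsub f v).
Proof.
move=> f0 f1 f2; rewrite /theta3 !thetaE !wedge_detform /detform.
rewrite -[in RHS](mulmx1 v) -mulmx_colsub; congr (\det (_ *m _)).
apply/matrixP => a b; rewrite !mxE eq_sym; case: splitP => [c bc|c bc].
  rewrite !mxE; case: splitP => [d cd|d cd]; rewrite !mxE ord1 eqxx andbT eq_sym.
    suff -> : b = 0 by rewrite f0.
    by apply/val_inj; rewrite /= bc cd ord1.
  suff -> : b = 1 by rewrite f1.
  by apply/val_inj; rewrite /= bc cd ord1.
rewrite !mxE ord1 eqxx andbT eq_sym; suff -> : b = 2 by rewrite f2.
by apply/val_inj; rewrite /= bc ord1.
Qed.

Lemma rho_plusE (R : realType) (v : 'M[R]_(3, 3 + 3)) :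
  rho_plus v = \det (lsubmx v) + \det (rsubmx v).
Proof.
rewrite /rho_plus (@theta3E _ _ _ _ (@lshift 3 3)); try by apply/val_inj; rewrite /= inordK.
rewrite (@theta3E _ _ _ _ (@rshift 3 3)); try by apply/val_inj; rewrite /= inordK.
by congr (_ + _); congr determinant; apply/matrixP => i j; rewrite !mxE.
Qed.

Lemma row'_mul (R : realType) m n p i (A : 'M[R]_(m, n)) (B : 'M[R]_(n, p)) :
  row' i (A *m B) = row' i A *m B.
Proof. by apply/matrixP => a b; rewrite !mxE; apply: eq_bigr => c _; rewrite mxE. Qed.

Lemma detform_alternating (R : realType) n k (C : 'M[R]_(n, k)) :
  alternating_form (detform C).
Proof.
split=> [A B D i0 b c hA hB hD|A i1 i2 ne12 h].
  apply: (determinant_multilinear (i0 := i0)).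
  - by rewrite !row_mul hA mulmxDl -!scalemxAl.
  - by rewrite !row'_mul hB.
  - by rewrite !row'_mul hD.
apply: (determinant_alternate ne12) => j; rewrite !mxE.
by apply: eq_bigr => m _; rewrite h.
Qed.

Lemma alternatingD (R : realType) n k (w1 w2 : multivec R n k) (c1 c2 : R) :
  alternating_form w1 -> alternating_form w2 ->
  alternating_form (fun v => c1 * w1 v + c2 * w2 v).
Proof.
move=> [l1 a1] [l2 a2]; split=> [A B C i0 b c hA hB hC|A i1 i2 ne12 h].
  by rewrite (l1 A B C i0 b c) // (l2 A B C i0 b c) //; ring.
by rewrite (a1 A i1 i2) // (a2 A i1 i2) // !mulr0 addr0.
Qed.

Lemma alternating_pullback (R : realType) m n k (A : 'M[R]_(m, n)) (w : multivec R n k) :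
  alternating_form w -> alternating_form (pullback A w).
Proof.
move=> [l1 a1]; split=> [X Y Z i0 b c hX hY hZ|X i1 i2 ne12 h]; rewrite /pullback.
  apply: (l1 _ _ _ i0).
  - by rewrite !row_mul hX mulmxDl -!scalemxAl.
  - by rewrite !row'_mul hY.
  - by rewrite !row'_mul hZ.
apply: (a1 _ _ _ ne12) => j; rewrite !mxE.
by apply: eq_bigr => p _; rewrite h.
Qed.

Lemma mul_mx_col (R : realType) m n1 n2 p (v : 'M[R]_(m, n1 + n2))
    (C : 'M[R]_(n1, p)) (D : 'M[R]_(n2, p)) :
  v *m col_mx C D = lsubmx v *m C + rsubmx v *m D.
Proof. by rewrite -{1}(hsubmxK v) mul_row_col. Qed.

Lemma alternating_rho_plus (R : realType) : alternating_form (@rho_plus R).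
Proof.
have -> : @rho_plus R = fun v => 1 * detform (col_mx 1%:M 0 : 'M[R]_(3 + 3, 3)) v
    + 1 * detform (col_mx 0 1%:M : 'M[R]_(3 + 3, 3)) v.
  apply/funext => v; rewrite !mul1r rho_plusE /detform.
  by rewrite !mul_mx_col !mulmx1 !mulmx0 addr0 add0r.
by apply: alternatingD; exact: detform_alternating.
Qed.

Definition rows3 (R : realType) n (a b c : 'rV[R]_n) : 'M[R]_(3, n) :=
  \matrix_(i, j) (if i == 0 then a 0 j else if i == 1 then b 0 j else c 0 j).

Lemma rows3_row (R : realType) n (v : 'M[R]_(3, n)) :
  v = rows3 (row 0 v) (row 1 v) (row 2 v).
Proof. by apply/matrixP => i j; rewrite !mxE; case: (ord3P i) => ->. Qed.

Lemma rows3_mul (R : realType) n m (a b c : 'rV[R]_n) (A : 'M[R]_(n, m)) :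
  rows3 a b c *m A = rows3 (a *m A) (b *m A) (c *m A).
Proof.
apply/matrixP => i j; rewrite !mxE; case: (ord3P i) => -> /=;
  by apply: eq_bigr => k _; rewrite !mxE.
Qed.

Lemma det_mx2 (R : comNzRingType) (v : 'M[R]_2) :
  \det v = v 0 0 * v 1 1 - v 0 1 * v 1 0.
Proof.
rewrite (expand_det_row _ 0) !big_ord_recl big_ord0 /cofactor !det_mx11 !mxE /=.
rewrite !addn0 expr0 expr1 mul1r addr0 mulN1r mulrN.
by congr (_ * v _ _ - v _ _ * v _ _); apply/val_inj.
Qed.

Lemma det_mx3 (R : comNzRingType) (v : 'M[R]_3) : \det v =
  v 0 0 * (v 1 1 * v 2 2 - v 1 2 * v 2 1) - v 0 1 * (v 1 0 * v 2 2 - v 1 2 * v 2 0)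
  + v 0 2 * (v 1 0 * v 2 1 - v 1 1 * v 2 0).
Proof.
rewrite (expand_det_row _ 0) !big_ord_recl big_ord0 /cofactor !det_mx2 !mxE /=.
rewrite ?addn0 ?add0n /= expr0 expr1 sqrrN expr1n !mul1r addr0 mulN1r mulrN addrA.
by congr (v _ _ * (v _ _ * v _ _ - v _ _ * v _ _) - v _ _ * (v _ _ * v _ _ - v _ _ * v _ _)
  + v _ _ * (v _ _ * v _ _ - v _ _ * v _ _)); apply/val_inj.
Qed.

Section Tri.
Variables (R : realType) (n : nat) (w : multivec R n 3).
Hypothesis hw : alternating_form w.
Local Notation T a b c := (w (rows3 a b c)).

Lemma tri_lin1 x y a a' b c : T (x *: a + y *: a') b c = x * T a b c + y * T a' b c.
Proof. by apply: (hw.1 _ _ _ 0); apply/matrixP => i j; rewrite !mxE //=. Qed.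

Lemma tri_lin2 x y a b b' c : T a (x *: b + y *: b') c = x * T a b c + y * T a b' c.
Proof.
apply: (hw.1 _ _ _ 1); apply/matrixP => i j; rewrite !mxE //=;
  by case: (ord3P (lift 1 i)) (neq_lift 1 i) => ->.
Qed.

Lemma tri_lin3 x y a b c c' : T a b (x *: c + y *: c') = x * T a b c + y * T a b c'.
Proof.
apply: (hw.1 _ _ _ 2); apply/matrixP => i j; rewrite !mxE //=;
  by case: (ord3P (lift 2 i)) (neq_lift 2 i) => ->.
Qed.

Lemma tri_eq12 a c : T a a c = 0.
Proof. by apply: (hw.2 _ 0 1) => // j; rewrite !mxE. Qed.

Lemma tri_eq13 a b : T a b a = 0.
Proof. by apply: (hw.2 _ 0 2) => // j; rewrite !mxE. Qed.

Lemma tri_eq23 a b : T a b b = 0.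
Proof. by apply: (hw.2 _ 1 2) => // j; rewrite !mxE. Qed.

Lemma tri_sw12 a b c : T a b c = - T b a c.
Proof.
have := tri_eq12 (1 *: a + 1 *: b) c.
by rewrite tri_lin1 !tri_lin2 !tri_eq12; lra.
Qed.

Lemma tri_sw23 a b c : T a b c = - T a c b.
Proof.
have := tri_eq23 a (1 *: b + 1 *: c).
by rewrite tri_lin2 !tri_lin3 !tri_eq23; lra.
Qed.

Lemma tri_sum1 (I : Type) (r : seq I) (k : I -> R) (f : I -> 'rV[R]_n) b c :
  T (\sum_(i <- r) k i *: f i) b c = \sum_(i <- r) k i * T (f i) b c.
Proof.
elim: r => [|i r IH]; rewrite ?big_nil ?big_cons.
  by have := tri_lin1 0 0 0 0 b c; rewrite !scale0r addr0 !mul0r addr0.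
by rewrite -(scale1r (\sum_(_ <- _) _)) tri_lin1 mul1r IH.
Qed.

Lemma tri_sum2 (I : Type) (r : seq I) (k : I -> R) (f : I -> 'rV[R]_n) a c :
  T a (\sum_(i <- r) k i *: f i) c = \sum_(i <- r) k i * T a (f i) c.
Proof.
rewrite tri_sw12 tri_sum1 -sumrN; apply: eq_bigr => i _.
by rewrite tri_sw12 mulrN opprK.
Qed.

Lemma tri_sum3 (I : Type) (r : seq I) (k : I -> R) (f : I -> 'rV[R]_n) a b :
  T a b (\sum_(i <- r) k i *: f i) = \sum_(i <- r) k i * T a b (f i).
Proof.
rewrite tri_sw23 tri_sum2 -sumrN; apply: eq_bigr => i _.
by rewrite tri_sw23 mulrN opprK.
Qed.

Definition coef3 (i j k : 'I_n) : R :=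
  T (delta_mx 0 i) (delta_mx 0 j) (delta_mx 0 k).

Lemma tri_expand (v : 'M[R]_(3, n)) :
  w v = \sum_i \sum_j \sum_k v 0 i * v 1 j * v 2 k * coef3 i j k.
Proof.
rewrite {1}(rows3_row v) (row_sum_delta (row 0 v)) (row_sum_delta (row 1 v)).
rewrite (row_sum_delta (row 2 v)) tri_sum1.
under eq_bigr => i _ do rewrite tri_sum2 big_distrr /=.
under eq_bigr => i _ do under eq_bigr => j _ do rewrite tri_sum3 !big_distrr /=.
apply: eq_bigr => i _; apply: eq_bigr => j _; apply: eq_bigr => k _.
by rewrite !mxE !mulrA.
Qed.

Lemma tri_eq0 : (forall i j k : 'I_n, (i < j < k)%N -> coef3 i j k = 0) -> forall v, w v = 0.
Proof.
move=> h0 v.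
have h1 (i j k : 'I_n) : (i < j)%N -> coef3 i j k = 0.
  move=> ij; case: (ltngtP j k) => [jk|kj|/val_inj <-]; last exact: tri_eq23.
    by apply: h0; rewrite ij jk.
  rewrite /coef3 tri_sw23; case: (ltngtP i k) => [ik|ki|/val_inj <-].
  - by rewrite [w _]h0 ?oppr0 // ik.
  - by rewrite tri_sw12 [w _]h0 ?oppr0 // ki.
  - by rewrite tri_eq12 oppr0.
rewrite tri_expand big1 // => i _; rewrite big1 // => j _; rewrite big1 // => k _.
suff -> : coef3 i j k = 0 by rewrite mulr0.
case: (ltngtP i j) => [/h1 //|ji|/val_inj <-]; last exact: tri_eq12.
by rewrite /coef3 tri_sw12 [w _]h1 // oppr0.
Qed.
End Tri.

Lemma tri_ext (R : realType) n (w1 w2 : multivec R n 3) :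
  alternating_form w1 -> alternating_form w2 ->
  (forall i j k : 'I_n, (i < j < k)%N -> coef3 w1 i j k = coef3 w2 i j k) -> w1 =1 w2.
Proof.
move=> a1 a2 h v; apply/eqP; rewrite -subr_eq0; apply/eqP.
have := tri_eq0 (alternatingD 1 (- 1) a1 a2); rewrite /coef3 => /(_ _ v) /=.
rewrite mul1r mulN1r; apply=> i j k /h; rewrite /coef3 => ->.
by rewrite mulN1r mul1r subrr.
Qed.

Lemma pullback_comp (R : realType) m n p k (A : 'M[R]_(m, n)) (B : 'M[R]_(n, p))
    (w : multivec R p k) :
  pullback A (pullback B w) =1 pullback (A *m B) w.
Proof. by move=> v; rewrite /pullback mulmxA. Qed.

Definition swap6 (R : realType) : 'M[R]_(3 + 3) := block_mx 0 1%:M 1%:M 0.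

Lemma det_antidiag (R : realType) (X Y : 'M[R]_3) :
  \det (block_mx 0 X Y 0 : 'M[R]_(3 + 3)) = - (\det X * \det Y).
Proof.
have -> : (block_mx 0 X Y 0 : 'M[R]_(3 + 3)) =
    block_mx X 0 0 Y *m (block_mx 1%:M 1%:M 0 1%:M *m block_mx 1%:M 0 (- 1%:M) 1%:M
      *m block_mx 1%:M 1%:M 0 1%:M *m block_mx (- 1%:M) 0 0 1%:M).
  by rewrite !mulmx_block !(mulmx0, mul0mx, mulmx1, mul1mx, addr0, add0r, mulmxN, mulNmx,
    addNr, subrr, opprK, oppr0).
rewrite !det_mulmx !det_ublock !det_lblock !det1 -scaleN1r detZ det1.
by rewrite !mulr1 !mul1r -signr_odd /= expr1 mulrN1.
Qed.

Lemma rho_plus_swap (R : realType) : pullback (swap6 R) (@rho_plus R) =1 @rho_plus R.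
Proof.
move=> v; rewrite /pullback !rho_plusE /swap6 -{1 2}(hsubmxK v) mul_row_block.
by rewrite !mulmx0 !mulmx1 add0r addr0 row_mxKl row_mxKr addrC.
Qed.

(** * The stabiliser of rho_plus *)

Lemma det_rows3 (R : realType) (a b c : 'rV[R]_3) : \det (rows3 a b c) =
  a 0 0 * (b 0 1 * c 0 2 - b 0 2 * c 0 1) - a 0 1 * (b 0 0 * c 0 2 - b 0 2 * c 0 0)
  + a 0 2 * (b 0 0 * c 0 1 - b 0 1 * c 0 0).
Proof. by rewrite det_mx3 !mxE. Qed.

Lemma rho_plus_rows3 (R : realType) (a b c : 'rV[R]_(3 + 3)) :
  rho_plus (rows3 a b c) = \det (rows3 (lsubmx a) (lsubmx b) (lsubmx c))
    + \det (rows3 (rsubmx a) (rsubmx b) (rsubmx c)).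
Proof.
by rewrite rho_plusE; congr (_ + _); congr determinant; apply/matrixP => i j;
  rewrite !mxE; case: (ord3P i) => -> /=.
Qed.

Lemma rho_plus_l (R : realType) (u : 'rV[R]_3) (a b : 'rV[R]_(3 + 3)) :
  rho_plus (rows3 (row_mx u 0) a b) = \det (rows3 u (lsubmx a) (lsubmx b)).
Proof.
rewrite rho_plus_rows3 row_mxKl row_mxKr !det_rows3; have z j : (0 : 'rV[R]_3) 0 j = 0 by rewrite mxE.
rewrite !z; ring.
Qed.

Lemma rho_plus_r (R : realType) (u : 'rV[R]_3) (a b : 'rV[R]_(3 + 3)) :
  rho_plus (rows3 (row_mx 0 u) a b) = \det (rows3 u (rsubmx a) (rsubmx b)).
Proof.
rewrite rho_plus_rows3 row_mxKl row_mxKr !det_rows3;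
  have z j : (0 : 'rV[R]_3) 0 j = 0 by rewrite mxE.
rewrite !z; ring.
Qed.

(** The Pluecker relations for the 2-form w (v, -, -): they say that it is decomposable. *)
Definition plucker (R : realType) n (w : multivec R n 3) (v : 'rV[R]_n) : Prop :=
  forall a b c d, w (rows3 v a b) * w (rows3 v c d) - w (rows3 v a c) * w (rows3 v b d)
    + w (rows3 v a d) * w (rows3 v b c) = 0.

Lemma plucker_l (R : realType) (u : 'rV[R]_3) :
  plucker (@rho_plus R) (row_mx u 0 : 'rV[R]_(3 + 3)).
Proof. by move=> a b c d; rewrite !rho_plus_l !det_rows3; ring. Qed.

Lemma plucker_r (R : realType) (u : 'rV[R]_3) :
  plucker (@rho_plus R) (row_mx 0 u : 'rV[R]_(3 + 3)).
Proof. by move=> a b c d; rewrite !rho_plus_r !det_rows3; ring. Qed.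

Lemma det_rows3_neq0 (R : realType) (x : 'rV[R]_3) :
  x != 0 -> exists a b, \det (rows3 x a b) != 0.
Proof.
move=> /rV0Pn[i]; case: (ord3P i) => -> hi;
  [exists (delta_mx 0 1), (delta_mx 0 2) | exists (delta_mx 0 2), (delta_mx 0 0)
  |exists (delta_mx 0 0), (delta_mx 0 1)];
  by rewrite det_rows3 !mxE /= !(mul0r, mulr0, mulrN, mulr1, subr0, add0r, addr0, sub0r, oppr0, opprK).
Qed.

(** If both components of v are nonzero, contraction of rho_plus with v is the sum of two
decomposable forms in disjoint variables, which has a nonzero square. *)
Lemma plucker_rho_plus (R : realType) (v : 'rV[R]_(3 + 3)) :
  plucker (@rho_plus R) v -> (lsubmx v == 0) || (rsubmx v == 0).
Proof.
move=> hv; apply/norP => -[/det_rows3_neq0[a [b hab]] /det_rows3_neq0[c [d hcd]]].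
have := hv (row_mx a 0 : 'rV[R]_(3 + 3)) (row_mx b 0 : 'rV[R]_(3 + 3))
  (row_mx 0 c : 'rV[R]_(3 + 3)) (row_mx 0 d : 'rV[R]_(3 + 3)).
rewrite -{1 2 3 4 5 6}(hsubmxK v).
move: (lsubmx v) (rsubmx v) hab hcd => x y hab hcd.
have e (p q r s : 'rV[R]_3) : rho_plus (rows3 (row_mx x y : 'rV[R]_(3 + 3)) (row_mx p q) (row_mx r s))
   = \det (rows3 x p r) + \det (rows3 y q s).
  by rewrite rho_plus_rows3 !row_mxKl !row_mxKr.
rewrite !e.
have z1 (p q : 'rV[R]_3) : \det (rows3 q p 0) = 0 by rewrite det_rows3 !mxE; ring.
have z2 (p q : 'rV[R]_3) : \det (rows3 q 0 p) = 0 by rewrite det_rows3 !mxE; ring.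
rewrite !z1 !z2 !(addr0, add0r, mulr0, mul0r, subr0) => /eqP.
by rewrite mulf_eq0 (negPf hab) (negPf hcd).
Qed.

(** A vector space is not the union of two proper subspaces. *)
Lemma zero_or_zero (R : realType) (X Y : 'M[R]_3) :
  (forall u : 'rV_3, (u *m X == 0) || (u *m Y == 0)) -> X = 0 \/ Y = 0.
Proof.
move=> h; have [->|/eqP X0] := pselect (X = 0); first by left.
right; apply/eqP/negPn/negP => Y0.
have ex (Z : 'M[R]_3) : Z != 0 -> exists u : 'rV_3, u *m Z != 0.
  move=> Z0; apply: contrapT => h0; move/eqP: Z0; apply.
  apply/row_matrixP => i; rewrite row0 rowE; apply/eqP/negPn/negP => hi.
  by apply: h0; exists (delta_mx 0 i).
have [u uX] := ex _ X0; have [v vY] := ex _ Y0.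
have := h (u + v); have := h u; have := h v.
rewrite (negPf uX) (negPf vY) /= orbF => /eqP vX /eqP uY.
by rewrite !mulmxDl vX uY addr0 add0r (negPf uX) (negPf vY).
Qed.

(** The set of vectors with decomposable contraction is the union of the two summands, so an
element of the stabiliser preserves or exchanges them.  It has determinant -1 if it exchanges them. *)
Lemma rho_plus_stab (R : realType) (g : 'M[R]_(3 + 3)) :
  0 < \det g -> pullback g (@rho_plus R) =1 @rho_plus R -> g *m I0 R = I0 R *m g.
Proof.
move=> dg hg.
have gu : g \in unitmx by rewrite unitmxE unitfE gt_eqF.
have pl (v : 'rV[R]_(3 + 3)) : plucker (@rho_plus R) v -> plucker (@rho_plus R) (v *m g).
  move=> hv a b c d.
  rewrite -(mulmxKV gu a) -(mulmxKV gu b) -(mulmxKV gu c) -(mulmxKV gu d) -!rows3_mul.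
  by rewrite ![rho_plus (_ *m g)]hg; exact: hv.
rewrite -(submxK g) in dg hg gu pl *.
move: (ulsubmx g) (ursubmx g) (dlsubmx g) (drsubmx g) dg hg gu pl => A B C D dg hg gu pl.
have hAB : A = 0 \/ B = 0.
  apply: zero_or_zero => u; have := plucker_rho_plus (pl _ (plucker_l u)).
  by rewrite mul_row_block !mul0mx !addr0 row_mxKl row_mxKr.
have hCD : C = 0 \/ D = 0.
  apply: zero_or_zero => u; have := plucker_rho_plus (pl _ (plucker_r u)).
  by rewrite mul_row_block !mul0mx !add0r row_mxKl row_mxKr.
have dN0 : (\det (block_mx A B C D) == 0) = false by rewrite gt_eqF.
case: hAB hCD => [A0|B0] [C0|D0]; subst.
- by move: dN0; rewrite det_ublock det0 mul0r eqxx.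
- have r1 : \det B = 1.
    have := hg (row_mx 1%:M 0 : 'M[R]_(3, 3 + 3)); rewrite /pullback mul_row_block !mul0mx !mul1mx !addr0.
    by rewrite !rho_plusE !row_mxKl !row_mxKr det1 det0 add0r addr0.
  have r2 : \det C = 1.
    have := hg (row_mx 0 1%:M : 'M[R]_(3, 3 + 3)); rewrite /pullback mul_row_block !mul0mx !mul1mx !add0r.
    by rewrite !rho_plusE !row_mxKl !row_mxKr det1 det0 add0r addr0.
  by move: dg; rewrite det_antidiag r1 r2 mulr1 ltr0N1.
- change (block_mx A 0 0 D *m (block_mx 1%:M 0 0 (- 1%:M) : 'M[R]_(3 + 3)) =
    (block_mx 1%:M 0 0 (- 1%:M) : 'M[R]_(3 + 3)) *m block_mx A 0 0 D).
  rewrite !mulmx_block !(mulmx0, mul0mx, mulmx1, mul1mx, addr0, add0r, mulmxN, mulNmx, oppr0).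
  by [].
- by move: dN0; rewrite det_lblock det0 mulr0 eqxx.
Qed.

(** Two frames differ by an element of the stabiliser, which commutes with I0. *)
Lemma para_complexE (R : realType) (w : multivec R 6 3) (A : 'M[R]_6) :
  SL3_frame w A -> para_complex w = A *m I0 R *m invmx A.
Proof.
move=> fA; rewrite /para_complex.
have [B [fB ->]] := @xgetPex _ 0 [set J | exists A, SL3_frame w A /\ J = A *m I0 R *m invmx A]
  (ex_intro _ _ (ex_intro _ _ (conj fA erefl))).
have [dA hA] := fA; have [dB hB] := fB.
have uA : A \in unitmx by rewrite unitmxE unitfE gt_eqF.
have uB : B \in unitmx by rewrite unitmxE unitfE gt_eqF.
have : (invmx A *m B) *m I0 R = I0 R *m (invmx A *m B).
  apply: rho_plus_stab; first by rewrite det_mulmx det_inv mulr_gt0 ?invr_gt0.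
  move=> v; rewrite -pullback_comp /pullback.
  by have := hB (v *m invmx A); rewrite /pullback => ->; rewrite -hA /pullback mulmxKV.
move=> /(congr1 (fun X => A *m X *m invmx B)).
by rewrite !mulmxA mulmxV // mul1mx mulmxK.
Qed.

(** * Limits of matrices *)

Section Limits.
Context {T : Type} {F : set_system T} {FF : Filter F} {R : realType}.

Lemma cvg_sumR (I : Type) (r : seq I) (f : I -> T -> R) (l : I -> R) :
  (forall i, f i @ F --> l i) ->
  (fun z => \sum_(i <- r) f i z) @ F --> \sum_(i <- r) l i.
Proof. by move=> h; apply: cvg_big => // -[x y]; exact: add_continuous. Qed.

Lemma cvg_prodR (I : Type) (r : seq I) (f : I -> T -> R) (l : I -> R) :
  (forall i, f i @ F --> l i) ->
  (fun z => \prod_(i <- r) f i z) @ F --> \prod_(i <- r) l i.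
Proof. by move=> h; apply: cvg_big => // -[x y]; exact: mul_continuous. Qed.

(** Entrywise convergence along an arbitrary filter: polynomial and rational expressions in the
entries then converge by the rules for real functions. *)
Definition mcvg m n (f : T -> 'M[R]_(m, n)) (l : 'M[R]_(m, n)) : Prop :=
  forall i j, (fun z => f z i j) @ F --> l i j.

Lemma mcvg_cst m n (l : 'M[R]_(m, n)) : mcvg (fun=> l) l.
Proof. by move=> i j; exact: cvg_cst. Qed.

Lemma mcvgD m n (f g : T -> 'M[R]_(m, n)) a b :
  mcvg f a -> mcvg g b -> mcvg (fun z => f z + g z) (a + b).
Proof.
move=> fa gb i j; rewrite mxE; under eq_fun do rewrite mxE.
exact: cvgD (fa i j) (gb i j).
Qed.

Lemma mcvgN m n (f : T -> 'M[R]_(m, n)) a : mcvg f a -> mcvg (fun z => - f z) (- a).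
Proof. by move=> fa i j; rewrite mxE; under eq_fun do rewrite mxE; exact: cvgN (fa i j). Qed.

Lemma mcvgZ m n (c : T -> R) (f : T -> 'M[R]_(m, n)) (k : R) a :
  c @ F --> k -> mcvg f a -> mcvg (fun z => c z *: f z) (k *: a).
Proof.
move=> ck fa i j; rewrite mxE; under eq_fun do rewrite mxE.
exact: cvgM ck (fa i j).
Qed.

Lemma mcvgM m n p (f : T -> 'M[R]_(m, n)) (g : T -> 'M[R]_(n, p)) a b :
  mcvg f a -> mcvg g b -> mcvg (fun z => f z *m g z) (a *m b).
Proof.
move=> fa gb i j; rewrite mxE; under eq_fun do rewrite mxE.
by apply: cvg_sumR => k; exact: cvgM (fa i k) (gb k j).
Qed.

Lemma mcvg_tr m n (f : T -> 'M[R]_(m, n)) a : mcvg f a -> mcvg (fun z => (f z)^T) a^T.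
Proof. by move=> fa i j; rewrite mxE; under eq_fun do rewrite mxE; exact: fa. Qed.

Lemma mcvg_block m1 m2 n1 n2 (f : T -> 'M[R]_(m1, n1)) (g : T -> 'M[R]_(m1, n2))
    (h : T -> 'M[R]_(m2, n1)) (k : T -> 'M[R]_(m2, n2)) a b c d :
  mcvg f a -> mcvg g b -> mcvg h c -> mcvg k d ->
  mcvg (fun z => block_mx (f z) (g z) (h z) (k z)) (block_mx a b c d).
Proof.
move=> fa gb hc kd i j; rewrite -(@fintype.splitK m1 m2 i) -(@fintype.splitK n1 n2 j).
case: (fintype.split i) => i'; case: (fintype.split j) => j' /=.
- by rewrite block_mxEul; under eq_fun do rewrite block_mxEul; exact: fa.
- by rewrite block_mxEur; under eq_fun do rewrite block_mxEur; exact: gb.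
- by rewrite block_mxEdl; under eq_fun do rewrite block_mxEdl; exact: hc.
- by rewrite block_mxEdr; under eq_fun do rewrite block_mxEdr; exact: kd.
Qed.

Lemma cvg_det n (f : T -> 'M[R]_n) a : mcvg f a -> (fun z => \det (f z)) @ F --> \det a.
Proof.
move=> fa; rewrite /determinant; apply: cvg_sumR => s.
apply: cvgM; first exact: cvg_cst.
by apply: cvg_prodR => i; exact: fa.
Qed.

Lemma near_unitmx n (f : T -> 'M[R]_n) a :
  mcvg f a -> a \in unitmx -> \forall z \near F, f z \in unitmx.
Proof.
move=> /cvg_det fa; rewrite unitmxE unitfE => ua.
by apply: filterS (cvgr_neq0 _ fa ua) => z; rewrite unitmxE unitfE.
Qed.

Lemma mcvgV n (f : T -> 'M[R]_n) a :
  mcvg f a -> a \in unitmx -> mcvg (fun z => invmx (f z)) (invmx a).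
Proof.
move=> fa ua i j; rewrite /invmx ua !mxE.
have : (fun z => (\det (f z))^-1 * ((-1) ^+ (j + i) * \det (row' j (col' i (f z))))) @ F -->
    (\det a)^-1 * cofactor a j i.
  apply: cvgM; first by apply: cvgV; [rewrite -unitfE -unitmxE|exact: cvg_det].
  apply: cvgM; first exact: cvg_cst.
  by apply: cvg_det => p q; rewrite !mxE; under eq_fun do rewrite !mxE; exact: fa.
apply: cvg_trans; apply: near_eq_cvg.
by apply: filterS (near_unitmx fa ua) => z uz; rewrite uz !mxE.
Qed.

Lemma cvg_form (w : T -> multivec R 6 3) (w0 : multivec R 6 3) (v : T -> 'M[R]_(3, 6)) v0 :
  (forall z, alternating_form (w z)) -> alternating_form w0 ->
  (forall x, (fun z => w z x) @ F --> w0 x) -> mcvg v v0 ->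
  (fun z => w z (v z)) @ F --> w0 v0.
Proof.
move=> aw a0 ww0 vv0; rewrite (tri_expand a0); under eq_fun do rewrite (tri_expand (aw _)).
do 3 (apply: cvg_sumR => ?).
by apply: cvgM (ww0 _); apply: cvgM (vv0 _ _); apply: cvgM; exact: vv0.
Qed.
End Limits.
Arguments mcvg {T} F {R m n}.

(** * Normal forms near rho_plus *)

Definition mx3 (R : realType) (a b c d e f g h k : R) : 'M[R]_3 :=
  \matrix_(i, j) (if i == 0 then (if j == 0 then a else if j == 1 then b else c)
    else if i == 1 then (if j == 0 then d else if j == 1 then e else f)
    else (if j == 0 then g else if j == 1 then h else k)).

(** The two summands of R^3 + R^3, on which rho_plus restricts to the determinant. *)
Definition lft (R : realType) (u : 'rV[R]_3) : 'rV[R]_(3 + 3) := row_mx u 0.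
Definition rgt (R : realType) (u : 'rV[R]_3) : 'rV[R]_(3 + 3) := row_mx 0 u.
Local Notation e_ i := (delta_mx (0 : 'I_1) (i : 'I_3)).
Local Notation l_ i := (lft (e_ i)).
Local Notation r_ i := (rgt (e_ i)).

Lemma ord3_lt (i j : 'I_3) : (i < j)%N ->
  [\/ i = 0 /\ j = 1, i = 0 /\ j = 2 | i = 1 /\ j = 2].
Proof. by case: (ord3P i) => ->; case: (ord3P j) => -> // _; constructor. Qed.

Lemma ord3_lt3 (i j k : 'I_3) : (i < j < k)%N -> [/\ i = 0, j = 1 & k = 2].
Proof. by case: (ord3P i) => ->; case: (ord3P j) => -> //; case: (ord3P k) => ->. Qed.

Lemma delta_lshift (R : realType) (i : 'I_3) : delta_mx 0 (lshift 3 i) = l_ i :> 'rV[R]_(3 + 3).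
Proof.
apply/rowP => j; rewrite /lft -(@fintype.splitK 3 3 j); case: (fintype.split j) => k /=.
  by rewrite row_mxEl !mxE eqxx /= (inj_eq (@lshift_inj _ _)).
by rewrite row_mxEr !mxE eqxx /= eq_rlshift.
Qed.

Lemma delta_rshift (R : realType) (i : 'I_3) : delta_mx 0 (rshift 3 i) = r_ i :> 'rV[R]_(3 + 3).
Proof.
apply/rowP => j; rewrite /rgt -(@fintype.splitK 3 3 j); case: (fintype.split j) => k /=.
  by rewrite row_mxEl !mxE eqxx /= eq_lrshift.
by rewrite row_mxEr !mxE eqxx /= (inj_eq (@rshift_inj _ _)).
Qed.

Lemma form33_ext (R : realType) (w1 w2 : multivec R (3 + 3) 3) :
  alternating_form w1 -> alternating_form w2 ->
  w1 (rows3 (l_ 0) (l_ 1) (l_ 2)) = w2 (rows3 (l_ 0) (l_ 1) (l_ 2)) ->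
  (forall k, w1 (rows3 (l_ 0) (l_ 1) (r_ k)) = w2 (rows3 (l_ 0) (l_ 1) (r_ k))) ->
  (forall k, w1 (rows3 (l_ 0) (r_ k) (l_ 2)) = w2 (rows3 (l_ 0) (r_ k) (l_ 2))) ->
  (forall k, w1 (rows3 (r_ k) (l_ 1) (l_ 2)) = w2 (rows3 (r_ k) (l_ 1) (l_ 2))) ->
  (forall k, w1 (rows3 (l_ k) (r_ 1) (r_ 2)) = w2 (rows3 (l_ k) (r_ 1) (r_ 2))) ->
  (forall k, w1 (rows3 (l_ k) (r_ 2) (r_ 0)) = w2 (rows3 (l_ k) (r_ 2) (r_ 0))) ->
  (forall k, w1 (rows3 (l_ k) (r_ 0) (r_ 1)) = w2 (rows3 (l_ k) (r_ 0) (r_ 1))) ->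
  w1 (rows3 (r_ 0) (r_ 1) (r_ 2)) = w2 (rows3 (r_ 0) (r_ 1) (r_ 2)) ->
  w1 =1 w2.
Proof.
move=> a1 a2 hlll h2 h1 h0 g0 g1 g2 hrrr; apply: tri_ext => // i j k.
rewrite /coef3 -(@fintype.splitK 3 3 i) -(@fintype.splitK 3 3 j) -(@fintype.splitK 3 3 k).
case: (fintype.split i) => i'; case: (fintype.split j) => j'; case: (fintype.split k) => k' /=;
  rewrite !(delta_lshift, delta_rshift) ?ltn_add2l => /andP[ij jk].
- by have [] := @ord3_lt3 i' j' k'; rewrite ?ij // => -> -> ->.
- case: (ord3_lt ij) => -[-> ->] //.
    by rewrite (tri_sw23 a1) (tri_sw23 a2) h1.
  by rewrite (tri_sw23 a1) (tri_sw23 a2) (tri_sw12 a1) (tri_sw12 a2) h0.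
- by have := ltn_ord k'; rewrite ltnNge (leq_trans (leq_addr _ _) (ltnW jk)).
- case: (ord3_lt jk) => -[-> ->] //.
  by rewrite (tri_sw23 a1) (tri_sw23 a2) g1.
- by have := ltn_ord j'; rewrite ltnNge (leq_trans (leq_addr _ _) (ltnW ij)).
- by have := ltn_ord j'; rewrite ltnNge (leq_trans (leq_addr _ _) (ltnW ij)).
- by have := ltn_ord k'; rewrite ltnNge (leq_trans (leq_addr _ _) (ltnW jk)).
- by have [] := @ord3_lt3 i' j' k'; rewrite ?ij // => -> -> ->.
Qed.

(** The adjugate of the matrix of these entries. *)
Definition cofactor_mx (R : realType) (n00 n01 n02 n10 n11 n12 n20 n21 n22 : R) : 'M[R]_3 :=
  mx3 (n11 * n22 - n12 * n21) (n02 * n21 - n01 * n22) (n01 * n12 - n02 * n11)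
     (n12 * n20 - n10 * n22) (n00 * n22 - n02 * n20) (n02 * n10 - n00 * n12)
     (n10 * n21 - n11 * n20) (n01 * n20 - n00 * n21) (n00 * n11 - n01 * n10).

Section NormalForm.
Variables (R : realType).

Definition first_scale (p : R) : 'M[R]_3 := diag_mx (\row_j if j == 0 then p else 1).

Lemma det_first_scale p : \det (first_scale p) = p.
Proof.
rewrite det_diag !big_ord_recl big_ord0 !mxE /=.
by rewrite !mulr1.
Qed.

(** The frame of p det (x + y Y) + q det (x Z + y), for the vector (x, y) of R^3 + R^3. *)
Definition two_planes (p q : R) (Y Z : 'M[R]_3) : 'M[R]_(3 + 3) :=
  block_mx (first_scale p) (Z *m first_scale q) (Y *m first_scale p) (first_scale q).

Lemma two_planesE p q Y Z (x1 y1 x2 y2 x3 y3 : 'rV[R]_3) :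
  pullback (two_planes p q Y Z) (@rho_plus R)
     (rows3 (row_mx x1 y1 : 'rV[R]_(3 + 3)) (row_mx x2 y2) (row_mx x3 y3)) =
  p * \det (rows3 (x1 + y1 *m Y) (x2 + y2 *m Y) (x3 + y3 *m Y)) +
  q * \det (rows3 (x1 *m Z + y1) (x2 *m Z + y2) (x3 *m Z + y3)).
Proof.
rewrite /pullback rows3_mul rho_plus_rows3 /two_planes !mul_row_block !mulmxA.
rewrite !row_mxKl !row_mxKr -!mulmxDl -!rows3_mul !det_mulmx !det_first_scale.
by rewrite mulrC [X in _ + X]mulrC.
Qed.

(** A form without components of bidegree (2, 1) is rho_plus in the frame [two_planes] for suitable
multiples Z and Y of N and of its adjugate.  Since N times its adjugate is det N, matching the
components leaves equations in the scalars only, and these reduce to one quadratic equation for u. *)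
Lemma normal_form (w : multivec R (3 + 3) 3) (a b u n00 n01 n02 n10 n11 n12 n20 n21 n22 : R) :
  let N := mx3 n00 n01 n02 n10 n11 n12 n20 n21 n22 in
  let p := a / (1 + u) in let q := b / (1 - u ^+ 2) in
  let z := (1 - u) / b in let y := - (q / p) * z ^+ 2 in
  let Y := y *: cofactor_mx n00 n01 n02 n10 n11 n12 n20 n21 n22 in
  alternating_form w ->
  w (rows3 (l_ 0) (l_ 1) (l_ 2)) = a ->
  (forall k, w (rows3 (l_ 0) (l_ 1) (r_ k)) = 0) ->
  (forall k, w (rows3 (l_ 0) (r_ k) (l_ 2)) = 0) ->
  (forall k, w (rows3 (r_ k) (l_ 1) (l_ 2)) = 0) ->
  (forall k, w (rows3 (l_ k) (r_ 1) (r_ 2)) = N k 0) ->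
  (forall k, w (rows3 (l_ k) (r_ 2) (r_ 0)) = N k 1) ->
  (forall k, w (rows3 (l_ k) (r_ 0) (r_ 1)) = N k 2) ->
  w (rows3 (r_ 0) (r_ 1) (r_ 2)) = b ->
  a != 0 -> b != 0 -> 1 + u != 0 -> 1 - u != 0 ->
  a * b ^+ 2 * u = \det N * (1 - u) ^+ 2 ->
  pullback (two_planes p q Y (z *: N)) (@rho_plus R) =1 w.
Proof.
move=> N p q z y Y aw hlll h2 h1 h0 g0 g1 g2 hrrr a0 b0 u1 u2 hu.
set d := \det N in hu.
have dE : d = n00 * (n11 * n22 - n12 * n21) - n01 * (n10 * n22 - n12 * n20)
    + n02 * (n10 * n21 - n11 * n20) by rewrite /d det_mx3 /N !mxE.
have dE' : d = a * b ^+ 2 * u / (1 - u) ^+ 2 by rewrite hu mulfK // expf_neq0.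
have u3 : 1 - u ^+ 2 != 0.
  by rewrite (_ : _ - _ = (1 - u) * (1 + u)) ?mulf_neq0 //; ring.
(* the equations for the components of bidegree (3, 0), (1, 2) and (0, 3) *)
have F1 : p + q * z ^+ 3 * d = a.
  by rewrite dE' /p /q /z; field; rewrite u2 b0 u1 u3.
have F2 : p * y ^+ 2 * d + q * z = 1.
  by rewrite dE' /y /p /q /z; field; rewrite u2 b0 u1 u3 a0.
have F3 : p * y ^+ 3 * d ^+ 2 + q = b.
  by rewrite dE' /y /p /q /z; field; rewrite u2 b0 u1 u3 a0.
have eZ i : (e_ i : 'rV[R]_3) *m (z *: N) = row i (z *: N) by rewrite -rowE.
have eY i : (e_ i : 'rV[R]_3) *m Y = row i Y by rewrite -rowE.
have ar := alternating_pullback (two_planes p q Y (z *: N)) (alternating_rho_plus R).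
have p0 : p != 0 by rewrite mulf_neq0 ?invr_eq0.
have yE : y = - (q * z ^+ 2) / p by rewrite /y !mulNr -mulrA [p^-1 * _]mulrC mulrA.
clearbody d y z q p.
apply: form33_ext => //; try (move=> k); rewrite ?hlll ?hrrr;
  rewrite ?h0 ?h1 ?h2 ?g0 ?g1 ?g2 /lft /rgt two_planesE !(mul0mx, eZ, eY, add0r, addr0);
  rewrite !det_rows3.
- by rewrite -[RHS]F1 dE !mxE /=; ring.
- by case: (ord3P k) => ->; rewrite !mxE /= yE; field.
- by case: (ord3P k) => ->; rewrite !mxE /= yE; field.
- by case: (ord3P k) => ->; rewrite !mxE /= yE; field.
- by rewrite -[RHS]mulr1 -F2 dE; case: (ord3P k) => ->; rewrite !mxE /=; ring.
- by rewrite -[RHS]mulr1 -F2 dE; case: (ord3P k) => ->; rewrite !mxE /=; ring.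
- by rewrite -[RHS]mulr1 -F2 dE; case: (ord3P k) => ->; rewrite !mxE /=; ring.
- by rewrite -[RHS]F3 dE !mxE /=; ring.
Qed.
End NormalForm.

(** Adds to the second summand a combination of the first one. *)
Definition shear (R : realType) (X : 'M[R]_3) : 'M[R]_(3 + 3) := block_mx 1%:M 0 X 1%:M.

Lemma shearK (R : realType) (X : 'M[R]_3) : shear X *m shear (- X) = 1%:M.
Proof.
rewrite /shear mulmx_block !(mulmx0, mul0mx, mulmx1, mul1mx, addr0, add0r) subrr.
by rewrite -scalar_mx_block.
Qed.

Lemma lft_shear (R : realType) (X : 'M[R]_3) u : lft u *m shear X = lft u.
Proof. by rewrite /lft /shear mul_row_block !(mulmx1, mul0mx, mulmx0, addr0). Qed.

Lemma rgt_shear (R : realType) (X : 'M[R]_3) k : r_ k *m shear X =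
  X k 0 *: l_ 0 + 1 *: (X k 1 *: l_ 1 + 1 *: (X k 2 *: l_ 2 + 1 *: r_ k)).
Proof.
rewrite !scale1r /rgt /lft /shear mul_row_block !(mulmx1, mul0mx, mulmx0, add0r) -rowE.
rewrite !scale_row_mx !add_row_mx !scaler0 !add0r; congr row_mx.
rewrite addr0 [LHS]row_sum_delta !big_ord_recl big_ord0 addr0 !mxE.
by congr (_ *: delta_mx _ _ + (_ *: delta_mx _ _ + _ *: delta_mx _ _));
  do ?[congr (X _ _)]; apply/val_inj.
Qed.

(** The root that is continuous at k = 0, in a form without a denominator that vanishes there. *)
Lemma quadratic_root (R : rcfType) (k : R) (s := Num.sqrt (1 + 4 * k))
    (u := 2 * k / (2 * k + 1 + s)) :
  0 < 1 + 4 * k -> 2 * k + 1 + s != 0 -> u = k * (1 - u) ^+ 2.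
Proof.
move=> k0 s0; have hs : s ^+ 2 = 1 + 4 * k by rewrite sqr_sqrtr ?ltW.
have hk : k = (s ^+ 2 - 1) / 4 by rewrite hs; field.
have s1 : s + 1 != 0 by rewrite gt_eqF // ltr_wpDl // sqrtr_ge0.
have -> : u = (s - 1) / (s + 1).
  by rewrite /u; move: s0; rewrite hk => s0; field; rewrite s1 /=; apply: contraNneq s0 => h; apply/eqP; lra.
by rewrite hk; field.
Qed.

Section Explicit.
Variables (R : realType) (w : multivec R (3 + 3) 3).
Hypothesis aw : alternating_form w.

Let a := w (rows3 (l_ 0) (l_ 1) (l_ 2)).
(** The shear that kills the components of bidegree (2, 1). *)
Definition shear_mx : 'M[R]_3 := \matrix_(k, j)
  (- (if j == 0 then w (rows3 (r_ k) (l_ 1) (l_ 2))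
      else if j == 1 then w (rows3 (l_ 0) (r_ k) (l_ 2))
      else w (rows3 (l_ 0) (l_ 1) (r_ k))) / a).
Let w1 := pullback (shear shear_mx) w.
Let b := w1 (rows3 (r_ 0) (r_ 1) (r_ 2)).
Let n i j := w1 (rows3 (l_ i) (r_ (nth 0 [:: 1; 2; 0] j)) (r_ (nth 0 [:: 2; 0; 1] j))).
(** The components of bidegree (1, 2) after the shear. *)
Definition residue_mx : 'M[R]_3 := mx3 (n 0 0) (n 0 1) (n 0 2)
   (n 1 0) (n 1 1) (n 1 2) (n 2 0) (n 2 1) (n 2 2).
Let k := \det residue_mx / (a * b ^+ 2).
Let u := 2 * k / (2 * k + 1 + Num.sqrt (1 + 4 * k)).
Let p := a / (1 + u).
Let q := b / (1 - u ^+ 2).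
Let z := (1 - u) / b.
Let y := - (q / p) * z ^+ 2.
Definition section_mx : 'M[R]_(3 + 3) := shear (- shear_mx) *m
  two_planes p q (y *: cofactor_mx (n 0 0) (n 0 1) (n 0 2)
   (n 1 0) (n 1 1) (n 1 2) (n 2 0) (n 2 1) (n 2 2)) (z *: residue_mx).

Lemma section_mxP : a != 0 -> b != 0 -> 0 < 1 + 4 * k ->
  2 * k + 1 + Num.sqrt (1 + 4 * k) != 0 -> 1 + u != 0 -> 1 - u != 0 ->
  pullback section_mx (@rho_plus R) =1 w.
Proof.
move=> a0 b0 k0 s0 u1 u2 v.
have a1 : alternating_form w1 by exact: alternating_pullback.
have w1E x1 x2 x3 : w1 (rows3 x1 x2 x3) = w (rows3 (x1 *m shear shear_mx)
    (x2 *m shear shear_mx) (x3 *m shear shear_mx)) by rewrite /w1 /pullback rows3_mul.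
have := @normal_form R w1 a b u (n 0 0) (n 0 1) (n 0 2)
   (n 1 0) (n 1 1) (n 1 2) (n 2 0) (n 2 1) (n 2 2) a1.
rewrite -/residue_mx -/p -/q -/z -/y /= => H.
have {}H : pullback (two_planes p q (y *: cofactor_mx (n 0 0) (n 0 1) (n 0 2)
   (n 1 0) (n 1 1) (n 1 2) (n 2 0) (n 2 1) (n 2 2)) (z *: residue_mx)) (@rho_plus R) =1 w1.
  apply: H => //.
  - by rewrite w1E !lft_shear.
  - move=> j; rewrite w1E !lft_shear rgt_shear !(tri_lin3 aw) !mxE /=.
    by rewrite (tri_eq13 aw) (tri_eq23 aw) -/a; field.
  - move=> j; rewrite w1E !lft_shear rgt_shear !(tri_lin2 aw) !mxE /=.
    by rewrite (tri_eq12 aw) (tri_eq23 aw) -/a; field.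
  - move=> j; rewrite w1E !lft_shear rgt_shear !(tri_lin1 aw) !mxE /=.
    by rewrite (tri_eq12 aw) (tri_eq13 aw) -/a; field.
  - by move=> i; case: (ord3P i) => ->; rewrite !mxE.
  - by move=> i; case: (ord3P i) => ->; rewrite !mxE.
  - by move=> i; case: (ord3P i) => ->; rewrite !mxE.
  - have -> : \det residue_mx = k * (a * b ^+ 2).
      by rewrite /k divfK // mulf_neq0 ?expf_neq0.
    by rewrite {1}/u (quadratic_root k0 s0) -/u; ring.
rewrite /section_mx -pullback_comp /pullback.
have := H (v *m shear (- shear_mx)); rewrite /pullback => ->.
by rewrite /w1 /pullback -mulmxA -{2}[shear_mx]opprK shearK mulmx1.
Qed.
End Explicit.

Section LocalSection.
Context {T : Type} {F : set_system T} {FF : Filter F} {R : realType}.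

Lemma mcvg_mx3 (a b c d e f g h k : T -> R) a' b' c' d' e' f' g' h' k' :
  a @ F --> (a' : R) -> b @ F --> (b' : R) -> c @ F --> (c' : R) ->
  d @ F --> (d' : R) -> e @ F --> (e' : R) -> f @ F --> (f' : R) ->
  g @ F --> (g' : R) -> h @ F --> (h' : R) -> k @ F --> (k' : R) ->
  mcvg F (fun z => mx3 (a z) (b z) (c z) (d z) (e z) (f z) (g z) (h z) (k z))
    (mx3 a' b' c' d' e' f' g' h' k').
Proof.
move=> *; move=> i j; rewrite mxE; under eq_fun do rewrite mxE.
by case: (ord3P i) => ->; case: (ord3P j) => ->.
Qed.

(** All entries of [section_mx] are algebraic functions of the coefficients of w, defined and
continuous near rho_plus, where the frame is the identity.  This is the continuity of a section of
the orbit map of GL(6) near rho_plus; it shows in particular that the orbit is open. *)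
Lemma local_section (w : T -> multivec R (3 + 3) 3) :
  (forall z, alternating_form (w z)) ->
  (forall v, (fun z => w z v) @ F --> rho_plus v) ->
  exists2 A : T -> 'M[R]_(3 + 3), mcvg F A 1%:M & \forall z \near F, SL3_frame (w z) (A z).
Proof.
move=> aw cw.
pose a z : R := w z (rows3 (l_ 0) (l_ 1) (l_ 2)).
pose X z := shear_mx (w z).
pose w1 z := pullback (shear (X z)) (w z).
pose b z : R := w1 z (rows3 (r_ 0) (r_ 1) (r_ 2)).
pose n (i j : 'I_3) z : R := w1 z (rows3 (l_ i) (r_ (nth 0 [:: 1; 2; 0] j)) (r_ (nth 0 [:: 2; 0; 1] j))).
pose N z := residue_mx (w z).
pose k z : R := \det (N z) / (a z * b z ^+ 2).
pose s z : R := Num.sqrt (1 + 4 * k z).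
pose u z : R := 2 * k z / (2 * k z + 1 + s z).
pose p z : R := a z / (1 + u z).
pose q z : R := b z / (1 - u z ^+ 2).
pose c z : R := (1 - u z) / b z.
pose y z : R := - (q z / p z) * c z ^+ 2.
pose C z := cofactor_mx (n 0 0 z) (n 0 1 z) (n 0 2 z)
   (n 1 0 z) (n 1 1 z) (n 1 2 z) (n 2 0 z) (n 2 1 z) (n 2 2 z).
pose A z := shear (- X z) *m two_planes (p z) (q z) (y z *: C z) (c z *: N z).
have c1 : (fun=> 1 : R) @ F --> (1 : R) by exact: cvg_cst.
have c2 (r : R) : (fun=> r : R) @ F --> r by exact: cvg_cst.
have ca : a @ F --> (1 : R).
  rewrite (_ : 1 = rho_plus (rows3 (l_ 0) (l_ 1) (l_ 2)) :> R) //; first exact: cw.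
  by rewrite rho_plus_rows3 /lft !row_mxKl !row_mxKr !det_rows3 !mxE /=; ring.
have ca' : (fun z => (a z)^-1) @ F --> (1 : R).
  by rewrite -[1]invr1; apply: cvgV ca; exact: oner_neq0.
have cX : mcvg F X 0.
  have h v : rho_plus v = 0 :> R -> (fun z => - w z v / a z) @ F --> (0 : R).
    by move=> hv; rewrite -(mul0r 1) -oppr0 -hv; apply: cvgM ca'; exact: cvgN (cw v).
  move=> i j; rewrite mxE; under eq_fun do rewrite mxE.
  by case: (ord3P j) => -> /=; apply: h;
    rewrite rho_plus_rows3 /lft /rgt !row_mxKl !row_mxKr !det_rows3 !mxE /=; ring.
have cS : mcvg F (fun z => shear (X z)) 1%:M.
  rewrite scalar_mx_block; apply: mcvg_block => //; exact: mcvg_cst.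
have cw1 v : (fun z => w1 z v) @ F --> rho_plus v.
  rewrite /w1 /pullback -[v in X in _ --> X]mulmx1.
  apply: cvg_form => //; first exact: alternating_rho_plus.
  by apply: mcvgM cS; exact: mcvg_cst.
have cb : b @ F --> (1 : R).
  rewrite (_ : 1 = rho_plus (rows3 (r_ 0) (r_ 1) (r_ 2)) :> R) //; first exact: cw1.
  by rewrite rho_plus_rows3 /rgt !row_mxKl !row_mxKr !det_rows3 !mxE /=; ring.
have cn i j : n i j @ F --> (0 : R).
  rewrite (_ : 0 = rho_plus (rows3 (l_ i) (r_ (nth 0 [:: 1; 2; 0] j)) (r_ (nth 0 [:: 2; 0; 1] j))) :> R);
    first exact: cw1.
  rewrite rho_plus_rows3 /lft /rgt !row_mxKl !row_mxKr !det_rows3.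
  have z m : (0 : 'rV[R]_3) 0 m = 0 by rewrite mxE.
  by rewrite !z; ring.
have mx30 : mx3 (0 : R) 0 0 0 0 0 0 0 0 = 0.
  by apply/matrixP => i j; rewrite !mxE; case: (ord3P i) => ->; case: (ord3P j) => ->.
have NE : N = fun z => mx3 (n 0 0 z) (n 0 1 z) (n 0 2 z) (n 1 0 z) (n 1 1 z) (n 1 2 z)
    (n 2 0 z) (n 2 1 z) (n 2 2 z) by [].
have cN : mcvg F N 0.
  rewrite NE -mx30; exact: (mcvg_mx3 (cn 0 0) (cn 0 1) (cn 0 2) (cn 1 0) (cn 1 1) (cn 1 2)
    (cn 2 0) (cn 2 1) (cn 2 2)).
have cC : mcvg F C 0.
  have h i j i' j' k1 l1 k' l' :
      (fun z => n i j z * n i' j' z - n k1 l1 z * n k' l' z) @ F --> (0 : R).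
    rewrite -[X in _ --> X](subrr (0 * 0)).
    by apply: cvgB; apply: cvgM; exact: cn.
  rewrite -mx30; exact: (mcvg_mx3 (h 1 1 2 2 1 2 2 1) (h 0 2 2 1 0 1 2 2) (h 0 1 1 2 0 2 1 1)
    (h 1 2 2 0 1 0 2 2) (h 0 0 2 2 0 2 2 0) (h 0 2 1 0 0 0 1 2)
    (h 1 0 2 1 1 1 2 0) (h 0 1 2 0 0 0 2 1) (h 0 0 1 1 0 1 1 0)).
have ck : k @ F --> (0 : R).
  rewrite -[X in _ --> X](mul0r (1 * 1 ^+ 2)^-1); apply: cvgM.
    by rewrite -(det0 R 2); exact: cvg_det.
  apply: cvgV; first by rewrite expr1n mulr1 oner_neq0.
  by apply: cvgM ca _; exact: (cvgM cb cb).
have ck4 : (fun z => 1 + 4 * k z) @ F --> (1 : R).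
  rewrite -[X in _ --> X](_ : 1 + 4 * 0 = 1); last by ring.
  by apply: cvgD => //; exact: cvgM.
have cs : s @ F --> (1 : R).
  rewrite -[X in _ --> X]sqrtr1; apply: continuous_cvg ck4; exact: sqrt_continuous.
have cd : (fun z => 2 * k z + 1 + s z) @ F --> (2 : R).
  rewrite -[X in _ --> X](_ : 2 * 0 + 1 + 1 = 2); last by ring.
  by apply: cvgD cs; apply: cvgD => //; exact: cvgM.
have cu : u @ F --> (0 : R).
  rewrite -[X in _ --> X](_ : 2 * 0 / 2 = 0); last by ring.
  by apply: cvgM; [exact: cvgM | apply: cvgV cd; rewrite pnatr_eq0].
have cu1 : (fun z => 1 + u z) @ F --> (1 : R).
  by rewrite -[X in _ --> X]addr0; exact: cvgD.
have cu2 : (fun z => 1 - u z) @ F --> (1 : R).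
  by rewrite -[X in _ --> X]subr0; exact: cvgB.
have cp : p @ F --> (1 : R).
  rewrite -[X in _ --> X](_ : 1 / 1 = 1); last by rewrite divr1.
  by apply: cvgM => //; apply: cvgV => //; exact: oner_neq0.
have cq : q @ F --> (1 : R).
  rewrite -[X in _ --> X](_ : 1 / (1 - 0 * 0) = 1); last by rewrite mulr0 subr0 divr1.
  apply: cvgM => //; apply: cvgV; first by rewrite mulr0 subr0 oner_neq0.
  by apply: cvgB => //; exact: cvgM.
have cc : c @ F --> (1 : R).
  rewrite -[X in _ --> X](_ : 1 / 1 = 1); last by rewrite divr1.
  by apply: cvgM => //; apply: cvgV => //; exact: oner_neq0.
have cy : y @ F --> (- (1 / 1) * (1 * 1) : R).
  apply: cvgM; last exact: cvgM.
  by apply: cvgN; apply: cvgM => //; apply: cvgV => //; exact: oner_neq0.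
have cfs (f : T -> R) : f @ F --> (1 : R) -> mcvg F (fun z => first_scale (f z)) 1%:M.
  move=> cf i j; rewrite mxE; under eq_fun do rewrite !mxE.
  case: (ord3P i) => ->; case: (ord3P j) => -> //=; rewrite ?mulr1n //; exact: cvg_cst.
have cA : mcvg F A 1%:M.
  rewrite -[X in mcvg _ _ X]mulmx1; apply: mcvgM.
    rewrite scalar_mx_block; apply: mcvg_block; try exact: mcvg_cst.
    by rewrite -oppr0; exact: mcvgN.
  rewrite scalar_mx_block; apply: mcvg_block; try exact: cfs.
    by rewrite -(mul0mx _ 1%:M) -(scaler0 _ 1); apply: mcvgM; [exact: mcvgZ|exact: cfs].
  rewrite -(mul0mx _ 1%:M) -(scaler0 _ (- (1 / 1) * (1 * 1))).
  by apply: mcvgM; [exact: mcvgZ|exact: cfs].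
exists A => //.
have dA : \forall z \near F, 0 < \det (A z).
  by apply: (cvgr_gt (\det (1%:M : 'M[R]_(3 + 3)))); [exact: cvg_det|rewrite det1 ltr01].
have n0 (f : T -> R) r : f @ F --> r -> r != 0 -> \forall z \near F, f z != 0.
  by move=> cf; exact: cvgr_neq0.
near=> z; split; first by near: z.
apply: section_mxP => //.
- by near: z; apply: (n0 _ _ ca); exact: oner_neq0.
- by near: z; apply: (n0 _ _ cb); exact: oner_neq0.
- by near: z; apply: (cvgr_gt _ ck4); exact: ltr01.
- by near: z; apply: (n0 _ _ cd); rewrite pnatr_eq0.
- by near: z; apply: (n0 _ _ cu1); exact: oner_neq0.
- by near: z; apply: (n0 _ _ cu2); exact: oner_neq0.
Unshelve. all: by end_near.
Qed.

End LocalSection.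

(** * Local continuity of frames *)

Section FrameNear.
Context {T : Type} {F : set_system T} {FF : Filter F} {R : realType}.
Variables (w : T -> multivec R 6 3) (w0 : multivec R 6 3) (A0 : 'M[R]_6).
Hypotheses (aw : forall z, alternating_form (w z)).
Hypotheses (cw : forall v, (fun z => w z v) @ F --> w0 v) (f0 : SL3_frame w0 A0).

(** The local section, moved by a frame of the limit. *)
Lemma SL3_frame_near :
  exists2 A : T -> 'M[R]_6, mcvg F A A0 & \forall z \near F, SL3_frame (w z) (A z).
Proof.
have [dA0 hA0] := f0.
have uA0 : A0 \in unitmx by rewrite unitmxE unitfE gt_eqF.
have [||A cA fA] := @local_section _ F _ R (fun z => pullback (invmx A0) (w z)).
- by move=> z; exact: alternating_pullback.
- move=> v; have -> : rho_plus v = w0 (v *m invmx A0) by rewrite -hA0 /pullback mulmxKV.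
  exact: cw.
exists (fun z => A0 *m A z).
  by rewrite -[X in mcvg _ _ X]mulmx1; apply: mcvgM => //; exact: mcvg_cst.
apply: filterS fA => z [dA hA]; split; first by rewrite det_mulmx mulr_gt0.
move=> v; rewrite -pullback_comp.
by have := hA (v *m A0); rewrite /pullback => ->; rewrite mulmxK.
Qed.

Lemma para_complex_cvg : mcvg F (fun z => para_complex (w z)) (para_complex w0).
Proof.
have [A cA fA] := SL3_frame_near; rewrite (para_complexE f0).
have uA0 : A0 \in unitmx by rewrite unitmxE unitfE gt_eqF //; case: f0.
have h : mcvg F (fun z => A z *m I0 R *m invmx (A z)) (A0 *m I0 R *m invmx A0).
  by apply: mcvgM; [apply: mcvgM => //; exact: mcvg_cst|exact: mcvgV].
move=> i j; apply: cvg_trans (h i j); apply: near_eq_cvg.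
by apply: filterS fA => z /para_complexE ->.
Qed.
End FrameNear.

Lemma para_complex_sqr (R : realType) (w : multivec R 6 3) A :
  SL3_frame w A -> para_complex w *m para_complex w = 1%:M.
Proof.
move=> f; rewrite (para_complexE f).
have uA : A \in unitmx by rewrite unitmxE unitfE gt_eqF //; case: f.
rewrite !mulmxA mulmxKV // -[A *m _ *m _]mulmxA.
rewrite (_ : I0 R *m I0 R = 1%:M) ?mulmx1 ?mulmxV //.
change ((block_mx 1%:M 0 0 (- 1%:M) : 'M[R]_(3 + 3)) *m block_mx 1%:M 0 0 (- 1%:M) = 1%:M).
rewrite mulmx_block !(mulmx0, mul0mx, mulmx1, mul1mx, addr0, add0r, mulmxN, opprK).
by rewrite -scalar_mx_block.
Qed.

Lemma SL3_frame_pullback (R : realType) (w : multivec R 6 3) (A M : 'M[R]_6) :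
  0 < \det M -> SL3_frame w A -> SL3_frame (pullback M w) (M *m A).
Proof.
move=> dM [dA hA]; split; first by rewrite det_mulmx mulr_gt0.
by move=> v; rewrite -pullback_comp /pullback -hA.
Qed.

Lemma para_complex_pullback (R : realType) (w : multivec R 6 3) (A M : 'M[R]_6) :
  0 < \det M -> SL3_frame w A ->
  para_complex (pullback M w) = M *m para_complex w *m invmx M.
Proof.
move=> dM f; rewrite (para_complexE f) (para_complexE (SL3_frame_pullback dM f)).
have uA : A \in unitmx by rewrite unitmxE unitfE gt_eqF //; case: f.
have uM : M \in unitmx by rewrite unitmxE unitfE gt_eqF.
have -> : invmx (M *m A) = invmx A *m invmx M.
  have uMA : M *m A \in unitmx by rewrite unitmx_mul uM.
  apply: (can_inj (mulKmx uMA)); rewrite mulmxV // mulmxA -(mulmxA M) mulmxV //.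
  by rewrite mulmx1 mulmxV.
by rewrite !mulmxA.
Qed.

(** * Transport along a path of involutions *)

Lemma mcvg_comp (R : realType) (S T : Type) (F : set_system S) (G : set_system T) m n
    (g : S -> T) (f : T -> 'M[R]_(m, n)) l :
  g @ F --> G -> mcvg G f l -> mcvg F (fun z => f (g z)) l.
Proof. by move=> gG fl i j; apply: cvg_comp (fl i j). Qed.

Lemma cvg_to_pair (T : Type) (U V : topologicalType) (F : set_system T) {FF : Filter F}
    (f : T -> U) (g : T -> V) (u : U) (v : V) :
  f @ F --> u -> g @ F --> v -> (fun z => (f z, g z)) @ F --> (u, v).
Proof. by move=> fu gv; exact: (@cvg_pair _ _ _ F (nbhs u) (nbhs v) _ _ _ f g). Qed.

Definition mcontinuous (R : realType) (X : topologicalType) m n (f : X -> 'M[R]_(m, n)) : Prop :=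
  forall x, mcvg (nbhs x) f (f x).

Section Transport.
Context {R : realType} {X : topologicalType} {n : nat}.
Variable J : R -> X -> 'M[R]_n.

(** With J^2 = 1, the factor 1 + J J' satisfies J (1 + J J') = (1 + J J') J', and it is close to 2
when J' is close to J.  The product over a fine subdivision of the interval conjugates both ends. *)
Fixpoint transport (h : R) (k : nat) (x : X) : 'M[R]_n :=
  if k is j.+1 then transport h j x *m (1%:M + J (j%:R * h) x *m J (j.+1%:R * h) x)
  else 1%:M.

Hypothesis JJ : forall t x, J t x *m J t x = 1%:M.

Lemma transportJ h k x : J 0 x *m transport h k x = transport h k x *m J (k%:R * h) x.
Proof.
elim: k => [|k IH] /=; first by rewrite mul0r mulmx1 mul1mx.
rewrite mulmxA IH -!mulmxA; congr (_ *m _).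
by rewrite mulmxDr mulmxDl mulmx1 mul1mx mulmxA JJ mul1mx -mulmxA JJ mulmx1 addrC.
Qed.

Lemma transport_ext h k x y : (forall t, J t x = J t y) -> transport h k x = transport h k y.
Proof. by move=> e; elim: k => //= k ->; rewrite !e. Qed.

Hypothesis Jc : mcontinuous (fun z : R * X => J z.1 z.2).

Lemma slice_continuous t : mcontinuous (J t).
Proof.
move=> x; have ct : (fun y => (t, y)) @ x --> (t, x).
  by apply: cvg_to_pair; [exact: cvg_cst | exact: cvg_id].
exact: (mcvg_comp ct (@Jc (t, x))).
Qed.

Lemma transport_cont h k : mcontinuous (transport h k).
Proof.
elim: k => [|k IH] x /=; first exact: mcvg_cst.
apply: mcvgM; first exact: IH.
by apply: mcvgD; [exact: mcvg_cst | apply: mcvgM; exact: slice_continuous].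
Qed.

Lemma transport_unit (K : set X) : compact K -> exists m : nat,
  forall x, K x -> transport m.+1%:R^-1 m.+1 x \in unitmx.
Proof.
move=> cK.
have cA : compact ((`[0, 1]%classic : set R) `*` K) by apply: compact_setX cK; exact: segment_compact.
have [//|] := ((compact_near_coveringP _).1 cA _ (nbhs (0 : R))
  (fun h z => (1%:M + J z.1 z.2 *m J (z.1 + h) z.2) \in unitmx) _).
  move=> [t x] _; pose f (q : (R * X) * R) : 'M[R]_n :=
    1%:M + J q.1.1 q.1.2 *m J (q.1.1 + q.2) q.1.2.
  have cf : mcvg (filter_prod (nbhs (t, x)) (nbhs (0 : R))) f (1%:M + J t x *m J t x).
    apply: mcvgD; first exact: mcvg_cst.
    have c1 : (fun q : (R * X) * R => q.1) @ filter_prod (nbhs (t, x)) (nbhs (0 : R)) --> (t, x).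
      exact: cvg_fst.
    have c11 : (fun q : (R * X) * R => q.1.1) @ filter_prod (nbhs (t, x)) (nbhs (0 : R)) --> t.
      by apply: cvg_comp c1 _; exact: cvg_fst.
    have c12 : (fun q : (R * X) * R => q.1.2) @ filter_prod (nbhs (t, x)) (nbhs (0 : R)) --> x.
      by apply: cvg_comp c1 _; exact: cvg_snd.
    have c2 : (fun q : (R * X) * R => q.2) @ filter_prod (nbhs (t, x)) (nbhs (0 : R)) --> (0 : R).
      exact: cvg_snd.
    have c3 : (fun q : (R * X) * R => (q.1.1 + q.2, q.1.2))
        @ filter_prod (nbhs (t, x)) (nbhs (0 : R)) --> (t, x).
      by apply: cvg_to_pair => //=; rewrite -[X in _ --> X]addr0; exact: cvgD.
    by apply: mcvgM; [exact: (mcvg_comp c1 (@Jc (t, x))) | exact: (mcvg_comp c3 (@Jc (t, x)))].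
  apply: (near_unitmx cf); rewrite JJ -mulr2n -scaler_nat.
  by rewrite unitmxE detZ det1 mulr1 unitfE expf_neq0 // pnatr_eq0.
move=> e /= e0 he; set m := Num.trunc e^-1; exists m => x Kx.
have hm : `|0 - m.+1%:R^-1| < e.
  rewrite sub0r normrN ger0_norm ?invr_ge0 //.
  by rewrite invf_plt ?posrE // Num.Theory.truncnS_gt.
have step (k : nat) : (k <= m.+1)%N -> transport m.+1%:R^-1 k x \in unitmx.
  elim: k => [|k IH] km /=; first by rewrite unitmx1.
  rewrite unitmx_mul IH ?(ltnW km) //=.
  have -> : k.+1%:R / m.+1%:R = k%:R / m.+1%:R + m.+1%:R^-1 :> R.
    by rewrite -[k.+1]addn1 natrD mulrDl mul1r.
  apply: (he _ hm (k%:R / m.+1%:R, x)).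
  split=> //=; rewrite in_itv /= divr_ge0 //= ler_pdivrMr // mul1r ler_nat ltnW //.
exact: (step _ (leqnn _)).
Qed.
End Transport.

(** A homotopy of fields of involutions is a continuous conjugation over a compact set.  The last
clause keeps track of periods: the conjugation depends on the path J - x only. *)
Theorem involution_transport (R : realType) (X : topologicalType) n (J : R -> X -> 'M[R]_n) (K : set X) :
  (forall t x, J t x *m J t x = 1%:M) ->
  mcontinuous (fun z : R * X => J z.1 z.2) -> compact K ->
  exists T : X -> 'M[R]_n, [/\ mcontinuous T, forall x, K x -> T x \in unitmx,
    forall x, J 0 x *m T x = T x *m J 1 x &
    forall x y, (forall t, J t x = J t y) -> T x = T y].
Proof.
move=> JJ Jc cK; have [m hm] := transport_unit JJ Jc cK.
exists (transport J m.+1%:R^-1 m.+1); split => //.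
- exact: transport_cont.
- by move=> x; rewrite transportJ // divff.
- by move=> x y e; exact: transport_ext.
Qed.

(** * Parity of line fields on the torus *)

Section LineParity.
Variable R : realType.

(** The intermediate value theorem for a function without zeros. *)
Lemma pos_on_segment (f : R -> R) : continuous f ->
  (forall t, 0 <= t <= 1 -> f t != 0) -> 0 < f 0 -> 0 < f 1.
Proof.
move=> cf fN0 f0; rewrite ltNge; apply/negP => f1.
have [|t] := @IVT R f 0 1 0 ler01 (continuous_subspaceT cf).
  by rewrite ge_min f1 orbT /= le_max (ltW f0).
by rewrite in_itv /= => t01 ft; have := fN0 t t01; rewrite ft eqxx.
Qed.

Variables (n : nat) (Q : R * R -> 'M[R]_n) (C : 'M[R]_n).

(** The vanishing of the 2 x 2 minors. *)
Definition rank_one (P : 'M[R]_n) : Prop := forall i j k l, P i j * P k l = P i l * P k j.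

Definition dot m (u v : 'rV[R]_m) : R := (u *m v^T) 0 0.

Lemma cvg_dot (T : Type) (F : set_system T) {FF : Filter F} m (f g : T -> 'rV[R]_m) a b :
  mcvg F f a -> mcvg F g b -> (fun z => dot (f z) (g z)) @ F --> dot a b.
Proof. by move=> fa gb; apply: (mcvgM fa (mcvg_tr gb)). Qed.

Lemma dotE m (u v : 'rV[R]_m) : dot u v = \sum_i u 0 i * v 0 i.
Proof. by rewrite /dot mxE; apply: eq_bigr => i _; rewrite mxE. Qed.

Lemma dotZl m c (u v : 'rV[R]_m) : dot (c *: u) v = c * dot u v.
Proof. by rewrite /dot -scalemxAl mxE. Qed.

Lemma dotC m (u v : 'rV[R]_m) : dot u v = dot v u.
Proof. by rewrite !dotE; apply: eq_bigr => i _; rewrite mulrC. Qed.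

Lemma dotZr m c (u v : 'rV[R]_m) : dot u (c *: v) = c * dot u v.
Proof. by rewrite dotC dotZl dotC. Qed.

Lemma dotBl m (u v w : 'rV[R]_m) : dot (u - v) w = dot u w - dot v w.
Proof. by rewrite /dot mulmxBl !mxE. Qed.

Lemma dotNl m (u w : 'rV[R]_m) : dot (- u) w = - dot u w.
Proof. by rewrite /dot mulNmx mxE. Qed.

Lemma dot_ge0 m (u : 'rV[R]_m) : 0 <= dot u u.
Proof. by rewrite dotE sumr_ge0 // => i _; rewrite -expr2 sqr_ge0. Qed.

Lemma dot_eq0 m (u : 'rV[R]_m) : (dot u u == 0) = (u == 0).
Proof.
apply/idP/eqP => [|->]; last by rewrite dotE big1 // => i _; rewrite mxE mul0r.
rewrite dotE psumr_eq0 => [/allP h|i _]; last by rewrite -expr2 sqr_ge0.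
apply/rowP => i; rewrite mxE; apply/eqP.
by have := h i (mem_index_enum _); rewrite mulf_eq0 orbb.
Qed.

Lemma dot_gt0 m (u : 'rV[R]_m) : u != 0 -> 0 < dot u u.
Proof. by rewrite lt_def dot_ge0 dot_eq0 andbT. Qed.

Lemma rank_one_prop (P : 'M[R]_n) (u v : 'rV[R]_n) : rank_one P ->
  u *m P = u -> v *m P = v -> u != 0 -> exists c, v = c *: u.
Proof.
move=> rP uP vP /rV0Pn[l ul].
exists (v 0 l / u 0 l); apply/rowP => j; rewrite !mxE.
apply: (mulIf ul); rewrite mulrAC divfK //.
rewrite -{1}vP -{1}uP -{2}vP -{2}uP !mxE !big_distrl /=; apply: eq_bigr => i _.
rewrite !big_distrr /=; apply: eq_bigr => k _.
rewrite mulrACA rP; ring.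
Qed.

Lemma dot_line_neq0 (P : 'M[R]_n) (u v : 'rV[R]_n) : rank_one P ->
  u *m P = u -> v *m P = v -> u != 0 -> v != 0 -> dot u v != 0.
Proof.
move=> rP uP vP u0 v0; have [c vE] := rank_one_prop rP uP vP u0.
rewrite vE dotZr mulf_neq0 ?dot_eq0 //.
by apply: contraNneq v0 => c0; rewrite vE c0 scale0r.
Qed.

Hypotheses (Qc : mcontinuous Q) (QQ : forall x, Q x *m Q x = Q x).
Hypotheses (Q1 : forall x, rank_one (Q x)).
Hypotheses (Qp1 : forall u v, Q (u + 1, v) = Q (u, v)) (Qp2 : forall u v, Q (u, v + 1) = Q (u, v)).
Hypotheses (CC : C *m C = 1%:M) (Qs : forall u v, Q (- u, - v) = C *m Q (u, v) *m C).

(** A line field on the torus, here the images of projections Q, equivariant under -1 up to an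
involution C, cannot have C = 1 on the line at 0 and C = -1 on the lines at the other three half
periods.  Contracting the square trivialises the line field there by a nonvanishing section b.  The
scalar product of b (-x) C and b x is positive, by continuity from x = 0.  At a half period p other
than 0 the sections b p and b (-p) have therefore opposite signs.  For p = (1/2, 0) and (0, 1/2)
these signs compare b along opposite sides of the square, hence also at its corners, so that going
from one corner to the opposite one gives two sign changes, against the sign at (1/2, 1/2). *)
Theorem line_field_parity (b0 : 'rV[R]_n) : b0 != 0 -> b0 *m Q (0, 0) = b0 -> b0 *m C = b0 ->
  (forall b : 'rV[R]_n, b *m Q (2^-1, 0) = b -> b *m C = - b) ->
  (forall b : 'rV[R]_n, b *m Q (0, 2^-1) = b -> b *m C = - b) ->
  (forall b : 'rV[R]_n, b *m Q (2^-1, 2^-1) = b -> b *m C = - b) -> False.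
Proof.
move=> b00 b0Q b0C h1 h2 h3.
(* the reflections in the lines, pulled back by the contraction of the square to 0 *)
pose J (t : R) (x : R * R) := 2 *: Q (t * x.1, t * x.2) - 1%:M.
have JJ t x : J t x *m J t x = 1%:M.
  rewrite /J mulmxBr mulmx1 mulmxBl mul1mx -scalemxAl -scalemxAr QQ opprB addrA.
  rewrite -[X in _ = X]add0r -[in RHS](subrr (J t x)) /J scalerA.
  by apply/matrixP => i j; rewrite !mxE; ring.
have Jc : mcontinuous (fun z : R * (R * R) => J z.1 z.2).
  move=> z; apply: mcvgD; last exact: mcvg_cst.
  apply: mcvgZ; first exact: cvg_cst.
  have c1 : (fun y : R * (R * R) => (y.1 * y.2.1, y.1 * y.2.2)) @ z --> (z.1 * z.2.1, z.1 * z.2.2).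
    have cc : (fun y : R * (R * R) => y.2) @ z --> z.2 by exact: cvg_snd.
    apply: cvg_to_pair; apply: cvgM; try exact: cvg_fst.
      by apply: cvg_comp cc _; exact: cvg_fst.
    by apply: cvg_comp cc _; exact: cvg_snd.
  exact: (mcvg_comp c1 (@Qc _)).
pose K : set (R * R) := (`[-1, 1]%classic : set R) `*` (`[-1, 1]%classic : set R).
have cK : compact K by apply: compact_setX; exact: segment_compact.
have [T [Tc Tu TJ _]] := involution_transport JJ Jc cK.
pose b x := b0 *m T x.
have bN0 x : K x -> b x != 0.
  move=> Kx; apply: contraNneq b00 => bx0.
  by rewrite -(mulmxK (Tu x Kx) b0) -/(b x) bx0 mul0mx.
have bQ x : b x *m Q x = b x.
  have : b x *m J 1 x = b x.
    rewrite /b -mulmxA -TJ mulmxA; congr (_ *m _).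
    by rewrite /J !mul0r mulmxBr mulmx1 -scalemxAr b0Q scaler_nat mulr2n addrK.
  rewrite /J !mul1r -surjective_pairing mulmxBr mulmx1 -scalemxAr => /eqP.
  rewrite subr_eq -mulr2n -(scaler_nat 2 (b x)) => /eqP; apply: scalerI.
  by rewrite pnatr_eq0.
have bc : mcontinuous b by move=> x; apply: mcvgM; [exact: mcvg_cst|exact: Tc].
have dotc (f g : R -> R * R) : continuous f -> continuous g ->
    continuous (fun t => dot (b (f t)) (b (g t))).
  move=> cf cg t.
  have h1' : mcvg (nbhs t) (fun t => b (f t)) (b (f t)) by exact: (mcvg_comp (cf t) (@bc _)).
  have h2' : mcvg (nbhs t) (fun t => b (g t)) (b (g t)) by exact: (mcvg_comp (cg t) (@bc _)).
  exact: (cvg_dot h1' h2').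
have lin (p q r s : R) : continuous (fun t : R => (p + q * t, r + s * t)).
  by move=> t; apply: cvg_to_pair; (apply: cvgD; [exact: cvg_cst|apply: cvgM; [exact: cvg_cst|exact: cvg_id]]).
have KE u v : K (u, v) = ((-1 <= u <= 1) && (-1 <= v <= 1)) :> Prop.
  rewrite /K /setX /= !in_itv /=; apply/propext; split => [[-> ->//]|/andP//].
have neg x : K x -> K (- x.1, - x.2).
  by case: x => u v; rewrite !KE /=; lra.
have negQ u v : (b (- u, - v) *m C) *m Q (u, v) = b (- u, - v) *m C.
  have := bQ (- u, - v); rewrite Qs !mulmxA => /(congr1 (fun z => z *m C)).
  by rewrite -[_ *m C *m C]mulmxA CC mulmx1.
have negN0 u v : K (u, v) -> b (- u, - v) *m C != 0.
  move=> Kx; apply: contraNneq (bN0 _ (neg _ Kx)) => /(congr1 (fun z => z *m C)).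
  by rewrite mul0mx -mulmxA CC mulmx1 => /= ->.
have spos u v : K (u, v) -> 0 < dot (b (- u, - v) *m C) (b (u, v)).
  move=> Kx; pose f (t : R) : R := dot (b (0 + - u * t, 0 + - v * t) *m C) (b (0 + u * t, 0 + v * t)).
  have <- : f 1 = dot (b (- u, - v) *m C) (b (u, v)) by rewrite /f !mulr1 !add0r.
  apply: pos_on_segment.
  - move=> t.
    have h1' : mcvg (nbhs t) (fun t => b (0 + - u * t, 0 + - v * t)) (b (0 + - u * t, 0 + - v * t)).
      exact: (mcvg_comp (@lin _ _ _ _ t) (@bc _)).
    have h2' : mcvg (nbhs t) (fun t => b (0 + u * t, 0 + v * t)) (b (0 + u * t, 0 + v * t)).
      exact: (mcvg_comp (@lin _ _ _ _ t) (@bc _)).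
    exact: (cvg_dot (mcvgM h1' (@mcvg_cst _ _ _ R _ _ C)) h2').
  - move=> t t01; rewrite /f !add0r !mulNr.
    have Kt : K (u * t, v * t) by move: Kx; rewrite !KE; nra.
    by apply: dot_line_neq0 (Q1 (u * t, v * t)) _ _ _ _; [exact: negQ|exact: bQ|exact: negN0|exact: bN0].
  - rewrite /f !mulr0 !add0r.
    have K0 : K (0, 0) by rewrite KE; lra.
    have [c bE] := rank_one_prop (Q1 (0, 0)) b0Q (bQ (0, 0)) b00.
    by rewrite bE -scalemxAl b0C -bE dot_gt0 // bN0.
have opp_half u v : K (u, v) -> Q (- u, - v) = Q (u, v) -> (forall b' : 'rV_n, b' *m Q (u, v) = b' -> b' *m C = - b') ->
    dot (b (- u, - v)) (b (u, v)) < 0.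
  move=> Kx Qe hC; have := spos _ _ Kx.
  rewrite hC; last by rewrite -Qe bQ.
  by rewrite dotNl oppr_gt0.
have K1 : K (2^-1, 0) by rewrite KE; lra.
have K2 : K (0, 2^-1) by rewrite KE; lra.
have K3 : K (2^-1, 2^-1) by rewrite KE; lra.
have half : - 2^-1 + 1 = 2^-1 :> R by field.
have hQ1 v : Q (- 2^-1, v) = Q (2^-1, v) by rewrite -[in RHS]half Qp1.
have hQ2 u : Q (u, - 2^-1) = Q (u, 2^-1) by rewrite -[in RHS]half Qp2.
have n1 : dot (b (- 2^-1, 0)) (b (2^-1, 0)) < 0.
  by have := opp_half _ _ K1; rewrite oppr0 hQ1 => /(_ erefl h1).
have n2 : dot (b (0, - 2^-1)) (b (0, 2^-1)) < 0.
  by have := opp_half _ _ K2; rewrite oppr0 hQ2 => /(_ erefl h2).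
have n3 : dot (b (- 2^-1, - 2^-1)) (b (2^-1, 2^-1)) < 0.
  by have := opp_half _ _ K3; rewrite hQ1 hQ2 => /(_ erefl h3).
(* the sign at (1/2, 0), carried along the vertical sides *)
have m1 : dot (b (- 2^-1, - 2^-1)) (b (2^-1, - 2^-1)) < 0.
  rewrite -oppr_gt0; pose f (t : R) : R := - dot (b (- 2^-1 + 0 * t, 0 + - 2^-1 * t)) (b (2^-1 + 0 * t, 0 + - 2^-1 * t)).
  have -> : - dot (b (- 2^-1, - 2^-1)) (b (2^-1, - 2^-1)) = f 1 by rewrite /f !mul0r !addr0 !mulr1 !add0r.
  apply: pos_on_segment; last by rewrite /f !mulr0 !addr0 oppr_gt0.
    by move=> t; apply: cvgN; apply: dotc; exact: lin.
  move=> t t01; rewrite /f !mul0r !addr0 !add0r oppr_eq0.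
  apply: dot_line_neq0 (Q1 (2^-1, - 2^-1 * t)) _ _ _ _; rewrite ?bQ ?bN0 //; try by rewrite KE; lra.
  by rewrite -hQ1 bQ.
(* the sign at (0, 1/2), carried along the horizontal sides *)
have m2 : dot (b (2^-1, - 2^-1)) (b (2^-1, 2^-1)) < 0.
  rewrite -oppr_gt0; pose f (t : R) : R := - dot (b (0 + 2^-1 * t, - 2^-1 + 0 * t)) (b (0 + 2^-1 * t, 2^-1 + 0 * t)).
  have -> : - dot (b (2^-1, - 2^-1)) (b (2^-1, 2^-1)) = f 1 by rewrite /f !mul0r !addr0 !mulr1 !add0r.
  apply: pos_on_segment; last by rewrite /f !mulr0 !addr0 oppr_gt0.
    by move=> t; apply: cvgN; apply: dotc; exact: lin.
  move=> t t01; rewrite /f !mul0r !addr0 !add0r oppr_eq0.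
  apply: dot_line_neq0 (Q1 (2^-1 * t, 2^-1)) _ _ _ _; rewrite ?bQ ?bN0 //; try by rewrite KE; lra.
  by rewrite -hQ2 bQ.
have K4 : K (2^-1, - 2^-1) by rewrite KE; lra.
have q12 : b (2^-1, - 2^-1) *m Q (2^-1, 2^-1) = b (2^-1, - 2^-1).
  by rewrite -hQ2 bQ.
have q13 : b (- 2^-1, - 2^-1) *m Q (2^-1, - 2^-1) = b (- 2^-1, - 2^-1).
  by rewrite -hQ1 bQ.
have [c cE] := rank_one_prop (Q1 _) (bQ (2^-1, 2^-1)) q12 (bN0 _ K3).
have [d dE] := rank_one_prop (Q1 _) (bQ (2^-1, - 2^-1)) q13 (bN0 _ K4).
move: n3 m1 m2; rewrite dE !dotZl cE !(dotZl, dotZr).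
have := dot_gt0 (bN0 _ K3); move: (dot _ _) => y y0.
nra.
Qed.
End LineParity.

(** * The quaternion line of a rotation *)

Lemma ord4P (i : 'I_4) : [\/ i = 0, i = 1, i = 2 | i = 3].
Proof.
by case: i => -[|[|[|[|//]]]] h; [apply: Or41|apply: Or42|apply: Or43|apply: Or44];
  apply/val_inj.
Qed.

Lemma sum3 (V : nmodType) (f : 'I_3 -> V) : \sum_k f k = f 0 + f 1 + f 2.
Proof.
by rewrite !big_ord_recl big_ord0 addr0 addrA; congr (_ + f _ + f _); apply/val_inj.
Qed.

Section Quaternion.
Variable R : realType.

(** Four times q_i q_j, for the unit quaternions q and -q over the rotation B. *)
Definition quat_entry (B : 'M[R]_3) (i j : nat) : R :=
  match i, j with
  | 0%N, 0%N => 1 + B 0 0 + B 1 1 + B 2 2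
  | 1%N, 1%N => 1 + B 0 0 - B 1 1 - B 2 2
  | 2%N, 2%N => 1 - B 0 0 + B 1 1 - B 2 2
  | 3%N, 3%N => 1 - B 0 0 - B 1 1 + B 2 2
  | 0%N, 1%N | 1%N, 0%N => B 2 1 - B 1 2
  | 0%N, 2%N | 2%N, 0%N => B 0 2 - B 2 0
  | 0%N, 3%N | 3%N, 0%N => B 1 0 - B 0 1
  | 1%N, 2%N | 2%N, 1%N => B 0 1 + B 1 0
  | 1%N, 3%N | 3%N, 1%N => B 0 2 + B 2 0
  | 2%N, 3%N | 3%N, 2%N => B 1 2 + B 2 1
  | _, _ => 0
  end.

(** The projection on the line of the two quaternions over B.  It is continuous in B, which a choice
of one of them is not. *)
Definition quat_line (B : 'M[R]_3) : 'M[R]_4 := \matrix_(i, j) (4^-1 * quat_entry B i j).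

Definition quat_conj : 'M[R]_4 := diag_mx (\row_j if j == 0 then 1 else - 1).

Lemma quat_conjK : quat_conj *m quat_conj = 1%:M.
Proof.
rewrite mulmx_diag -diag_const_mx; congr diag_mx; apply/rowP => j; rewrite !mxE.
by case: ifP; rewrite ?mulr1 // mulrNN mulr1.
Qed.

Lemma quat_line_tr B : quat_line B^T = quat_conj *m quat_line B *m quat_conj.
Proof.
rewrite mul_diag_mx mul_mx_diag; apply/matrixP => i j; rewrite !mxE.
by case: (ord4P i) => ->; case: (ord4P j) => ->; rewrite /= !mxE; ring.
Qed.

Lemma quat_line_cont (T : Type) (F : set_system T) {FF : Filter F} (B : T -> 'M[R]_3) B0 :
  mcvg F B B0 -> mcvg F (fun z => quat_line (B z)) (quat_line B0).
Proof.
move=> cB i j; rewrite mxE; under eq_fun do rewrite mxE.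
have D (f g : T -> R) (a b : R) : f @ F --> a -> g @ F --> b -> (fun z => f z + g z) @ F --> a + b.
  exact: cvgD.
have N (f : T -> R) (a : R) : f @ F --> a -> (fun z => - f z) @ F --> - a by exact: cvgN.
have c1 : (fun=> 1 : R) @ F --> (1 : R) by exact: cvg_cst.
apply: cvgM; first exact: cvg_cst.
by case: (ord4P i) => ->; case: (ord4P j) => -> /=;
  repeat first [exact: c1|exact: cB|simple apply D|simple apply N].
Qed.

Lemma rank_one_minors n (P : 'M[R]_n) :
  (forall i j k l : 'I_n, (i < k)%N -> (j < l)%N -> P i j * P k l = P i l * P k j) -> rank_one P.
Proof.
move=> h i j k l.
case: (ltngtP i k) => [ik|ki|/val_inj ->]; last by rewrite mulrC.
  case: (ltngtP j l) => [jl|lj|/val_inj -> //]; first exact: h.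
  by rewrite (h i l k j).
case: (ltngtP j l) => [jl|lj|/val_inj -> //].
  by rewrite mulrC [RHS]mulrC -h.
by rewrite mulrC [RHS]mulrC h.
Qed.

Lemma ord4_lt (i j : 'I_4) : (i < j)%N ->
  i = 0 /\ j = 1 \/ i = 0 /\ j = 2 \/ i = 0 /\ j = 3 \/ i = 1 /\ j = 2 \/ i = 1 /\ j = 3 \/ i = 2 /\ j = 3.
Proof. by case: (ord4P i) => ->; case: (ord4P j) => -> // _; tauto. Qed.

Variable B : 'M[R]_3.
Hypotheses (BBt : B *m B^T = 1%:M) (dB : \det B = 1).

(** The inverse is the adjugate. *)
Lemma rotation_cofactor : B^T = cofactor_mx (B 0 0) (B 0 1) (B 0 2) (B 1 0) (B 1 1) (B 1 2)
  (B 2 0) (B 2 1) (B 2 2).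
Proof.
set D := cofactor_mx _ _ _ _ _ _ _ _ _.
have BD : B *m D = 1%:M.
  rewrite -dB det_mx3; apply/matrixP => i j; rewrite !mxE sum3.
  by case: (ord3P i) => ->; case: (ord3P j) => ->; rewrite !mxE /= ?mulr1n ?mulr0n; ring.
by rewrite -[LHS]mulmx1 -BD mulmxA (mulmx1C BBt) mul1mx.
Qed.

Lemma quat_line_rank_one : rank_one (quat_line B).
Proof.
have e1 i j : \sum_k B i k * B j k = (i == j)%:R.
  by have := congr1 (fun M : 'M[R]_3 => M i j) BBt; rewrite !mxE => <-; apply: eq_bigr => k _; rewrite mxE.
have e2 i j : \sum_k B k i * B k j = (i == j)%:R.
  have := congr1 (fun M : 'M[R]_3 => M i j) (mulmx1C BBt); rewrite !mxE => <-.
  by apply: eq_bigr => k _; rewrite mxE.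
have e3 i j := congr1 (fun M : 'M[R]_3 => M i j) rotation_cofactor.
have := (e1 0 0, e1 0 1, e1 0 2, e1 1 1, e1 1 2, e1 2 2, e2 0 0, e2 0 1, e2 0 2, e2 1 1, e2 1 2, e2 2 2).
have := (e3 0 0, e3 0 1, e3 0 2, e3 1 0, e3 1 1, e3 1 2, e3 2 0, e3 2 1, e3 2 2).
rewrite !sum3 !mxE /= {e1 e2 e3}.
move=> [[[[[[[[h1 h2] h3] h4] h5] h6] h7] h8] h9].
move=> [[[[[[[[[[[g1 g2] g3] g4] g5] g6] g7] g8] g9] g10] g11] g12].
apply: rank_one_minors => i j k l ik jl; rewrite !mxE.
case: (ord4_lt ik) => [|[|[|[|[|]]]]] [-> ->]; case: (ord4_lt jl) => [|[|[|[|[|]]]]] [-> ->] /=; lra.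
Qed.

(** A matrix of rank one with trace 1. *)
Lemma quat_line_idem : quat_line B *m quat_line B = quat_line B.
Proof.
apply/matrixP => i j; rewrite [LHS]mxE.
transitivity (\sum_k quat_line B i j * quat_line B k k).
  by apply: eq_bigr => k _; rewrite quat_line_rank_one.
rewrite -big_distrr /= !big_ord_recl big_ord0 !mxE /=.
rewrite (_ : _ + _ = 1) ?mulr1 //.
by field.
Qed.
End Quaternion.

(** * Orthonormalisation *)

Lemma rows3_orthonormal (R : realType) n (a b c : 'rV[R]_n) :
  dot a a = 1 -> dot b b = 1 -> dot c c = 1 -> dot b a = 0 -> dot c a = 0 -> dot c b = 0 ->
  rows3 a b c *m (rows3 a b c)^T = 1%:M.
Proof.
move=> aa bb cc ba ca cb.
have r0 : row 0 (rows3 a b c) = a by apply/rowP => j; rewrite !mxE.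
have r1 : row 1 (rows3 a b c) = b by apply/rowP => j; rewrite !mxE.
have r2 : row 2 (rows3 a b c) = c by apply/rowP => j; rewrite !mxE.
have e (i j : 'I_3) : (rows3 a b c *m (rows3 a b c)^T) i j =
    dot (row i (rows3 a b c)) (row j (rows3 a b c)).
  by rewrite dotE mxE; apply: eq_bigr => k _; rewrite [in RHS]mxE [X in _ = _ * X]mxE [X in _ * X = _]mxE.
apply/matrixP => i j; rewrite e [RHS]mxE.
by case: (ord3P i) => ->; case: (ord3P j) => ->; rewrite ?r0 ?r1 ?r2 // dotC.
Qed.

Lemma rows3_sub (R : realType) n m (a b c : 'rV[R]_n) (M : 'M[R]_(m, n)) :
  (a <= M)%MS -> (b <= M)%MS -> (c <= M)%MS -> (rows3 a b c <= M)%MS.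
Proof.
move=> ha hb hc; apply/row_subP => i.
case: (ord3P i) => ->.
- by rewrite (_ : row 0 _ = a) //; apply/rowP => j; rewrite !mxE.
- by rewrite (_ : row 1 _ = b) //; apply/rowP => j; rewrite !mxE.
- by rewrite (_ : row 2 _ = c) //; apply/rowP => j; rewrite !mxE.
Qed.

Lemma sub_rows3 (R : realType) n (a b c : 'rV[R]_n) :
  [/\ (a <= rows3 a b c)%MS, (b <= rows3 a b c)%MS & (c <= rows3 a b c)%MS].
Proof.
split.
- by rewrite -{1}(_ : row 0 (rows3 a b c) = a) ?row_sub //; apply/rowP => j; rewrite !mxE.
- by rewrite -{1}(_ : row 1 (rows3 a b c) = b) ?row_sub //; apply/rowP => j; rewrite !mxE.
- by rewrite -{1}(_ : row 2 (rows3 a b c) = c) ?row_sub //; apply/rowP => j; rewrite !mxE.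
Qed.

Lemma rows3_cvg (R : realType) n (T : Type) (F : set_system T) {FF : Filter F}
    (f g h : T -> 'rV[R]_n) a b c :
  mcvg F f a -> mcvg F g b -> mcvg F h c ->
  mcvg F (fun z => rows3 (f z) (g z) (h z)) (rows3 a b c).
Proof.
move=> fa gb hc i j; rewrite mxE; under eq_fun do rewrite mxE.
case: (ord3P i) => -> /=; [exact: fa|exact: gb|exact: hc].
Qed.

Section GramSchmidt.
Variables (R : realType) (n : nat).
Implicit Types (u v : 'rV[R]_n) (M : 'M[R]_(3, n)).

Definition normalize u : 'rV[R]_n := (Num.sqrt (dot u u))^-1 *: u.

Lemma dot_normalize u : u != 0 -> dot (normalize u) (normalize u) = 1.
Proof.
move=> u0; have d0 := dot_gt0 u0.
rewrite /normalize dotZl dotZr mulrA -invfM -expr2 sqr_sqrtr ?dot_ge0 //.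
by rewrite mulVf // gt_eqF.
Qed.

Lemma normalizeK u : u != 0 -> Num.sqrt (dot u u) *: normalize u = u.
Proof.
by move=> u0; rewrite scalerA divff ?scale1r // sqrtr_eq0 -ltNge dot_gt0.
Qed.

Lemma normalize_cvg (T : Type) (F : set_system T) {FF : Filter F} (f : T -> 'rV[R]_n) a :
  a != 0 -> mcvg F f a -> mcvg F (fun z => normalize (f z)) (normalize a).
Proof.
move=> a0 fa; apply: mcvgZ => //; apply: cvgV.
  by rewrite sqrtr_eq0 -ltNge dot_gt0.
by apply: continuous_cvg (cvg_dot fa fa); exact: sqrt_continuous.
Qed.

Definition gs1 M := normalize (row 0 M).
Definition gs2' M := row 1 M - dot (row 1 M) (gs1 M) *: gs1 M.
Definition gs2 M := normalize (gs2' M).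
Definition gs3' M := row 2 M - dot (row 2 M) (gs1 M) *: gs1 M - dot (row 2 M) (gs2 M) *: gs2 M.
Definition gs3 M := normalize (gs3' M).
Definition gram_schmidt M := rows3 (gs1 M) (gs2 M) (gs3 M).

(** Linear independence of the three rows. *)
Lemma row_free_comb M (a b c : R) : row_free M ->
  a *: row 0 M + b *: row 1 M + c *: row 2 M = 0 -> [/\ a = 0, b = 0 & c = 0].
Proof.
move=> fM h.
have : (\row_(j < 3) [:: a; b; c]`_j) *m M = 0 *m M.
  by rewrite mul0mx -[RHS]h; apply/rowP => j; rewrite !mxE sum3 !mxE /=; ring.
move/(row_free_inj fM) => /rowP e.
by split; [have := e 0 | have := e 1 | have := e 2]; rewrite !mxE.
Qed.

Variable M : 'M[R]_(3, n).
Hypothesis fM : row_free M.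

Lemma gs1_neq0 : row 0 M != 0.
Proof.
apply/eqP => h; have [] := @row_free_comb M 1 0 0 fM.
  by rewrite !scale0r !addr0 scale1r.
by move=> /eqP; rewrite oner_eq0.
Qed.

Lemma gs1E : exists p, gs1 M = p *: row 0 M.
Proof. by eexists. Qed.

Lemma gs2_neq0 : gs2' M != 0.
Proof.
have [q gs1e] := gs1E; apply/eqP; rewrite /gs2' gs1e => h.
have [|_ /eqP h1 _] := @row_free_comb M (- (dot (row 1 M) (q *: row 0 M) * q)) 1 0 fM;
  last by rewrite oner_eq0 in h1.
by rewrite scale0r addr0 scale1r scaleNr -scalerA addrC.
Qed.

Lemma gs2E : exists p q, gs2 M = p *: row 0 M + q *: row 1 M.
Proof.
have [p gs1e] := gs1E; rewrite /gs2 /normalize; set q := (_)^-1.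
exists (- (q * (dot (row 1 M) (gs1 M) * p))), q.
by rewrite /gs2' gs1e scalerBr !scalerA addrC scaleNr.
Qed.

Lemma gs3_neq0 : gs3' M != 0.
Proof.
have [q gs1e] := gs1E; have [r [s gs2e]] := gs2E; apply/eqP; rewrite /gs3'.
set p := dot _ (gs1 _); set t := dot _ (gs2 _); rewrite gs1e gs2e => h.
have [|_ _ /eqP h1] := @row_free_comb M (- (p * q + t * r)) (- (t * s)) 1 fM;
  last by rewrite oner_eq0 in h1.
by rewrite -[RHS]h; apply/rowP => j; rewrite !mxE; ring.
Qed.

Lemma gram_schmidtP : gram_schmidt M *m (gram_schmidt M)^T = 1%:M.
Proof.
have d11 : dot (gs1 M) (gs1 M) = 1 by exact: dot_normalize gs1_neq0.
have d22 : dot (gs2 M) (gs2 M) = 1 by exact: dot_normalize gs2_neq0.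
have d33 : dot (gs3 M) (gs3 M) = 1 by exact: dot_normalize gs3_neq0.
have d21 : dot (gs2 M) (gs1 M) = 0.
  rewrite /gs2 /normalize dotZl; set c := (_)^-1; rewrite /gs2' dotBl.
  by rewrite [dot (_ *: gs1 M) _]dotZl d11 mulr1 subrr mulr0.
have d31 : dot (gs3 M) (gs1 M) = 0.
  rewrite /gs3 /normalize dotZl; set c := (_)^-1; rewrite /gs3' !dotBl.
  by rewrite [dot (_ *: gs1 M) _]dotZl [dot (_ *: gs2 M) _]dotZl d11 d21 mulr1 mulr0 subr0 subrr mulr0.
have d32 : dot (gs3 M) (gs2 M) = 0.
  rewrite /gs3 /normalize dotZl; set c := (_)^-1; rewrite /gs3' !dotBl.
  by rewrite [dot (_ *: gs1 M) _]dotZl [dot (_ *: gs2 M) _]dotZl d22 (dotC (gs1 M)) d21 mulr1 mulr0 subr0 subrr mulr0.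
exact: rows3_orthonormal.
Qed.

Lemma gram_schmidt_eq : (gram_schmidt M :=: M)%MS.
Proof.
have [r0 r1 r2] := sub_rows3 (gs1 M) (gs2 M) (gs3 M).
have s1 : (gs1 M <= M)%MS by rewrite scalemx_sub // row_sub.
have s2 : (gs2 M <= M)%MS.
  by rewrite scalemx_sub // addmx_sub ?row_sub // eqmx_opp scalemx_sub.
have s3 : (gs3 M <= M)%MS.
  by rewrite scalemx_sub // !addmx_sub ?row_sub // eqmx_opp scalemx_sub.
apply/eqmxP/andP; split; first exact: rows3_sub.
apply/row_subP => i; case: (ord3P i) => ->.
- by rewrite -(normalizeK gs1_neq0) scalemx_sub.
- have -> : row 1 M = gs2' M + dot (row 1 M) (gs1 M) *: gs1 M by rewrite /gs2' !subrK.
  apply: addmx_sub; last exact: scalemx_sub.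
  by rewrite -(normalizeK gs2_neq0) scalemx_sub.
- have -> : row 2 M = gs3' M + dot (row 2 M) (gs2 M) *: gs2 M + dot (row 2 M) (gs1 M) *: gs1 M.
    by rewrite /gs3' !subrK.
  apply: addmx_sub; last exact: scalemx_sub.
  apply: addmx_sub; last exact: scalemx_sub.
  by rewrite -(normalizeK gs3_neq0) scalemx_sub.
Qed.

Lemma gram_schmidt_cvg (T : Type) (F : set_system T) {FF : Filter F} (f : T -> 'M[R]_(3, n)) :
  mcvg F f M -> mcvg F (fun z => gram_schmidt (f z)) (gram_schmidt M).
Proof.
move=> fa.
have cr i : mcvg F (fun z => row i (f z)) (row i M).
  by move=> p q; rewrite mxE; under eq_fun do rewrite mxE; exact: fa.
have c1 : mcvg F (fun z => gs1 (f z)) (gs1 M) by apply: normalize_cvg => //; exact: gs1_neq0.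
have cp i (h : T -> 'rV[R]_n) b : mcvg F h b ->
    mcvg F (fun z => - (dot (row i (f z)) (h z) *: h z)) (- (dot (row i M) b *: b)).
  by move=> hb; apply: mcvgN; apply: mcvgZ => //; exact: (cvg_dot (cr i) hb).
have c2 : mcvg F (fun z => gs2 (f z)) (gs2 M).
  by apply: normalize_cvg; [exact: gs2_neq0|apply: mcvgD => //; exact: cp].
have c3 : mcvg F (fun z => gs3 (f z)) (gs3 M).
  apply: normalize_cvg; first exact: gs3_neq0.
  by apply: mcvgD; [apply: mcvgD => //; exact: cp|exact: cp].
exact: rows3_cvg.
Qed.
End GramSchmidt.

(** * Symmetric bundles of involutions on the torus *)

Lemma I0_fixed (R : realType) (u : 'rV[R]_(3 + 3)) :
  u *m I0 R = u -> u = lsubmx u *m (row_mx 1%:M 0 : 'M[R]_(3, 3 + 3)).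
Proof.
rewrite -{1 2}(hsubmxK u).
change (row_mx (lsubmx u) (rsubmx u) *m (block_mx 1%:M 0 0 (- 1%:M) : 'M[R]_(3 + 3)) =
  row_mx (lsubmx u) (rsubmx u) -> u = lsubmx u *m (row_mx 1%:M 0 : 'M[R]_(3, 3 + 3))).
rewrite mul_row_block !(mulmx0, mulmx1, addr0, add0r, mulmxN) => /eq_row_mx[_ h].
have r0 : rsubmx u = 0.
  apply/matrixP => i j; move/matrixP: h => /(_ i j); rewrite !mxE; lra.
by rewrite -{1}(hsubmxK u) r0 mul_mx_row mulmx1 mulmx0.
Qed.

(** A symmetric rotation other than 1 is a half turn, and the real part of its quaternion is 0. *)
Lemma quat_line_imaginary (R : realType) (B : 'M[R]_3) : B *m B^T = 1%:M -> \det B = 1 ->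
  B^T = B -> B 0 0 + B 1 1 + B 2 2 != 3 ->
  forall b : 'rV_4, b *m quat_line B = b -> b *m quat_conj R = - b.
Proof.
move=> BBt dB Bs tB b bB.
have := quat_line_idem BBt dB.
have := quat_line_tr B; rewrite Bs.
have : quat_line B 0 0 != 1 by rewrite mxE /=; apply: contra_neq tB => h; lra.
move: (quat_line B) bB => Q bQ q1 hC QQ.
have q0 j : j != 0 -> Q 0 j = 0.
  move=> j0; move/matrixP: hC => /(_ 0 j).
  by rewrite mul_diag_mx mul_mx_diag !mxE /= (negPf j0); lra.
have q00 : Q 0 0 = 0.
  have /eqP : Q 0 0 * Q 0 0 = Q 0 0.
    by rewrite -{3}QQ mxE big_ord_recl big1 ?addr0 // => i _; rewrite q0 // mul0r.
  by rewrite -subr_eq0 -{3}[Q 0 0]mulr1 -mulrBr mulf_eq0 subr_eq0 (negPf q1) orbF => /eqP.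
have b0 : b 0 0 = 0.
  rewrite -bQ mxE big1 // => i _; have [->|i0] := eqVneq i 0; first by rewrite q00 mulr0.
  suff -> : Q i 0 = 0 by rewrite mulr0.
  move/matrixP: hC => /(_ i 0).
  by rewrite mul_diag_mx mul_mx_diag !mxE /= (negPf i0); lra.
rewrite mul_mx_diag; apply/rowP => j; rewrite !mxE; case: eqVneq => [->|_]; last by rewrite mulrN1.
by rewrite b0 mul0r oppr0.
Qed.

Lemma dot_row (R : realType) m n (M : 'M[R]_(m, n)) i :
  dot (row i M) (row i M) = (M *m M^T) i i.
Proof. by rewrite dotE mxE; apply: eq_bigr => k _; rewrite !mxE. Qed.

(** The trace of g on the row space of F is maximal only if g fixes this space: the squared norms of
the rows of F g - F add up to 6 minus twice the trace. *)
Lemma trace_fixed (R : realType) n (F : 'M[R]_(3, n)) (g : 'M[R]_n) :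
  F *m F^T = 1%:M -> g *m g = 1%:M -> g^T = g ->
  (F *m g *m F^T) 0 0 + (F *m g *m F^T) 1 1 + (F *m g *m F^T) 2 2 = 3 -> F *m g = F.
Proof.
move=> FF gg gt; set B := F *m g *m F^T => trB.
have MM : (F *m g - F) *m (F *m g - F)^T = 2%:M - B - B.
  rewrite linearB /= trmx_mul gt mulmxBl !mulmxBr -!mulmxA (mulmxA g g) gg mul1mx FF.
  rewrite (mulmxA F g) -/B.
  by apply/matrixP => i j; rewrite !mxE; ring.
have d (i : 'I_3) : dot (row i (F *m g - F)) (row i (F *m g - F)) = 2 - B i i - B i i.
  by rewrite dot_row MM; clearbody B; rewrite !mxE eqxx mulr1n.
have h (i : 'I_3) : dot (row i (F *m g - F)) (row i (F *m g - F)) = 0.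
  have := dot_ge0 (row 0 (F *m g - F)); have := dot_ge0 (row 1 (F *m g - F)).
  have := dot_ge0 (row 2 (F *m g - F)); rewrite !d.
  by case: (ord3P i) => ->; lra.
apply/eqP; rewrite -subr_eq0; apply/eqP/row_matrixP => i; rewrite row0.
by apply/eqP; rewrite -dot_eq0 h.
Qed.

(** A field J on the torus, compatible with x |-> -x through an orthogonal involution g, where g fixes
the 1-eigenspace at 0 but moves a vector of it at the three other half periods.  In the section, T
conjugates J to a constant field, and F is an orthonormal periodic frame of the 1-eigenbundle.  The
matrix B x of g : E (-x) -> E x is a rotation with B (-x) inverse to B x.  It is 1 at 0, and
symmetric but not 1 at the other half periods.  Inverse rotations have conjugate quaternions, so the
lines of quaternions over B contradict the parity of line fields. *)
Section Nontrivial.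
Variables (R : realType) (J : R * R -> 'M[R]_6) (g A : 'M[R]_6) (T : R * R -> 'M[R]_6).
Hypotheses (uA : A \in unitmx) (Tc : mcontinuous T) (Tu : forall x, T x \in unitmx).
Hypotheses (Tp1 : forall u v, T (u + 1, v) = T (u, v)) (Tp2 : forall u v, T (u, v + 1) = T (u, v)).
Hypothesis TJ : forall x, (A *m I0 R *m invmx A) *m T x = T x *m J x.
Hypotheses (gg : g *m g = 1%:M) (gt : g^T = g).
Hypothesis Js : forall u v, J (- u, - v) = g *m J (u, v) *m g.
Hypothesis fix0 : forall v : 'rV_6, v *m J (0, 0) = v -> v *m g = v.
Hypotheses (mov1 : exists v : 'rV_6, v *m J (2^-1, 0) = v /\ v *m g <> v)
  (mov2 : exists v : 'rV_6, v *m J (0, 2^-1) = v /\ v *m g <> v)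
  (mov3 : exists v : 'rV_6, v *m J (2^-1, 2^-1) = v /\ v *m g <> v).

Let E0 : 'M[R]_(3, 6) := (row_mx 1%:M 0 : 'M[R]_(3, 3 + 3)) *m invmx A.
Let J0 := A *m I0 R *m invmx A.

Let E0J : E0 *m J0 = E0.
Proof.
rewrite /E0 /J0 !mulmxA mulmxKV //; congr (_ *m _).
change ((row_mx 1%:M 0 : 'M[R]_(3, 3 + 3)) *m (block_mx 1%:M 0 0 (- 1%:M) : 'M[R]_(3 + 3)) = row_mx 1%:M 0).
by rewrite mul_row_block !(mulmx0, mul0mx, mulmx1, addr0).
Qed.

Let E0_free : row_free E0.
Proof.
have uV : invmx A \in unitmx by rewrite unitmx_inv.
rewrite /row_free /E0 mxrankMfree ?row_free_unit //.
by rewrite rank_row_mx0 mxrank1.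
Qed.

Let E0_all (v : 'rV[R]_6) : v *m J0 = v -> (v <= E0)%MS.
Proof.
move=> vJ; set u := v *m A.
have uI : u *m I0 R = u by rewrite /u -{2}vJ /J0 !mulmxA mulmxKV.
have -> : v = u *m invmx A by rewrite mulmxK.
rewrite /E0 submxMr //.
by rewrite (I0_fixed uI) submxMl.
Qed.

Let F x := gram_schmidt (E0 *m T x).

Let free_F x : row_free (E0 *m T x).
Proof. by rewrite /row_free mxrankMfree ?row_free_unit. Qed.

Let FFt x : F x *m (F x)^T = 1%:M. Proof. exact: gram_schmidtP. Qed.

Let F_all x (v : 'rV[R]_6) : v *m J x = v -> (v <= F x)%MS.
Proof.
move=> vJ; rewrite /F gram_schmidt_eq // -(mulmxKV (Tu x) v) submxMr // E0_all //.
by apply: (can_inj (mulmxK (Tu x))); rewrite mulmxKV // -mulmxA TJ mulmxA mulmxKV.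
Qed.

Let F_proj x k (M : 'M[R]_(k, 6)) : (M <= F x)%MS -> M *m (F x)^T *m F x = M.
Proof. by move=> /submxP[D ->]; rewrite -(mulmxA D) FFt mulmx1. Qed.

Let FJ x : F x *m J x = F x.
Proof.
have : (F x <= E0 *m T x)%MS by rewrite /F gram_schmidt_eq.
by move=> /submxP[D ->]; rewrite -mulmxA -(mulmxA E0) -TJ -/J0 (mulmxA E0 J0) E0J.
Qed.

Let opp (x : R * R) : R * R := (- x.1, - x.2).
Let B x := F x *m g *m (F (opp x))^T.

Let JsE x : J (opp x) = g *m J x *m g. Proof. by case: x => u v; exact: Js. Qed.

Let oppK x : opp (opp x) = x. Proof. by case: x => u v; rewrite /opp /= !opprK. Qed.

Let Fg_sub x : (F x *m g <= F (opp x))%MS.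
Proof.
apply/row_subP => i; apply: F_all; rewrite -row_mul; congr (row i _).
by rewrite JsE !mulmxA -(mulmxA (F x) g g) gg mulmx1 FJ.
Qed.

Let BBt x : B x *m (B x)^T = 1%:M.
Proof.
rewrite /B trmx_mul trmxK trmx_mul gt !mulmxA F_proj //.
by rewrite -(mulmxA (F x)) gg mulmx1 FFt.
Qed.

Let Bopp x : B (opp x) = (B x)^T.
Proof. by rewrite /B oppK !trmx_mul trmxK gt mulmxA. Qed.

Let Fc : mcontinuous F.
Proof.
move=> x; apply: gram_schmidt_cvg => //; apply: mcvgM; [exact: mcvg_cst|exact: Tc].
Qed.

Let oppc (x : R * R) : opp y @[y --> x] --> opp x.
Proof. by apply: cvg_to_pair; apply: cvgN; [exact: cvg_fst|exact: cvg_snd]. Qed.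

Let Bc : mcontinuous B.
Proof.
move=> x; apply: mcvgM; first by apply: mcvgM; [exact: Fc|exact: mcvg_cst].
have h : mcvg (nbhs x) (fun z => F (opp z)) (F (opp x)).
  exact: (mcvg_comp (oppc (x := x)) (@Fc _)).
exact: mcvg_tr.
Qed.

Let Fp1 u v : F (u + 1, v) = F (u, v). Proof. by rewrite /F Tp1. Qed.
Let Fp2 u v : F (u, v + 1) = F (u, v). Proof. by rewrite /F Tp2. Qed.
Let Fm1 u v : F (u - 1, v) = F (u, v). Proof. by rewrite -[in RHS](subrK 1 u) Fp1. Qed.
Let Fm2 u v : F (u, v - 1) = F (u, v). Proof. by rewrite -[in RHS](subrK 1 v) Fp2. Qed.

Let B0 : B (0, 0) = 1%:M.
Proof.
rewrite /B /opp /= oppr0 (_ : F (0, 0) *m g = F (0, 0)) ?FFt //.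
by apply/row_matrixP => i; rewrite row_mul fix0 // -row_mul FJ.
Qed.

Let dB x : \det (B x) = 1.
Proof.
have d2 y : \det (B y) ^+ 2 = 1 by rewrite expr2 -{2}(det_tr (B y)) -det_mulmx BBt det1.
have dN0 y : \det (B y) != 0.
  by apply/eqP => h; have := d2 y; rewrite h expr0n /= => /esym/eqP; rewrite oner_eq0.
(* the determinant is 1 or -1, and it is 1 at the origin *)
suff : 0 < \det (B x).
  move=> d0; move: (d2 x) => /eqP; rewrite sqrf_eq1 => /orP[/eqP //|/eqP h]; move: d0; rewrite h; lra.
pose f (t : R) : R := \det (B (0 + x.1 * t, 0 + x.2 * t)).
have -> : \det (B x) = f 1 by rewrite /f !add0r !mulr1 -surjective_pairing.
apply: pos_on_segment => [t|t _|]; last by rewrite /f !mulr0 !addr0 B0 det1 ltr01.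
  have ct : (fun t : R => (0 + x.1 * t, 0 + x.2 * t)) @ t --> (0 + x.1 * t, 0 + x.2 * t).
    by apply: cvg_to_pair; (apply: cvgD; [exact: cvg_cst|apply: cvgM; [exact: cvg_cst|exact: cvg_id]]).
  exact: cvg_det (mcvg_comp ct (@Bc _)).
exact: dN0.
Qed.

Let half_point x : F (opp x) = F x -> (exists v : 'rV_6, v *m J x = v /\ v *m g <> v) ->
  forall b : 'rV_4, b *m quat_line (B x) = b -> b *m quat_conj R = - b.
Proof.
move=> Fx [v [vJ vg]]; apply: quat_line_imaginary; first exact: BBt.
- exact: dB.
- by rewrite -Bopp /B oppK Fx.
- apply/eqP => trB; apply: vg.
  have Fg : F x *m g = F x.
    by apply: (trace_fixed (FFt x) gg gt); move: trB; rewrite /B Fx.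
  by have /submxP[D ->] := F_all vJ; rewrite -mulmxA Fg.
Qed.

(** Conjugation of quaternions is 1 on the line of the quaternion 1, and -1 on imaginary lines. *)
Lemma no_constant_model : False.
Proof.
pose Q x := quat_line (B x).
have FE u v : F (opp (u, v)) = F (- u, - v) by [].
have half : 2^-1 - 1 = - 2^-1 :> R by field.
have Bp1 u v : B (u + 1, v) = B (u, v) by rewrite /B /opp /= opprD Fp1 Fm1.
have Bp2 u v : B (u, v + 1) = B (u, v) by rewrite /B /opp /= opprD Fp2 Fm2.
pose b0 : 'rV[R]_4 := delta_mx 0 0.
apply: (@line_field_parity R 4 Q (quat_conj R) _ _ _ _ _ _ _ b0).
- by move=> x; apply: quat_line_cont; exact: Bc.
- by move=> x; apply: quat_line_idem; [exact: BBt|exact: dB].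
- by move=> x; apply: quat_line_rank_one; [exact: BBt|exact: dB].
- by move=> u v; rewrite /Q Bp1.
- by move=> u v; rewrite /Q Bp2.
- exact: quat_conjK.
- by move=> u v; rewrite /Q -quat_line_tr -Bopp.
- by apply/rV0Pn; exists 0; rewrite mxE oner_neq0.
- rewrite /Q B0 /b0 -rowE; apply/rowP => j; rewrite !mxE.
  by case: (ord4P j) => -> /=; rewrite !mxE /=; field.
- by rewrite mul_mx_diag; apply/rowP => j; rewrite !mxE; case: (ord4P j) => -> /=; ring.
- apply: (half_point _ mov1).
  by rewrite FE oppr0 -(Fm1 2^-1) half.
- apply: (half_point _ mov2).
  by rewrite FE oppr0 -(Fm2 0 2^-1) half.
- apply: (half_point _ mov3).
  by rewrite FE -(Fm1 2^-1) -(Fm2 _ 2^-1) half.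
Qed.
End Nontrivial.

(** * Pencils of 2-forms on R^4 *)

Section Form2.
Variable R : realType.
Implicit Types (u v a b c d : 'rV[R]_6) (P N K f : 'rV[R]_3).

(** Pluecker coordinates. *)
Definition pl (i j : 'I_6) u v : R := u 0 i * v 0 j - u 0 j * v 0 i.

(** The coordinates 2, 3, 4, 5 are those of R^4, in dimension 6.  The vectors P and N are the
coordinates of the self-dual and the anti-self-dual part in the bases e12 + e34, e13 - e24, e14 + e23
and e12 - e34, e13 + e24, e14 - e23. *)
Definition form2 P N u v : R :=
  (P 0 0 + N 0 0) * pl 2 3 u v + (P 0 0 - N 0 0) * pl 4 5 u v +
  (P 0 1 + N 0 1) * pl 2 4 u v - (P 0 1 - N 0 1) * pl 3 5 u v +
  (P 0 2 + N 0 2) * pl 2 5 u v + (P 0 2 - N 0 2) * pl 3 4 u v.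

(** The wedge product of 2-forms on R^4, up to the factor 2 and the volume form. *)
Definition lorentz P N P' N' : R := dot P P' - dot N N'.

Definition det4 a b c d : R :=
  pl 2 3 a b * pl 4 5 c d - pl 2 4 a b * pl 3 5 c d + pl 2 5 a b * pl 3 4 c d
  + pl 3 4 a b * pl 2 5 c d - pl 3 5 a b * pl 2 4 c d + pl 4 5 a b * pl 2 3 c d.

Lemma dot3 P N : dot P N = P 0 0 * N 0 0 + P 0 1 * N 0 1 + P 0 2 * N 0 2.
Proof.
rewrite dotE !big_ord_recl big_ord0 addr0 addrA.
by congr (_ + P _ _ * N _ _ + P _ _ * N _ _); apply/val_inj.
Qed.

(** The 4-form is the wedge product of both 2-forms, expanded on four vectors. *)
Lemma form2_plucker P N P' N' a b c d :
  form2 P N a b * form2 P' N' c d + form2 P' N' a b * form2 P N c d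
  - form2 P N a c * form2 P' N' b d - form2 P' N' a c * form2 P N b d
  + form2 P N a d * form2 P' N' b c + form2 P' N' a d * form2 P N b c
  = 2 * lorentz P N P' N' * det4 a b c d.
Proof. by rewrite /lorentz !dot3 /form2 /det4 /pl; ring. Qed.

(** A 2-form on R^4 with square 0 is decomposable. *)
Lemma form2_null P N a b c d : lorentz P N P N = 0 ->
  form2 P N a b * form2 P N c d =
  form2 P N a c * form2 P N b d - form2 P N a d * form2 P N b c.
Proof. by move=> h; have := form2_plucker P N P N a b c d; rewrite h mulr0 mul0r; lra. Qed.

Lemma form2C P N u v : form2 P N u v = - form2 P N v u.
Proof. by rewrite /form2 /pl; ring. Qed.

Lemma sum6 (V : nmodType) (h : 'I_6 -> V) : \sum_k h k = h 0 + h 1 + h 2 + h 3 + h 4 + h 5.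
Proof.
rewrite !big_ord_recl big_ord0 addr0 !addrA.
by congr (_ + h _ + h _ + h _ + h _ + h _); apply/val_inj.
Qed.

(** The 1-form obtained by contraction with c. *)
Definition form2_col P N c : 'cV[R]_6 := \col_j form2 P N c (delta_mx 0 j).

Lemma form2_colE P N c u : (u *m form2_col P N c) 0 0 = form2 P N c u.
Proof. by rewrite mxE sum6 !mxE /form2 /pl !mxE /=; ring. Qed.

(** A 2-form on R^4 with nonzero square is nondegenerate. *)
Lemma form2_nondeg P N v : lorentz P N P N != 0 -> (forall u, form2 P N u v = 0) ->
  [/\ v 0 2 = 0, v 0 3 = 0, v 0 4 = 0 & v 0 5 = 0].
Proof.
move=> h0 hv; have e (j : 'I_6) := hv (delta_mx 0 j).
have := (e 2, e 3, e 4, e 5); move: h0; rewrite /form2 /pl !mxE /= /lorentz !dot3.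
rewrite !(mul0r, mul1r, subr0, sub0r, mulr0, addr0, add0r).
move: (v 0 2) (v 0 3) (v 0 4) (v 0 5) => v2 v3 v4 v5.
move: (P 0 0) (P 0 1) (P 0 2) (N 0 0) (N 0 1) (N 0 2) => p0 p1 p2 n0 n1 n2 h0 [[[e2 e3] e4] e5].
have m (x : R) : (p0 * p0 + p1 * p1 + p2 * p2 - (n0 * n0 + n1 * n1 + n2 * n2)) * x = 0 -> x = 0.
  by move/eqP; rewrite mulf_eq0 (negPf h0) => /eqP.
have L (x1 x2 x3 y1 y2 y3 r : R) : y1 = 0 -> y2 = 0 -> y3 = 0 ->
    r = - (x1 * y1 + x2 * y2 + x3 * y3) -> r = 0.
  by move=> -> -> -> ->; rewrite !mulr0 !addr0 oppr0.
split; apply: m.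
- by apply: (L (p0 - n0) (p1 - n1) (p2 - n2) _ _ _ _ e3 e4 e5); ring.
- by apply: (L (- (p0 - n0)) (p2 + n2) (- (p1 + n1)) _ _ _ _ e2 e4 e5); ring.
- by apply: (L (- (p1 - n1)) (- (p2 + n2)) (p0 + n0) _ _ _ _ e2 e3 e5); ring.
- by apply: (L (- (p2 - n2)) (p1 + n1) (- (p0 + n0)) _ _ _ _ e2 e3 e4); ring.
Qed.

(** ds /\ (P + K) + dt /\ f, for P self-dual and K, f anti-self-dual; s and t are the coordinates
0 and 1. *)
Definition pencil (P K f : 'rV[R]_3) : multivec R 6 3 := fun v : 'M[R]_(3, 6) =>
  let a := row 0 v in let b := row 1 v in let c := row 2 v in
  a 0 0 * form2 P K b c - b 0 0 * form2 P K a c + c 0 0 * form2 P K a b +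
  (a 0 1 * form2 0 f b c - b 0 1 * form2 0 f a c + c 0 1 * form2 0 f a b).

(** - ds /\ dt + w3, for the third self-dual form w3. *)
Definition omega (u v : 'rV[R]_6) : R := form2 (delta_mx 0 2) 0 u v - pl 0 1 u v.

Definition st_col (x y : R) : 'cV[R]_6 := \col_j (if j == 0 then x else if j == 1 then y else 0).

Lemma st_colE x y u : (u *m st_col x y) 0 0 = x * u 0 0 + y * u 0 1.
Proof. by rewrite mxE sum6 !mxE /=; ring. Qed.

(** The columns are 1-forms with product (x ds + y dt) /\ [form2 P N], when the 2-form has square 0: it
is then the product of its contractions with c and d, divided by its value on (c, d). *)
Definition null_frame x y P N c d : 'M[R]_(6, 3) := \matrix_(i, j)
  (if j == 0 then st_col x y i 0
   else if j == 1 then (form2 P N c d)^-1 * form2_col P N c i 0 else form2_col P N d i 0).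

Lemma null_frame_row x y P N c d u :
  [/\ (u *m null_frame x y P N c d) 0 0 = x * u 0 0 + y * u 0 1,
      (u *m null_frame x y P N c d) 0 1 = (form2 P N c d)^-1 * form2 P N c u &
      (u *m null_frame x y P N c d) 0 2 = form2 P N d u].
Proof.
have e j (C : 'cV[R]_6) : (forall i, null_frame x y P N c d i j = C i 0) ->
    (u *m null_frame x y P N c d) 0 j = (u *m C) 0 0.
  by move=> h; rewrite !mxE; apply: eq_bigr => k _; rewrite h.
split; first by rewrite -st_colE; apply: e => i; rewrite mxE.
  rewrite -(form2_colE P N c u) (e _ ((form2 P N c d)^-1 *: form2_col P N c)).
    by rewrite -scalemxAr [LHS]mxE.
  by move=> i; rewrite mxE /= [in RHS]mxE.
by rewrite -(form2_colE P N d u); apply: e => i; rewrite mxE.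
Qed.

Lemma det_null_frame x y P N c d (v : 'M[R]_(3, 6)) : lorentz P N P N = 0 -> form2 P N c d != 0 ->
  \det (v *m null_frame x y P N c d) =
  let a1 := row 0 v in let a2 := row 1 v in let a3 := row 2 v in
  (x * a1 0 0 + y * a1 0 1) * form2 P N a2 a3 - (x * a2 0 0 + y * a2 0 1) * form2 P N a1 a3
  + (x * a3 0 0 + y * a3 0 1) * form2 P N a1 a2.
Proof.
move=> h cd /=; rewrite {1}(rows3_row v) rows3_mul.
have e u1 u2 : form2 P N u1 u2 = (form2 P N c d)^-1 *
   (form2 P N c u1 * form2 P N d u2 - form2 P N c u2 * form2 P N d u1).
  by rewrite -form2_null // mulKf.
have [p1 p2 p3] := null_frame_row x y P N c d (row 0 v).
have [q1 q2 q3] := null_frame_row x y P N c d (row 1 v).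
have [r1 r2 r3] := null_frame_row x y P N c d (row 2 v).
rewrite det_mx3 ![rows3 _ _ _ _ _]mxE /= p1 p2 p3 q1 q2 q3 r1 r2 r3.
rewrite (e (row 1 v) (row 2 v)) (e (row 0 v) (row 2 v)) (e (row 0 v) (row 1 v)).
by ring.
Qed.
End Form2.

Section PencilFrame.
Variable R : realType.
Implicit Types (P N K f : 'rV[R]_3).

Lemma dotDl m (u v w : 'rV[R]_m) : dot (u + v) w = dot u w + dot v w.
Proof. by rewrite /dot mulmxDl mxE. Qed.

Lemma dot_sqD m (u v : 'rV[R]_m) : dot (u + v) (u + v) = dot u u + 2 * dot u v + dot v v.
Proof. by rewrite dotDl !(dotC _ (u + v)) !dotDl (dotC v u); ring. Qed.

Lemma form2_witness P N : P != 0 -> exists c d, form2 P N c d != 0.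
Proof.
move=> P0; apply: contrapT => h; move/eqP: P0; apply.
have {}h i j : form2 P N (delta_mx 0 i) (delta_mx 0 j) = 0.
  by apply: contrapT => /eqP h1; apply: h; exists (delta_mx 0 i), (delta_mx 0 j).
have := (h 2 3, h 4 5, h 2 4, h 3 5, h 2 5, h 3 4).
rewrite /form2 /pl !mxE /= => -[[[[[h1 h2] h3] h4] h5] h6].
by apply/rowP => j; case: (ord3P j) => ->; rewrite mxE; lra.
Qed.

Lemma null_frame_kernel x y P N c d (u : 'rV[R]_6) : lorentz P N P N = 0 -> form2 P N c d != 0 ->
  u *m null_frame x y P N c d = 0 ->
  x * u 0 0 + y * u 0 1 = 0 /\ forall z, form2 P N z u = 0.
Proof.
move=> h cd u0; have [] := null_frame_row x y P N c d u; rewrite u0 !mxE => e0 e1 e2.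
split=> // z; apply: (mulfI cd); rewrite mulr0.
have c0 : form2 P N c u = 0.
  by apply/eqP; move/esym/eqP: e1; rewrite mulf_eq0 invr_eq0 (negPf cd).
by rewrite mulrC form2_null // (form2C _ _ z c) (form2C _ _ u d) (form2C _ _ z d) (form2C _ _ u c)
  c0 -e2; ring.
Qed.

(** The product of w3 with the null 2-form is 0 when P has no third component, so w3 vanishes on its
kernel; there the 1-form x ds + y dt makes ds and dt proportional. *)
Lemma null_frame_lagrangian x y P N c d (u v : 'rV[R]_6) : lorentz P N P N = 0 -> form2 P N c d != 0 ->
  (x != 0) || (y != 0) -> P 0 2 = 0 ->
  u *m null_frame x y P N c d = 0 -> v *m null_frame x y P N c d = 0 -> omega u v = 0.
Proof.
move=> h cd xy P2 /(null_frame_kernel h cd)[eu fu] /(null_frame_kernel h cd)[ev fv].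
have p0 : pl 0 1 u v = 0.
  rewrite /pl; case/orP: xy => z0; apply: (mulfI z0); rewrite mulr0.
    transitivity ((x * u 0 0 + y * u 0 1) * v 0 1 - (x * v 0 0 + y * v 0 1) * u 0 1); first ring.
    by rewrite eu ev !mul0r subrr.
  transitivity (- ((x * u 0 0 + y * u 0 1) * v 0 0) + (x * v 0 0 + y * v 0 1) * u 0 0); first ring.
  by rewrite eu ev !mul0r oppr0 addr0.
rewrite /omega p0 subr0; apply: (mulfI cd); rewrite mulr0.
have := form2_plucker P N (delta_mx 0 2) 0 c d u v.
rewrite (_ : lorentz _ _ _ _ = 0) ?mulr0 ?mul0r; last first.
  by rewrite /lorentz !dot3 !mxE /= P2; ring.
by rewrite !fu !fv; lra.
Qed.

(** Subtract from K its component k f along f, so that K' = K - k f is orthogonal to f.  With the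
lengths m and e for which m^2 = |P|^2 - |K'|^2 and e^2 = |f|^2, both 2-forms (P + K') / 2m + f / 2e and
(P + K') / 2m - f / 2e have square 0, and the form is the sum of their products with
m ds + e (dt + k ds) and m ds - e (dt + k ds). *)
Lemma pencil_frame P K f : dot K K < dot P P -> f != 0 ->
  exists2 A : 'M[R]_(3 + 3), SL3_frame (pencil P K f) A &
    P 0 2 = 0 -> forall u u' : 'rV[R]_3,
      omega (row_mx u 0 *m invmx A) (row_mx u' 0 *m invmx A) = 0 /\
      omega (row_mx 0 u *m invmx A) (row_mx 0 u' *m invmx A) = 0.
Proof.
move=> KP f0.
have ee0 : 0 < dot f f by exact: dot_gt0.
pose e := Num.sqrt (dot f f); have e0 : 0 < e by rewrite sqrtr_gt0.
have e2 : dot f f = e ^+ 2 by rewrite sqr_sqrtr ?ltW.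
pose k := dot K f / dot f f; pose Kp := K - k *: f.
have Kpf : dot Kp f = 0 by rewrite dotBl dotZl divfK ?subrr // gt_eqF.
have KpKp : dot K K = dot Kp Kp + k ^+ 2 * dot f f.
  have KE : K = Kp + k *: f by rewrite subrK.
  by rewrite {1 2}KE dot_sqD dotZr Kpf dotZl dotZr; ring.
have mm0 : 0 < dot P P - dot Kp Kp.
  by rewrite subr_gt0; apply: le_lt_trans KP; rewrite KpKp lerDl mulr_ge0 ?sqr_ge0 // ltW.
pose m := Num.sqrt (dot P P - dot Kp Kp); have m0 : 0 < m by rewrite sqrtr_gt0.
have m2 : dot P P - dot Kp Kp = m ^+ 2 by rewrite sqr_sqrtr ?ltW.
have mN0 : m != 0 by rewrite gt_eqF. have eN0 : e != 0 by rewrite gt_eqF.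
pose P1 := (2 * m)^-1 *: P.
pose N1 := (2 * m)^-1 *: Kp + (2 * e)^-1 *: f.
pose N2 := (2 * m)^-1 *: Kp + (- (2 * e)^-1) *: f.
have lN (t : R) : t ^+ 2 = (2 * e)^-1 ^+ 2 ->
    lorentz P1 ((2 * m)^-1 *: Kp + t *: f) P1 ((2 * m)^-1 *: Kp + t *: f) = 0.
  move=> t2; rewrite /lorentz /P1 dot_sqD !dotZl !dotZr Kpf (_ : dot P P = m ^+ 2 + dot Kp Kp); last by rewrite -m2 subrK.
  transitivity ((2 * m)^-1 ^+ 2 * m ^+ 2 - t ^+ 2 * dot f f); first ring.
  by rewrite t2 e2; field; rewrite mN0 eN0.
have l1 : lorentz P1 N1 P1 N1 = 0 by exact: lN.
have l2 : lorentz P1 N2 P1 N2 = 0 by apply: lN; rewrite sqrrN.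
have P0 : P != 0 by rewrite -dot_eq0 gt_eqF // (le_lt_trans _ KP) // dot_ge0.
have P10 : P1 != 0 by rewrite scaler_eq0 negb_or P0 invr_eq0 mulf_neq0 // pnatr_eq0.
have [c1 [d1 cd1]] := form2_witness N1 P10.
have [c2 [d2 cd2]] := form2_witness N2 P10.
pose A1 := null_frame (m + e * k) e P1 N1 c1 d1.
pose A2 := null_frame (m - e * k) (- e) P1 N2 c2 d2.
pose A : 'M[R]_(3 + 3) := row_mx A1 A2.
have fs u v : form2 P1 N1 u v + form2 P1 N2 u v = m^-1 * form2 P Kp u v.
  by rewrite /form2 !mxE; field; rewrite mN0 eN0.
have fd u v : form2 P1 N1 u v - form2 P1 N2 u v = e^-1 * form2 0 f u v.
  by rewrite /form2 !mxE; field; rewrite mN0 eN0.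
have fk u v : form2 P K u v = form2 P Kp u v + k * form2 0 f u v.
  by rewrite /form2 !mxE; ring.
have hA : pullback A (@rho_plus R) =1 pencil P K f.
  move=> v; rewrite /pullback rho_plusE /A mul_mx_row row_mxKl row_mxKr !det_null_frame //=.
  rewrite /pencil !fk.
  have s1 u w : form2 P1 N1 u w = 2^-1 * (m^-1 * form2 P Kp u w + e^-1 * form2 0 f u w).
    by rewrite -fs -fd; field.
  have s2 u w : form2 P1 N2 u w = 2^-1 * (m^-1 * form2 P Kp u w - e^-1 * form2 0 f u w).
    by rewrite -fs -fd; field.
  rewrite !s1 !s2.
  move: (form2 P Kp _ _) (form2 P Kp _ _) (form2 P Kp _ _) => x1 x2 x3.
  move: (form2 0 f _ _) (form2 0 f _ _) (form2 0 f _ _) => y1 y2 y3.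
  by field; rewrite mN0 eN0.
have uA : A \in unitmx.
  rewrite -row_free_unit -kermx_eq0; apply/eqP/row_matrixP => i; rewrite row0.
  have : row i (kermx A) *m A = 0 by rewrite -row_mul mulmx_ker row0.
  move: (row i (kermx A)) => v; rewrite /A mul_mx_row => vA.
  have [v1 v2] : v *m A1 = 0 /\ v *m A2 = 0 by apply: eq_row_mx; rewrite vA row_mx0.
  have [h1 g1] := null_frame_kernel l1 cd1 v1; have [h2 g2] := null_frame_kernel l2 cd2 v2.
  have v00 : v 0 0 = 0.
    by apply: (mulfI mN0); rewrite mulr0; lra.
  have v01 : v 0 1 = 0.
    by apply: (mulfI eN0); rewrite mulr0; move: h1; rewrite v00; lra.
  have [|z|q2 q3 q4 q5] := @form2_nondeg R P Kp v.
  - by rewrite /lorentz m2 expf_neq0.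
  - by apply: (mulfI (invr_neq0 mN0)); rewrite -fs g1 g2 addr0 mulr0.
  - by apply/rowP => j; rewrite [RHS]mxE; case: j => -[|[|[|[|[|[|//]]]]]] h;
      [rewrite -[RHS]v00|rewrite -[RHS]v01|rewrite -[RHS]q2|rewrite -[RHS]q3|rewrite -[RHS]q4|rewrite -[RHS]q5];
      congr (v _ _); apply/val_inj.
have lag : P 0 2 = 0 -> forall u u' : 'rV[R]_3,
      omega (row_mx u 0 *m invmx A) (row_mx u' 0 *m invmx A) = 0 /\
      omega (row_mx 0 u *m invmx A) (row_mx 0 u' *m invmx A) = 0.
  move=> P2 u u'; have P12 : P1 0 2 = 0 by rewrite mxE P2 mulr0.
  have k2 (z : 'rV[R]_3) : (row_mx z 0 *m invmx A) *m A2 = 0.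
    have : row_mx z 0 *m invmx A *m A = row_mx z 0 by rewrite mulmxKV.
    by rewrite /A mul_mx_row => /eq_row_mx[].
  have k1 (z : 'rV[R]_3) : (row_mx 0 z *m invmx A) *m A1 = 0.
    have : row_mx 0 z *m invmx A *m A = row_mx 0 z by rewrite mulmxKV.
    by rewrite /A mul_mx_row => /eq_row_mx[].
  split.
    by apply: (null_frame_lagrangian l2 cd2 _ P12 (k2 u) (k2 u')); rewrite oppr_eq0 eN0 orbT.
  by apply: (null_frame_lagrangian l1 cd1 _ P12 (k1 u) (k1 u')); rewrite eN0 orbT.
(* exchanging the two summands changes the sign of the determinant *)
have [dA|dA|dA] := ltrgtP 0 (\det A).
- by exists A.
- exists (A *m swap6 R); first split.
  + by rewrite det_mulmx /swap6 det_antidiag !det1 mulr1 mulrN1 oppr_gt0.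
  + by move=> v; rewrite -hA -pullback_comp /pullback; exact: rho_plus_swap.
  + have sw : invmx (A *m swap6 R) = swap6 R *m invmx A.
      have ss : swap6 R *m swap6 R = 1%:M.
        rewrite /swap6 mulmx_block !(mulmx0, mul0mx, mulmx1, addr0, add0r).
        by rewrite -scalar_mx_block.
      have uS : A *m swap6 R \in unitmx by rewrite unitmx_mul uA; case/mulmx1_unit: ss.
      apply: (can_inj (mulKmx uS)); rewrite mulmxV // mulmxA -(mulmxA A) ss mulmx1 mulmxV //.
    move=> P2 u u'; rewrite sw !mulmxA /swap6 !mul_row_block.
    rewrite !(mulmx0, mul0mx, mulmx1, addr0, add0r).
    by have [] := lag P2 u u'.
- by move: uA; rewrite unitmxE unitfE -dA eqxx.
Qed.
End PencilFrame.

(** * Signature *)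

(** Twice the Gram matrix of the symmetric form of J and of the 2-form with matrix W. *)
Definition gram (R : realType) (J W : 'M[R]_6) : 'M[R]_6 := J *m W - W *m J^T.

Lemma tr11 (R : realType) (M : 'M[R]_1) : M^T = M.
Proof. by apply/matrixP => i j; rewrite mxE !ord1. Qed.

Lemma IformE (R : realType) (w : multivec R 6 3) (o : multivec R 6 2) (W : 'M[R]_6) a b :
  (forall a b : 'rV[R]_6, o (col_mx a b) = (a *m W *m b^T) 0 0) -> W^T = - W ->
  Iform w o a b = (a *m (2^-1 *: gram (para_complex w) W) *m b^T) 0 0.
Proof.
move=> oW sW; rewrite /Iform !oW /gram; set J := para_complex w.
rewrite -[b *m J *m W *m a^T]tr11 !trmx_mul trmxK sW.
rewrite -scalemxAr -scalemxAl [RHS]mxE; congr (_ * _).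
rewrite mulmxBr mulmxBl mulNmx mulmxN !mulmxA [RHS]mxE [X in _ = _ + X]mxE.
by rewrite [X in _ + X = _]mxE.
Qed.

Lemma gram_frame (R : realType) (A W : 'M[R]_6) : A \in unitmx ->
  invmx A *m gram (A *m I0 R *m invmx A) W *m (invmx A)^T =
  gram (I0 R) (invmx A *m W *m (invmx A)^T).
Proof.
move=> uA; rewrite /gram mulmxBr mulmxBl !trmx_mul !mulmxA mulVmx // mul1mx.
congr (_ - _); rewrite -!mulmxA; congr (_ *m (_ *m (_ *m _))).
by rewrite -trmx_mul mulVmx // trmx1 mulmx1.
Qed.

Lemma I0_tr (R : realType) : (I0 R)^T = I0 R.
Proof.
change ((block_mx 1%:M 0 0 (- 1%:M) : 'M[R]_(3 + 3))^T = block_mx 1%:M 0 0 (- 1%:M)).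
by rewrite tr_block_mx !trmx0 linearN /= trmx1.
Qed.

Lemma gram_block (R : realType) (X Y Z V : 'M[R]_3) :
  gram (I0 R) (block_mx X Y Z V : 'M[R]_(3 + 3)) = (block_mx 0 (2 *: Y) (- 2 *: Z) 0 : 'M[R]_(3 + 3)).
Proof.
rewrite /gram I0_tr.
change ((block_mx 1%:M 0 0 (- 1%:M) : 'M[R]_(3 + 3)) *m block_mx X Y Z V -
  block_mx X Y Z V *m (block_mx 1%:M 0 0 (- 1%:M) : 'M[R]_(3 + 3)) = block_mx 0 (2 *: Y) (- 2 *: Z) 0).
rewrite !mulmx_block !(mulmx0, mul0mx, mulmx1, mul1mx, addr0, add0r, mulmxN, mulNmx).
rewrite opp_block_mx add_block_mx opprK !subrr ?addNr scaleNr scaler_nat mulr2n.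
by rewrite [2 *: Z]scaler_nat mulr2n opprD.
Qed.

(** In a frame the two eigenspaces of J are isotropic for the symmetric form, since W is skew.  A
nondegenerate symmetric form on R^6 with two complementary isotropic subspaces of dimension 3 has
signature (3, 3). *)
Lemma Iform_signature (R : realType) (w : multivec R 6 3) (A : 'M[R]_6) (o : multivec R 6 2)
    (W : 'M[R]_6) : SL3_frame w A ->
  (forall a b : 'rV[R]_6, o (col_mx a b) = (a *m W *m b^T) 0 0) -> W^T = - W ->
  gram (para_complex w) W \in unitmx -> @signature R 3 3 (Iform w o).
Proof.
move=> fA oW sW; rewrite (para_complexE fA).
have uA : A \in unitmx by rewrite unitmxE unitfE gt_eqF //; case: fA.
set W' : 'M[R]_(3 + 3) := invmx A *m W *m (invmx A)^T => uG.
have sW' : (W' : 'M[R]_(3 + 3))^T = - W' by rewrite /W' !trmx_mul trmxK sW mulNmx mulmxN mulmxA.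
have : gram (I0 R) W' \in unitmx.
  by rewrite -gram_frame // !unitmx_mul unitmx_tr unitmx_inv uA uG.
have E := gram_frame W uA; rewrite -/W' in E.
move: E sW'; rewrite -(@submxK _ 3 3 3 3 W').
move: (@ulsubmx _ 3 3 3 3 W') (@ursubmx _ 3 3 3 3 W') (@dlsubmx _ 3 3 3 3 W') (@drsubmx _ 3 3 3 3 W').
move=> X Y Z V; rewrite gram_block tr_block_mx opp_block_mx => E /eq_block_mx[_ hZ _ _] uS.
have {}hZ : Z = - Y^T by rewrite -[Z]trmxK hZ linearN.
have uY : Y \in unitmx.
  move: uS; rewrite unitmxE det_antidiag unitrN unitrM -!unitmxE => /andP[+ _].
  by rewrite !unitmxE detZ unitrM => /andP[].
(* the bases 1 and D of the two isotropic subspaces are dual up to the factor 2 *)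
pose D := 2^-1 *: (invmx Y)^T.
pose C : 'M[R]_(3 + 3) := block_mx 1%:M D 1%:M (- D).
have YD : Y *m D^T = 2^-1%:M by rewrite /D linearZ /= trmxK -scalemxAr mulmxV // scalemx1.
have DY : D *m Y^T = 2^-1%:M by rewrite -[LHS]trmxK trmx_mul trmxK YD tr_scalar_mx.
have key : C *m (2^-1 *: (block_mx 0 (2 *: Y) (- 2 *: Z) 0 : 'M[R]_(3 + 3))) *m C^T =
    block_mx 1%:M 0 0 (- 1%:M).
  rewrite scale_block_mx !scaler0 !scalerA hZ mulrN mulVf ?pnatr_eq0 // scale1r scaleN1r opprK.
  rewrite /C tr_block_mx mulmx_block !(mulmx0, mul0mx, mul1mx, addr0, add0r) mulmx_block.
  rewrite !trmx1 !mulmx1 linearN /= !(mulmxN, mulNmx) DY YD.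
  have h : 2^-1%:M + 2^-1%:M = 1%:M :> 'M[R]_3.
    by rewrite -raddfD /=; congr (_%:M); field.
  by rewrite h subrr addNr -opprD h.
have key2 : (C *m invmx A) *m (2^-1 *: gram (A *m I0 R *m invmx A) W) *m (C *m invmx A)^T =
    block_mx 1%:M 0 0 (- 1%:M).
  rewrite -key -E trmx_mul -scalemxAr -scalemxAl -scalemxAr -scalemxAl !mulmxA.
  by [].
exists (C *m invmx A).
  have : (C *m invmx A) *m ((2^-1 *: gram (A *m I0 R *m invmx A) W) *m (C *m invmx A)^T *m
      block_mx 1%:M 0 0 (- 1%:M)) = 1%:M.
    rewrite !mulmxA key2 mulmx_block !(mulmx0, mul0mx, mul1mx, addr0, add0r) mulmxN mulmx1 opprK.
    by rewrite -scalar_mx_block.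
  by case/mulmx1_unit.
move=> i j; rewrite (IformE w _ _ oW sW) (para_complexE fA).
move/matrixP: key2 => /(_ i j) <-.
have e (M1 M2 : 'M[R]_6) (p q : 'I_6) : (row p M1 *m col q M2) 0 0 = (M1 *m M2) p q.
  by rewrite !mxE; apply: eq_bigr => k _; rewrite !mxE.
by rewrite -row_mul tr_row e.
Qed.

Definition omega_mx (R : realType) : 'M[R]_6 := \matrix_(i, j)
  (nth 0 [:: - 1; 1; 1; 1; - 1; - 1] i * ((j : nat) == nth 0%N [:: 1; 0; 5; 4; 3; 2]%N i)%:R).

Lemma omega_mxE (R : realType) (a b : 'rV[R]_6) : (a *m omega_mx R *m b^T) 0 0 = omega a b.
Proof.
rewrite -mulmxA mxE sum6.
have e (i : 'I_6) : (omega_mx R *m b^T) i 0 =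
    nth 0 [:: - 1; 1; 1; 1; - 1; - 1] i * b 0 (inord (nth 0%N [:: 1; 0; 5; 4; 3; 2]%N i)).
  rewrite mxE (bigD1 (inord (nth 0%N [:: 1; 0; 5; 4; 3; 2]%N i))) //= big1 => [|j jN].
    rewrite !mxE inordK ?eqxx ?mulr1 ?addr0 //.
    by case: i => -[|[|[|[|[|[|//]]]]]].
  rewrite !mxE; case: eqP => [h|]; last by rewrite mulr0 mul0r.
  by case/negP: jN; apply/eqP/val_inj; rewrite /= inordK // -h.
rewrite !e /omega /form2 /pl !mxE /=.
have i0 : inord 0 = 0 :> 'I_6 by apply/val_inj; rewrite /= inordK.
have i1 : inord 1 = 1 :> 'I_6 by apply/val_inj; rewrite /= inordK.
have i2 : inord 2 = 2 :> 'I_6 by apply/val_inj; rewrite /= inordK.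
have i3 : inord 3 = 3 :> 'I_6 by apply/val_inj; rewrite /= inordK.
have i4 : inord 4 = 4 :> 'I_6 by apply/val_inj; rewrite /= inordK.
have i5 : inord 5 = 5 :> 'I_6 by apply/val_inj; rewrite /= inordK.
by rewrite i0 i1 i2 i3 i4 i5; ring.
Qed.

Lemma ord6P (Q : 'I_6 -> Prop) : Q 0 -> Q 1 -> Q 2 -> Q 3 -> Q 4 -> Q 5 -> forall i, Q i.
Proof.
move=> q0 q1 q2 q3 q4 q5 [[|[|[|[|[|[|//]]]]]] h].
- by rewrite (_ : Ordinal h = 0) //; exact/val_inj.
- by rewrite (_ : Ordinal h = 1) //; exact/val_inj.
- by rewrite (_ : Ordinal h = 2) //; exact/val_inj.
- by rewrite (_ : Ordinal h = 3) //; exact/val_inj.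
- by rewrite (_ : Ordinal h = 4) //; exact/val_inj.
- by rewrite (_ : Ordinal h = 5) //; exact/val_inj.
Qed.

Lemma omega_mx_skew (R : realType) : (omega_mx R)^T = - omega_mx R.
Proof.
by apply/matrixP; elim/ord6P; elim/ord6P; rewrite !mxE /= ?(mulr1, mulr0, opprK, oppr0).
Qed.

Lemma omega_mx_unit (R : realType) : omega_mx R \in unitmx.
Proof.
have : omega_mx R *m (- omega_mx R) = 1%:M.
  by apply/matrixP; elim/ord6P; elim/ord6P; rewrite mxE sum6 !mxE /=; ring.
by case/mulmx1_unit.
Qed.

(** Both eigenspaces of J are Lagrangian, so that the 2-form pairs them perfectly. *)
Lemma pencil_gram (R : realType) (P K f : 'rV[R]_3) :
  dot K K < dot P P -> f != 0 -> P 0 2 = 0 ->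
  exists2 A : 'M[R]_6, SL3_frame (pencil P K f) A &
    gram (para_complex (pencil P K f)) (omega_mx R) \in unitmx.
Proof.
move=> KP f0 P2; have [A fA lag] := pencil_frame KP f0; exists A => //.
rewrite (para_complexE fA).
have uA : A \in unitmx by rewrite unitmxE unitfE gt_eqF //; case: fA.
pose W : 'M[R]_(3 + 3) := invmx A *m omega_mx R *m (invmx A)^T.
have e (x y : 'rV[R]_(3 + 3)) : (x *m W *m y^T) 0 0 = omega (x *m invmx A) (y *m invmx A).
  by rewrite -omega_mxE trmx_mul /W !mulmxA.
have ul : ulsubmx W = 0.
  apply/matrixP => i j; rewrite [RHS]mxE.
  have [h _] := lag P2 (delta_mx 0 i) (delta_mx 0 j); rewrite -h -e.
  rewrite -{2}(submxK W) mul_row_block !mul0mx !addr0 tr_row_mx mul_row_col trmx0 mulmx0 addr0.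
  by rewrite trmx_delta -rowE -colE !mxE.
have dr : drsubmx W = 0.
  apply/matrixP => i j; rewrite [RHS]mxE.
  have [_ h] := lag P2 (delta_mx 0 i) (delta_mx 0 j); rewrite -h -e.
  rewrite -{2}(submxK W) mul_row_block !mul0mx !add0r tr_row_mx mul_row_col trmx0 mulmx0 add0r.
  by rewrite trmx_delta -rowE -colE !mxE.
have uW : W \in unitmx by rewrite !unitmx_mul unitmx_tr unitmx_inv uA omega_mx_unit.
have : gram (I0 R) W \in unitmx.
  move: uW; rewrite -(submxK W) ul dr gram_block !unitmxE !det_antidiag !unitrN !unitrM.
  rewrite -!unitmxE => /andP[uY uZ].
  by rewrite !unitmxZ ?uY ?unitrN // unitfE pnatr_eq0.
rewrite -gram_frame //; rewrite !unitmx_mul => /andP[/andP[_ ->]] //.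
Qed.

(** * The cube of the 2-form *)

Section Wedge.
Variable R : realType.

Lemma wedge_pullback m n k l (A : 'M[R]_(m, n)) (a : multivec R n k) (b : multivec R n l) :
  wedge (pullback A a) (pullback A b) = pullback A (wedge a b).
Proof.
apply/funext => v; rewrite /wedge /pullback; congr (_ * _); apply: eq_bigr => s _.
congr (_ * a _ * b _); apply/matrixP => i j; rewrite !mxE;
  by apply: eq_bigr => t _; rewrite !mxE.
Qed.

Lemma wedge_suml n k l (I : finType) (x : I -> R) (f : I -> multivec R n k) (g : multivec R n l) :
  wedge (fun v => \sum_i x i * f i v) g = fun v => \sum_i x i * wedge (f i) g v.
Proof.
apply/funext => v; rewrite /wedge.
under [RHS]eq_bigr => i _ do rewrite mulrCA big_distrr /=.
rewrite -big_distrr /= exchange_big /=; congr (_ * _); apply: eq_bigr => s _.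
rewrite big_distrr big_distrl /=; apply: eq_bigr => i _.
by rewrite [in LHS]mulrCA !mulrA.
Qed.

Lemma wedge_sumr n k l (I : finType) (x : I -> R) (f : I -> multivec R n l) (g : multivec R n k) :
  wedge g (fun v => \sum_i x i * f i v) = fun v => \sum_i x i * wedge g (f i) v.
Proof.
apply/funext => v; rewrite /wedge.
under [RHS]eq_bigr => i _ do rewrite mulrCA big_distrr /=.
rewrite -big_distrr /= exchange_big /=; congr (_ * _); apply: eq_bigr => s _.
rewrite big_distrr /=; apply: eq_bigr => i _.
by rewrite [in LHS]mulrCA !mulrA.
Qed.

Definition omega_form : multivec R 6 2 := fun v => omega (row 0 v) (row 1 v).

Definition pair_mx (i j : 'I_6) : 'M[R]_(6, 2) :=
  \matrix_(k, l) (k == if l == 0 then i else j)%:R.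

Definition omega_pair (a : 'I_3) : 'M[R]_(6, 2) :=
  if a == 0 then pair_mx 0 1 else if a == 1 then pair_mx 2 5 else pair_mx 3 4.

Definition omega_sign (a : 'I_3) : R := if a == 0 then - 1 else 1.

Lemma det_pair_mx i j (v : 'M[R]_(2, 6)) : \det (v *m pair_mx i j) = pl i j (row 0 v) (row 1 v).
Proof.
have e k l : (v *m pair_mx i j) k l = v k (if l == 0 then i else j).
  rewrite mxE (bigD1 (if l == 0 then i else j)) //= big1 => [|m mN].
    by rewrite !mxE eqxx mulr1 addr0.
  by rewrite !mxE (negPf mN) mulr0.
by rewrite det_mx2 !e /pl !mxE.
Qed.

(** A sum of three decomposable forms in disjoint pairs of variables. *)
Lemma omega_formE : omega_form = fun v => \sum_a omega_sign a * detform (omega_pair a) v.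
Proof.
apply/funext => v; rewrite sum3 /omega_sign /omega_pair /detform /= !det_pair_mx /omega_form /omega.
by rewrite /form2 !mxE /=; ring.
Qed.

Definition cols6 (A B C : 'M[R]_(6, 2)) : 'M[R]_6 := \matrix_(i, j)
  nth 0 [:: A i 0; A i 1; B i 0; B i 1; C i 0; C i 1] j.

Lemma cols6E A B C : row_mx (row_mx A B) C = cols6 A B C.
Proof.
apply/matrixP => i j.
have e (j' : 'I_(2 + 2 + 2)) : val j = val j' ->
    row_mx (row_mx A B) C i j = row_mx (row_mx A B) C i j' by move=> /val_inj ->.
rewrite [RHS]mxE; move: j e; elim/ord6P => e /=.
- by rewrite (e (lshift 2 (lshift 2 0)) erefl) !row_mxEl.
- by rewrite (e (lshift 2 (lshift 2 1)) erefl) !row_mxEl.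
- by rewrite (e (lshift 2 (rshift 2 0)) erefl) row_mxEl row_mxEr.
- by rewrite (e (lshift 2 (rshift 2 1)) erefl) row_mxEl row_mxEr.
- by rewrite (e (rshift (2 + 2) 0) erefl) row_mxEr.
- by rewrite (e (rshift (2 + 2) 1) erefl) row_mxEr.
Qed.

Lemma cols6_swap12 A B C : \det (cols6 B A C) = \det (cols6 A B C).
Proof.
have -> : cols6 B A C = col_perm (tperm 0 2 * tperm 1 3) (cols6 A B C).
  by apply/matrixP => i; elim/ord6P; rewrite !mxE permM !permE /= ?permE.
by rewrite col_permE det_mulmx det_perm odd_permV odd_permM !odd_tperm /= expr0 mulr1.
Qed.

Lemma cols6_swap23 A B C : \det (cols6 A C B) = \det (cols6 A B C).
Proof.
have -> : cols6 A C B = col_perm (tperm 2 4 * tperm 3 5) (cols6 A B C).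
  by apply/matrixP => i; elim/ord6P; rewrite !mxE permM !permE /= ?permE.
by rewrite col_permE det_mulmx det_perm odd_permV odd_permM !odd_tperm /= expr0 mulr1.
Qed.

Lemma cols6_eq12 A C : \det (cols6 A A C) = 0.
Proof.
rewrite -det_tr; apply: (@determinant_alternate _ _ _ 0 2) => // j.
by rewrite !mxE.
Qed.

Lemma cols6_omega : \det (cols6 (omega_pair 0) (omega_pair 1) (omega_pair 2)) = 1.
Proof.
transitivity (\det (block_mx 1%:M 0 0 (mx3 0 1 0 0 0 1 1 0 0) : 'M[R]_(3 + 3))).
  congr determinant.
  suff h (i j : 'I_(3 + 3)) : cols6 (omega_pair 0) (omega_pair 1) (omega_pair 2) i j =
      (block_mx 1%:M 0 0 (mx3 0 1 0 0 0 1 1 0 0) : 'M[R]_(3 + 3)) i j.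
    by apply/matrixP => i j; exact: h.
  rewrite -(@fintype.splitK 3 3 i) -(@fintype.splitK 3 3 j).
  case: (fintype.split i) => i'; case: (fintype.split j) => j' /=;
    rewrite ?block_mxEul ?block_mxEur ?block_mxEdl ?block_mxEdr [LHS]mxE;
    case: (ord3P i') => ->; case: (ord3P j') => ->;
    by rewrite /omega_pair /= !mxE -?val_eqE.
by rewrite det_ublock det1 mul1r det_mx3 !mxE /=; ring.
Qed.

(** Only the six products of three different pairs are nonzero, and even forms commute.  The value is
- 6 because exactly one of the three signs is negative. *)
Lemma omega_cube (B : 'M[R]_6) :
  wedge (wedge omega_form omega_form) omega_form B = - 6 * \det B.
Proof.
have -> : wedge (wedge omega_form omega_form) omega_form B = \sum_a \sum_b \sum_c
    omega_sign a * (omega_sign b * (omega_sign c *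
      (\det B * \det (cols6 (omega_pair a) (omega_pair b) (omega_pair c))))).
  have h : wedge omega_form omega_form = fun v => \sum_a omega_sign a *
      (fun v => \sum_b omega_sign b * wedge (detform (omega_pair a)) (detform (omega_pair b)) v) v.
    rewrite {1}omega_formE wedge_suml; apply/funext => v; apply: eq_bigr => a _.
    by rewrite omega_formE wedge_sumr.
  rewrite h (wedge_suml omega_sign (fun a v => \sum_b omega_sign b *
    wedge (detform (omega_pair a)) (detform (omega_pair b)) v)).
  apply: eq_bigr => a _; rewrite (wedge_suml omega_sign (fun b =>
    wedge (detform (omega_pair a)) (detform (omega_pair b)))) big_distrr /=.
  apply: eq_bigr => b _; rewrite omega_formE wedge_sumr !big_distrr /=.
  apply: eq_bigr => c _; rewrite !wedge_detform /detform cols6E.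
  by rewrite det_mulmx.
have z13 X Y : \det (cols6 X Y X) = 0 by rewrite cols6_swap23 cols6_eq12.
have z23 X Y : \det (cols6 Y X X) = 0 by rewrite cols6_swap12 z13.
rewrite !sum3 !cols6_eq12 !z13 !z23.
have -> : \det (cols6 (omega_pair 0) (omega_pair 2) (omega_pair 1)) = 1.
  by rewrite cols6_swap23 cols6_omega.
have -> : \det (cols6 (omega_pair 1) (omega_pair 2) (omega_pair 0)) = 1.
  by rewrite cols6_swap23 cols6_swap12 cols6_omega.
have -> : \det (cols6 (omega_pair 2) (omega_pair 0) (omega_pair 1)) = 1.
  by rewrite cols6_swap12 cols6_swap23 cols6_omega.
have -> : \det (cols6 (omega_pair 1) (omega_pair 0) (omega_pair 2)) = 1.
  by rewrite cols6_swap12 cols6_omega.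
rewrite cols6_omega.
have -> : \det (cols6 (omega_pair 2) (omega_pair 1) (omega_pair 0)) = 1.
  by rewrite cols6_swap12 cols6_swap23 cols6_swap12 cols6_omega.
rewrite /omega_sign /=; ring.
Qed.

Lemma omega_form_alternating : alternating_form omega_form.
Proof.
have -> : omega_form = fun v => 1 * (fun v => - 1 * detform (pair_mx 0 1) v + 1 * detform (pair_mx 2 5) v) v
    + 1 * detform (pair_mx 3 4) v.
  by apply/funext => v; rewrite omega_formE sum3 /omega_sign /omega_pair /=; ring.
by do 2 (apply: alternatingD; last exact: detform_alternating); exact: detform_alternating.
Qed.

Lemma negative_top_omega (M : 'M[R]_6) : 0 < \det M ->
  let o := pullback M omega_form in @negative_top R 6 (wedge (wedge o o) o).
Proof.
move=> dM o B dB; rewrite /o !wedge_pullback /pullback omega_cube det_mulmx.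
by rewrite mulNr oppr_lt0 !mulr_gt0.
Qed.
End Wedge.

(** * Trigonometric differential forms *)

Section Wave.
Variables (R : realType) (n : nat).
Implicit Types (a : 'cV[R]_n) (x v : 'rV[R]_n) (p : R).

Definition pairing x a : R := (x *m a) 0 0.

Lemma pairingD x y a : pairing (x + y) a = pairing x a + pairing y a.
Proof. by rewrite /pairing mulmxDl mxE. Qed.

Lemma pairingZ k x a : pairing (k *: x) a = k * pairing x a.
Proof. by rewrite /pairing -scalemxAl mxE. Qed.

Lemma pairing_continuous a : continuous (pairing^~ a : 'rV[R]_n -> R).
Proof.
have -> : pairing^~ a = fun x => \sum_i x 0 i * a i 0.
  by apply/funext => x; rewrite /pairing mxE.
move=> x; apply: (@cvg_sumR _ (nbhs x) (nbhs_filter x)) => i; apply: cvgM; last exact: cvg_cst.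
exact: coord_continuous.
Qed.

Lemma wave_diff a p x : differentiable (fun y : 'rV[R]_n => cos (pairing y a + p)) x /\
  forall v, 'D_v (fun y : 'rV[R]_n => cos (pairing y a + p)) x =
    pairing v a * cos (pairing x a + p + pi / 2).
Proof.
have lin : linear (pairing^~ a : 'rV[R]_n -> R) by move=> k u v; rewrite pairingD pairingZ.
pose LM := GRing.isLinear.Build _ _ _ _ _ lin.
pose L : {linear 'rV[R]_n -> R} := HB.pack (pairing^~ a : 'rV[R]_n -> R) LM.
have cL : continuous L by exact: pairing_continuous.
pose l : 'rV[R]_n -> R := fun y => pairing y a.
have dL : differentiable l x by exact: (@linear_differentiable _ _ _ L).
have dp : differentiable (cst p : 'rV[R]_n -> R) x by exact: differentiable_cst.
have dLp : differentiable (l + cst p) x by apply: differentiableD.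
have dc y : differentiable (@cos R) y by exact/derivable1_diffP/derivable_cos.
have fE : (fun y : 'rV[R]_n => cos (pairing y a + p)) = @cos R \o (l + cst p) by [].
have df : differentiable (@cos R \o (l + cst p)) x by exact: differentiable_comp.
rewrite fE; split=> // v; rewrite deriveE // diff_comp //=.
have -> : 'd (l + cst p) x v = pairing v a.
  rewrite diffD // (@diff_lin _ _ _ L) // diff_cst.
  exact: addr0.
rewrite -[pairing v a]mulr1 -[_ * 1]/(pairing v a *: (1 : R)) linearZ /=.
rewrite -deriveE // derive_val.
rewrite [in RHS]cosD cos_pihalf sin_pihalf mulr0 sub0r mulr1.
by rewrite [(pairing v a)%:A]mulr1.
Qed.

Definition trig_sum (s : seq (R * 'cV[R]_n * R)) : 'rV[R]_n -> R :=
  fun x => \sum_(q <- s) q.1.1 * cos (pairing x q.1.2 + q.2).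

(** The derivative of a cosine is a cosine with the phase shifted by a quarter period, so these sums
are closed under derivatives. *)
Lemma trig_sum_diff s x : differentiable (trig_sum s) x /\
  forall v, 'D_v (trig_sum s) x =
    trig_sum [seq (q.1.1 * pairing v q.1.2, q.1.2, q.2 + pi / 2) | q <- s] x.
Proof.
elim: s => [|[[c a] p] s [IHd IHD]].
  have -> : trig_sum [::] = cst 0 by apply/funext => y; rewrite /trig_sum big_nil.
  split=> [|v]; first exact: differentiable_cst.
  by rewrite deriveE ?diff_cst //= /trig_sum ?big_nil //; exact: differentiable_cst.
have -> : trig_sum ((c, a, p) :: s) = c \*: (fun y => cos (pairing y a + p)) + trig_sum s.
  by apply/funext => y; rewrite /trig_sum big_cons.
have [wd wD] := wave_diff a p x.
have wd' : differentiable (c \*: (fun y : 'rV[R]_n => cos (pairing y a + p) : R)) x.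
  exact: differentiableZ.
split=> [|v]; first exact: differentiableD.
rewrite deriveD; try exact: diff_derivable.
rewrite deriveZ; try exact: diff_derivable.
rewrite wD IHD /trig_sum big_cons /= addrA; congr (_ + _).
by rewrite -mulrA.
Qed.

Lemma smooth_trig_sum s : smooth (trig_sum s).
Proof.
move=> k; elim: k s => [|k IH] s /=.
  by move=> x; apply: differentiable_continuous; have [] := trig_sum_diff s x.
split=> [x|v]; first by have [] := trig_sum_diff s x.
have -> : 'D_v (trig_sum s) = trig_sum [seq (q.1.1 * pairing v q.1.2, q.1.2, q.2 + pi / 2) | q <- s].
  by apply/funext => x; have [_ ->] := trig_sum_diff s x.
exact: IH.
Qed.
End Wave.

Lemma cosDint (R : realType) (y : R) (z : int) : cos (y + pi *+ 2 * z%:~R) = cos y.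
Proof.
case: z => m.
  by rewrite -pmulrn mulr_natr periodicn //; exact: cosD2pi.
rewrite NegzE mulrNz mulrN -pmulrn mulr_natr.
by rewrite -(periodicn (@cosD2pi R) m.+1) subrK.
Qed.

Section Smooth.
Variables (R : realType) (n : nat).
Implicit Types (f g : 'rV[R]_n -> R).

Lemma Ck_lin k f g (c d : R) : Ck k f -> Ck k g -> Ck k (fun x => c * f x + d * g x).
Proof.
elim: k f g => [|k IH] f g /=.
  move=> cf cg x; exact: (cvgD (cvgM (cvg_cst c) (cf x)) (cvgM (cvg_cst d) (cg x))).
move=> [df Df] [dg Dg].
have -> : (fun x => c * f x + d * g x) = c \*: f + d \*: g by [].
split=> [x|v]; first by apply: differentiableD; exact: differentiableZ.
have -> : 'D_v (c \*: f + d \*: g) = fun x => c * 'D_v f x + d * 'D_v g x.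
  apply/funext => x; rewrite deriveD; try by apply: diff_derivable; exact: differentiableZ.
  by rewrite !deriveZ //; exact: diff_derivable.
by apply: IH.
Qed.

Lemma smooth_lin f g (c d : R) : smooth f -> smooth g -> smooth (fun x => c * f x + d * g x).
Proof. by move=> sf sg k; exact: Ck_lin. Qed.

Lemma smooth_differentiable f x : smooth f -> differentiable f x.
Proof. by move=> /(_ 1%N) []. Qed.

Lemma smooth_cst (c : R) : smooth (fun _ : 'rV[R]_n => c).
Proof.
move=> k; elim: k c => [|k IH] c /=; first exact: cst_continuous.
split=> [x|v]; first exact: differentiable_cst.
have -> : 'D_v (fun _ : 'rV[R]_n => c) = fun=> 0.
  by apply/funext => x; exact: derive_cst.
exact: IH.
Qed.

Definition lin_form k (c d : R) (w1 w2 : dform R n k) : dform R n k :=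
  fun x v => c * w1 x v + d * w2 x v.

Lemma torus_form_lin k (c d : R) (w1 w2 : dform R n k) :
  torus_form w1 -> torus_form w2 -> torus_form (lin_form c d w1 w2).
Proof.
move=> [a1 p1 s1] [a2 p2 s2]; split=> [x|x m v|v].
- exact: alternatingD.
- by rewrite /lin_form p1 p2.
- exact: smooth_lin.
Qed.

Lemma extd_lin k (c d : R) (w1 w2 : dform R n k) x v :
  torus_form w1 -> torus_form w2 ->
  extd (lin_form c d w1 w2) x v = c * extd w1 x v + d * extd w2 x v.
Proof.
move=> [_ _ s1] [_ _ s2]; rewrite /extd !big_distrr -big_split; apply: eq_bigr => i _ /=.
have -> : (fun y => lin_form c d w1 w2 y (row' i v)) =
  c \*: (fun y => w1 y (row' i v)) + d \*: (fun y => w2 y (row' i v)) by [].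
have d1 : differentiable (fun y => w1 y (row' i v)) x by exact: smooth_differentiable.
have d2 : differentiable (fun y => w2 y (row' i v)) x by exact: smooth_differentiable.
rewrite deriveD; try by apply: diff_derivable; exact: differentiableZ.
rewrite !deriveZ; try exact: diff_derivable.
by rewrite mulrDr !mulrA ![_ * (-1) ^+ i]mulrC.
Qed.

(** amp cos (<x, freq> + phase) c1 /\ ... /\ ck, for the columns c1, ..., ck of cov. *)
Record wave k := Wave { amp : R; freq : 'cV[R]_n; phase : R; cov : 'M[R]_(n, k) }.

Definition wave_sum k (s : seq (wave k)) : dform R n k :=
  fun x v => \sum_(q <- s) amp q * cos (pairing x (freq q) + phase q) * \det (v *m cov q).

Definition wave_d k (q : wave k) : wave k.+1 :=
  @Wave k.+1 (amp q) (freq q) (phase q + pi / 2) (row_mx (freq q) (cov q) : 'M[R]_(n, 1 + k)).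

Lemma wave_sum_trig k (s : seq (wave k)) v :
  (fun x => wave_sum s x v) = trig_sum [seq (amp q * \det (v *m cov q), freq q, phase q) | q <- s].
Proof.
apply/funext => x; rewrite /wave_sum /trig_sum big_map; apply: eq_bigr => q _ /=.
by rewrite mulrAC.
Qed.

Lemma wave_sum_alternating k (s : seq (wave k)) x : alternating_form (wave_sum s x).
Proof.
elim: s => [|q s IH].
  by split=> [A B C i0 b c _ _ _|A i1 i2 _ _]; rewrite /wave_sum !big_nil ?mulr0 ?addr0.
have -> : wave_sum (q :: s) x = fun v =>
    (amp q * cos (pairing x (freq q) + phase q)) * detform (cov q) v + 1 * wave_sum s x v.
  by apply/funext => v; rewrite /wave_sum big_cons mul1r.
by apply: alternatingD => //; exact: detform_alternating.
Qed.

(** The wave is periodic for the integral lattice. *)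
Definition integral_freq k (q : wave k) : Prop :=
  forall m : 'rV[int]_n, exists z : int, pairing (map_mx intr m) (freq q) = (pi *+ 2) * z%:~R.

Lemma torus_wave_sum k (s : seq (wave k)) :
  (forall q, List.In q s -> integral_freq q) -> torus_form (wave_sum s).
Proof.
move=> hs; split=> [x|x m v|v].
- exact: wave_sum_alternating.
- rewrite /wave_sum; elim: s hs => [|q s IH] hs; first by rewrite !big_nil.
  rewrite !big_cons IH => [|q' q's]; last by apply: hs; right.
  have [z hz] := hs q (or_introl erefl) m.
  by rewrite pairingD hz addrAC cosDint.
- rewrite wave_sum_trig; exact: smooth_trig_sum.
Qed.

(** The differential of the cosine is the frequency times the shifted cosine; expanding the determinant
along its new first column gives the alternating sum of the exterior derivative. *)
Lemma extd_wave_sum k (s : seq (wave k)) x v :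
  extd (wave_sum s) x v = wave_sum [seq wave_d q | q <- s] x v.
Proof.
rewrite /extd; transitivity (\sum_(i < k.+1) (-1) ^+ i * trig_sum
   [seq (q.1.1 * pairing (row i v) q.1.2, q.1.2, q.2 + pi / 2) | q <-
     [seq (amp q * \det (row' i v *m cov q), freq q, phase q) | q <- s]] x).
  by apply: eq_bigr => i _; rewrite wave_sum_trig; have [_ ->] := trig_sum_diff
    [seq (amp q * \det (row' i v *m cov q), freq q, phase q) | q <- s] x.
rewrite /trig_sum /wave_sum; under eq_bigr => i _ do rewrite !big_map big_distrr /=.
rewrite exchange_big big_map; apply: eq_bigr => q _ /=.
rewrite (expand_det_col _ 0) big_distrr /=; apply: eq_bigr => i _.
have -> : (v *m row_mx (freq q) (cov q)) i 0 = pairing (row i v) (freq q).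
  rewrite /pairing !mxE; apply: eq_bigr => l _; rewrite !mxE; congr (_ * _).
  by case: splitP => [j _|j /eqP //]; rewrite ord1.
have -> : cofactor (v *m row_mx (freq q) (cov q)) i 0 = (-1) ^+ i * \det (row' i v *m cov q).
  rewrite /cofactor addn0; congr (_ * \det _); apply/matrixP => p r.
  rewrite !mxE; apply: eq_bigr => l _; rewrite !mxE; congr (_ * _).
  case: splitP => [j|j /=]; first by rewrite ord1.
  rewrite /bump /= ?add0n ?add1n => h; congr (cov q _ _); apply/val_inj; by case: h.
by ring.
Qed.

Lemma wave_sum_closed k (s : seq (wave k)) : closed_form (wave_sum [seq wave_d q | q <- s]).
Proof.
move=> x v; rewrite extd_wave_sum /wave_sum big_map big_map big1 // => q _ /=.
suff -> : \det (v *m row_mx (freq q) (row_mx (freq q) (cov q) : 'M[R]_(n, 1 + k))) = 0 by rewrite mulr0.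
rewrite -det_tr; apply: (@determinant_alternate _ _ _ 0 (lift 0 0)) => // i.
rewrite [LHS]mxE [RHS]mxE !mxE; apply: eq_bigr => l _; congr (_ * _); rewrite !mxE.
case: splitP => [j _|j /eqP //]; case: splitP => [j' |j' /= /esym/eqP]; first by rewrite ord1.
rewrite add1n eqSS => /eqP j'0; rewrite mxE; case: splitP => [j'' _|j'']; first by rewrite !ord1.
by rewrite j'0.
Qed.
End Smooth.

(** * The explicit forms *)

Section Explicit.
Variable R : realType.

Definition row3 (a b c : R) : 'rV[R]_3 := \row_j (if j == 0 then a else if j == 1 then b else c).

(** The three families of coefficients are the derivatives of a potential, [terms], so that the form is
exact.  P turns once in the first two directions, which keeps it orthogonal to w3.  For e = 1 the
vector f is chosen so that, where sin s = sin t = 0, only its first entry remains and cos s times this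
entry is 2 at s = t = 0 and - 2 at the three other points.  For e = 0, and on the lines s = 0, t = 0
and s = t, it avoids the third axis. *)
Definition P_ (s : R) := row3 (3 * cos s) (3 * sin s) 0.
Definition K_ (e s t : R) := row3 (e * (sin s * sin t * (cos t - 1))) 0 (e * (cos s * sin t)).
Definition f_ (e s t : R) :=
  row3 (cos t + e * ((2 * cos t ^+ 2 - 1) * (1 - cos s) + cos s * cos t)) (sin t) (e * (sin s * cos t)).

Definition rho (e s t : R) : multivec R 6 3 := pencil (P_ s) (K_ e s t) (f_ e s t).

(** coef cos (fs s + ft t + ph) times the (anti-)self-dual form number ix. *)
Record term := Term { coef : R; fs : int; ft : int; ph : R; anti : bool; ix : 'I_3 }.

Definition quarter : R := - (pi / 2).

(** The potential 3 (sin s w1 - cos s w2) + F, for a primitive F of f in t with dF/ds = K. *)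
Definition terms (e : R) : seq term := [::
  Term 3 1 0 quarter false 0; Term (- 3) 1 0 0 false 1;
  Term (- 1) 0 1 0 true 1;
  Term (e / 2) 1 (- 1) 0 true 2; Term (- (e / 2)) 1 1 0 true 2;
  Term 1 0 1 quarter true 0; Term (e / 2) 0 2 quarter true 0;
  Term (e / 2) 1 1 quarter true 0; Term (e / 2) (- 1) 1 quarter true 0;
  Term (- (e / 4)) 1 2 quarter true 0; Term (- (e / 4)) (- 1) 2 quarter true 0].

Definition term_freq (q : term) : 'cV[R]_6 := st_col (pi *+ 2 * (fs q)%:~R) (pi *+ 2 * (ft q)%:~R).

(** The (anti-)self-dual form number i is the sum or difference of the products of the coordinates in
these two pairs, according to [pair_sign]. *)
Definition pair1 (i : 'I_3) : 'M[R]_(6, 2) :=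
  if i == 0 then pair_mx R 2 3 else if i == 1 then pair_mx R 2 4 else pair_mx R 2 5.
Definition pair2 (i : 'I_3) : 'M[R]_(6, 2) :=
  if i == 0 then pair_mx R 4 5 else if i == 1 then pair_mx R 3 5 else pair_mx R 3 4.
Definition pair_sign (b : bool) (i : 'I_3) : R := if b (+) (i == 1) then - 1 else 1.

Definition term_waves (q : term) : seq (wave R 6 2) := [::
  Wave (coef q / (pi *+ 2)) (term_freq q) (ph q) (pair1 (ix q));
  Wave (pair_sign (anti q) (ix q) * coef q / (pi *+ 2)) (term_freq q) (ph q) (pair2 (ix q))].

Definition eta (e : R) : seq (wave R 6 2) := flatten [seq term_waves q | q <- terms e].

Definition wave_pull k (M : 'M[R]_6) (q : wave R 6 k) : wave R 6 k :=
  Wave (amp q) (M *m freq q) (phase q) (M *m cov q).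

Definition basis2 (b : bool) (i : 'I_3) : 'rV[R]_6 -> 'rV[R]_6 -> R :=
  if b then form2 0 (delta_mx 0 i) else form2 (delta_mx 0 i) 0.

Lemma basis2E b i (v : 'M[R]_(2, 6)) :
  \det (v *m pair1 i) + pair_sign b i * \det (v *m pair2 i) = basis2 b i (row 0 v) (row 1 v).
Proof.
rewrite /pair1 /pair2 /pair_sign /basis2 /form2.
by case: (ord3P i) => -> /=; case: b => /=; rewrite !det_pair_mx !mxE /=; ring.
Qed.

Lemma det_row_mx (a : 'cV[R]_6) (C : 'M[R]_(6, 2)) (v : 'M[R]_(3, 6)) :
  \det (v *m (row_mx a C : 'M[R]_(6, 1 + 2))) =
  \sum_(i < 3) (-1) ^+ i * pairing (row i v) a * \det (row' i v *m C).
Proof.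
rewrite (expand_det_col _ 0); apply: eq_bigr => i _.
have -> : (v *m (row_mx a C : 'M[R]_(6, 1 + 2))) i 0 = pairing (row i v) a.
  rewrite /pairing !mxE; apply: eq_bigr => l _; rewrite !mxE; congr (_ * _).
  by case: splitP => [j _|j /eqP //]; rewrite ord1.
rewrite /cofactor addn0 mulrCA mulrA; congr (_ * \det _); apply/matrixP => p r.
rewrite !mxE; apply: eq_bigr => l _; rewrite !mxE; congr (_ * _).
case: splitP => [j|j /=]; first by rewrite ord1.
by rewrite /bump /= ?add0n ?add1n => h; congr (C _ _); apply/val_inj; case: h.
Qed.

(** (x ds + y dt) /\ B. *)
Definition wedge12 (x y : R) (B : 'rV[R]_6 -> 'rV[R]_6 -> R) (v : 'M[R]_(3, 6)) : R :=
  let a := row 0 v in let b := row 1 v in let c := row 2 v in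
  x * (a 0 0 * B b c - b 0 0 * B a c + c 0 0 * B a b) +
  y * (a 0 1 * B b c - b 0 1 * B a c + c 0 1 * B a b).

Lemma term_waves_d q x v :
  wave_sum [seq wave_d w | w <- term_waves q] x v =
  coef q * cos (pi *+ 2 * ((fs q)%:~R * x 0 0 + (ft q)%:~R * x 0 1) + (ph q + pi / 2)) *
  wedge12 (fs q)%:~R (ft q)%:~R (basis2 (anti q) (ix q)) v.
Proof.
rewrite /wave_sum /= !big_cons big_nil /= addr0 !det_row_mx.
have B := fun i => basis2E (anti q) (ix q) (row' i v).
have pE u : pairing u (term_freq q) = pi *+ 2 * ((fs q)%:~R * u 0 0 + (ft q)%:~R * u 0 1).
  by rewrite /pairing /term_freq st_colE; ring.
have r0 : row 0 (row' 0 v) = row 1 v by apply/rowP => j; rewrite !mxE; congr (v _ _); exact/val_inj.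
have r1 : row 1 (row' 0 v) = row 2 v by apply/rowP => j; rewrite !mxE; congr (v _ _); exact/val_inj.
have r2 : row 0 (row' 1 v) = row 0 v by apply/rowP => j; rewrite !mxE; congr (v _ _); exact/val_inj.
have r3 : row 1 (row' 1 v) = row 2 v by apply/rowP => j; rewrite !mxE; congr (v _ _); exact/val_inj.
have r4 : row 0 (row' 2 v) = row 0 v by apply/rowP => j; rewrite !mxE; congr (v _ _); exact/val_inj.
have r5 : row 1 (row' 2 v) = row 1 v by apply/rowP => j; rewrite !mxE; congr (v _ _); exact/val_inj.
have b0 := B 0; have b1 := B 1; have b2 := B 2; rewrite r0 r1 in b0; rewrite r2 r3 in b1; rewrite r4 r5 in b2.
rewrite !sum3 /wedge12 -b0 -b1 -b2 !pE.
have p0 : (pi *+ 2 : R) != 0 by rewrite mulrn_eq0 /= gt_eqF // pi_gt0.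
move: (cos _) (\det _) (\det _) (\det _) (\det _) (\det _) (\det _) => C D1 D2 D3 D4 D5 D6.
rewrite expr0 expr1 sqrrN expr1n !(mxE _ _ 0 0, mxE _ _ 0 1).
move: (pi *+ 2) p0 => pp p0.
by field.
Qed.

Lemma eta_d e x v : wave_sum [seq wave_d w | w <- eta e] x v =
  \sum_(q <- terms e) coef q *
    cos (pi *+ 2 * ((fs q)%:~R * x 0 0 + (ft q)%:~R * x 0 1) + (ph q + pi / 2)) *
    wedge12 (fs q)%:~R (ft q)%:~R (basis2 (anti q) (ix q)) v.
Proof.
rewrite /eta; elim: (terms e) => [|q s IH]; first by rewrite /wave_sum !big_nil.
by rewrite big_cons -IH -term_waves_d /= /wave_sum !big_cons big_nil addr0 addrA.
Qed.

Lemma rho_eta e x v : wave_sum [seq wave_d w | w <- eta e] x v =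
  rho e (pi *+ 2 * x 0 0) (pi *+ 2 * x 0 1) v.
Proof.
rewrite eta_d; set s := pi *+ 2 * x 0 0; set t := pi *+ 2 * x 0 1.
have cq (m n : int) : cos (pi *+ 2 * (m%:~R * x 0 0 + n%:~R * x 0 1) + (quarter + pi / 2)) =
    cos (m%:~R * s + n%:~R * t).
  by rewrite /quarter addNr addr0 mulrDr !(mulrCA (pi *+ 2)).
have c0 (m n : int) : cos (pi *+ 2 * (m%:~R * x 0 0 + n%:~R * x 0 1) + (0 + pi / 2)) =
    - sin (m%:~R * s + n%:~R * t).
  rewrite add0r mulrDr !(mulrCA (pi *+ 2)) -/s -/t cosD cos_pihalf sin_pihalf.
  by rewrite mulr0 sub0r mulr1.
have i1 : (1 : int)%:~R = 1 :> R by [].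
have iN : (- 1 : int)%:~R = - 1 :> R by [].
have i0 : (0 : int)%:~R = 0 :> R by [].
have i2 : (2 : int)%:~R = 2 :> R by [].
rewrite /terms !big_cons big_nil /= !cq !c0 i1 iN i0 i2.
have c2t : cos (2 * t) = 2 * cos t ^+ 2 - 1.
  rewrite (_ : 2 * t = t + t); last by ring.
  by rewrite cosD -!expr2 sin2cos2; ring.
have s2t : sin (2 * t) = 2 * sin t * cos t.
  by rewrite (_ : 2 * t = t + t); [rewrite sinD; ring|ring].
rewrite !(mul0r, add0r, addr0, mul1r, mulN1r) !(cosD, sinD, cosN, sinN) c2t s2t.
rewrite /rho /pencil /wedge12 /basis2 /form2 !mxE /=.
move: (cos s) (sin s) (cos t) (sin t) => cs ss ct st.
by field.
Qed.

Lemma rho_P2 s : (P_ s) 0 2 = 0. Proof. by rewrite mxE. Qed.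

Lemma rho_timelike e s t : e ^+ 2 <= 1 -> dot (K_ e s t) (K_ e s t) < dot (P_ s) (P_ s).
Proof.
move=> e1; rewrite !dot3 !mxE /=.
have hs := cos2Dsin2 s; have ht := cos2Dsin2 t.
move: (cos s) (sin s) (cos t) (sin t) hs ht => cs ss ct st hs ht.
have h1 : (ss * st * (ct - 1)) ^+ 2 <= 4.
  have -> : (ss * st * (ct - 1)) ^+ 2 = ss ^+ 2 * (st ^+ 2 * (ct - 1) ^+ 2) by ring.
  have a1 : 0 <= ss ^+ 2 <= 1 by nra.
  have a2 : 0 <= st ^+ 2 <= 1 by nra.
  have a3 : 0 <= (ct - 1) ^+ 2 <= 4 by nra.
  have a4 : 0 <= st ^+ 2 * (ct - 1) ^+ 2 <= 4 by nra.
  by nra.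
have h2 : (cs * st) ^+ 2 <= 1.
  have -> : (cs * st) ^+ 2 = cs ^+ 2 * st ^+ 2 by ring.
  have a1 : 0 <= cs ^+ 2 <= 1 by nra.
  have a2 : 0 <= st ^+ 2 <= 1 by nra.
  by nra.
have -> : e * (ss * st * (ct - 1)) * (e * (ss * st * (ct - 1))) + 0 * 0 + e * (cs * st) * (e * (cs * st)) =
  e ^+ 2 * ((ss * st * (ct - 1)) ^+ 2 + (cs * st) ^+ 2) by ring.
have -> : 3 * cs * (3 * cs) + 3 * ss * (3 * ss) + 0 * 0 = 9 * (cs ^+ 2 + ss ^+ 2) by ring.
rewrite hs; have := sqr_ge0 (ss * st * (ct - 1)); have := sqr_ge0 (cs * st); have := sqr_ge0 e.
by nra.
Qed.

Lemma f_neq0 e s t : e = 0 \/ e = 1 -> f_ e s t != 0.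
Proof.
move=> he; apply/eqP => /rowP h; have := h 0; have := h 1; have := h 2; rewrite !mxE /=.
have hs := cos2Dsin2 s; have ht := cos2Dsin2 t.
move: (cos s) (sin s) (cos t) (sin t) hs ht => cs ss ct st hs ht e2 e1 e0; subst st.
have {}ht : ct ^+ 2 = 1 by move: ht; rewrite expr0n addr0.
have hc : ct = 1 \/ ct = - 1 by move: ht => /eqP; rewrite sqrf_eq1 => /orP[/eqP|/eqP]; auto.
case: he => E; subst e; first by case: hc => E; subst ct; move: e0; lra.
have {}e2 : ss = 0 by case: hc => E; subst ct; move: e2; lra.
subst ss; have {}hs : cs ^+ 2 = 1 by move: hs; rewrite expr0n addr0.
have hcs : cs = 1 \/ cs = - 1 by move: hs => /eqP; rewrite sqrf_eq1 => /orP[/eqP|/eqP]; auto.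
by case: hc => E; case: hcs => E'; subst ct cs; move: e0; rewrite ?expr1n ?sqrrN ?expr1n; lra.
Qed.
End Explicit.

(** * Fields of involutions up to isomorphism *)

Lemma periodic_int (R : realType) (X : Type) (f : R -> X) :
  (forall u, f (u + 1) = f u) -> forall (z : int) u, f (u + z%:~R) = f u.
Proof.
move=> f1; have fn (n : nat) u : f (u + n%:R) = f u.
  elim: n u => [|n IH] u; first by rewrite addr0.
  by rewrite -[n.+1]addn1 natrD addrA f1.
case=> n u; first by rewrite -pmulrn.
by rewrite NegzE mulrNz -pmulrn -[LHS](fn n.+1) subrK.
Qed.

Section TorusIso.
Variable R : realType.
Implicit Types J : R * R -> 'M[R]_6.

Definition periodic2 (X : Type) (f : R * R -> X) : Prop :=
  forall u v, f (u + 1, v) = f (u, v) /\ f (u, v + 1) = f (u, v).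

(** Conjugation by a continuous periodic family, that is, an isomorphism of the bundles of eigenspaces
over the torus. *)
Definition torus_iso J J' : Prop := exists T : R * R -> 'M[R]_6,
  [/\ mcontinuous T, forall x, T x \in unitmx, periodic2 T &
      forall x, J x *m T x = T x *m J' x].

Lemma torus_iso_sym J J' : torus_iso J J' -> torus_iso J' J.
Proof.
move=> [T [cT uT pT hT]]; exists (fun x => invmx (T x)); split=> [x|x|u v|x].
- exact: (mcvgV (cT x) (uT x)).
- by rewrite unitmx_inv.
- by have [-> ->] := pT u v.
- by apply: (can_inj (mulKmx (uT x))); rewrite !mulmxA -hT mulmxK // mulmxV // mul1mx.
Qed.

Lemma torus_iso_trans J1 J2 J3 : torus_iso J1 J2 -> torus_iso J2 J3 -> torus_iso J1 J3.
Proof.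
move=> [S [cS uS pS hS]] [T [cT uT pT hT]]; exists (fun x => S x *m T x); split=> [x|x|u v|x].
- exact: (mcvgM (cS x) (cT x)).
- by rewrite unitmx_mul uS uT.
- by have [-> ->] := pS u v; have [-> ->] := pT u v.
- by rewrite mulmxA hS -mulmxA hT mulmxA.
Qed.

Lemma periodic2_square (X : Type) (f : R * R -> X) : periodic2 f ->
  forall x, exists2 y, (`[0, 1] `*` `[0, 1])%classic y & f x = f y.
Proof.
move=> pf [u v]; exists (u - (Num.floor u)%:~R, v - (Num.floor v)%:~R).
  by split; rewrite /= in_itv /= subr_ge0 Num.Theory.floor_le /= lerBlDl ltW // -intrD1 Num.Theory.floorD1_gt.
have p1 v' (z : int) u' : f (u' + z%:~R, v') = f (u', v').
  by apply: (@periodic_int _ _ (fun t => f (t, v'))) => t; have [] := pf t v'.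
have p2 u' (z : int) v' : f (u', v' + z%:~R) = f (u', v').
  by apply: (@periodic_int _ _ (fun t => f (u', t))) => t; have [] := pf u' t.
transitivity (f (u - (Num.floor u)%:~R, v)).
  by rewrite -[RHS](p1 v (Num.floor u)) subrK.
by rewrite -[RHS](p2 _ (Num.floor v)) subrK.
Qed.

(** Homotopies are parametrised by [0, 1] only; this extends them to all times. *)
Definition clamp (t : R) : R := Num.max 0 (Num.min t 1).

Lemma clamp_itv t : clamp t \in `[0, 1].
Proof. by rewrite in_itv /= /clamp le_max lexx /= ge_max ler01 ge_min lexx orbT. Qed.

Lemma clamp_id t : t \in `[0, 1] -> clamp t = t.
Proof. by rewrite in_itv /= /clamp => /andP[t0 t1]; rewrite min_l // max_r. Qed.

Lemma clamp_continuous : continuous clamp.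
Proof.
move=> t; apply: (@continuous_max _ _ (cst 0) (fun t : R => Num.min t 1) t).
  exact: cst_continuous.
by apply: (@continuous_min _ _ id (cst 1) t); [exact: cvg_id|exact: cst_continuous].
Qed.

(** The para-complex structures of a path of forms are a path of fields of involutions. *)
Theorem path_torus_iso (w : R -> R * R -> multivec R 6 3) :
  (forall (t : R) x, t \in `[0, 1] -> alternating_form (w t x)) ->
  (forall (t : R) x, t \in `[0, 1] -> exists A, SL3_frame (w t x) A) ->
  (forall t : R, t \in `[0, 1] -> periodic2 (w t)) ->
  (forall v (t : R) (x : R * R), t \in `[0, 1] ->
     (fun z => w z.1 z.2 v) @ within (fun z : R * (R * R) => z.1 \in `[0, 1]) (nbhs (t, x)) --> w t x v) ->
  torus_iso (fun x => para_complex (w 0 x)) (fun x => para_complex (w 1 x)).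
Proof.
move=> aw fw pw cw; pose w' t := w (clamp t).
have e0 : clamp 0 = 0 by rewrite clamp_id // in_itv /= lexx ler01.
have e1 : clamp 1 = 1 by rewrite clamp_id // in_itv /= lexx ler01.
pose J t x := para_complex (w' t x).
have [t x|[t x]||T [cT uT hT eT]] := @involution_transport R _ 6 J (`[0, 1] `*` `[0, 1])%classic.
- by have [A fA] := fw _ x (clamp_itv t); exact: para_complex_sqr fA.
- have [A fA] := fw _ x (clamp_itv t).
  apply: (@para_complex_cvg _ _ _ _ (fun z => w' z.1 z.2) _ A) fA => [z|v].
    by apply: aw; exact: clamp_itv.
  have h : (fun z : R * (R * R) => (clamp z.1, z.2)) @ (t, x) -->
      within (fun z : R * (R * R) => z.1 \in `[0, 1]) (nbhs (clamp t, x)).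
    have h1 : (fun z : R * (R * R) => (clamp z.1, z.2)) @ (t, x) --> (clamp t, x).
      apply: cvg_to_pair; last exact: cvg_snd.
      by apply: (cvg_comp (fun z : R * (R * R) => z.1) clamp); [exact: cvg_fst|exact: clamp_continuous].
    move=> B wB.
    have h2 : nbhs (t, x) [set z : R * (R * R) | clamp z.1 \in `[0, 1] -> B (clamp z.1, z.2)] := h1 _ wB.
    change (nbhs (t, x) [set z : R * (R * R) | B (clamp z.1, z.2)]).
    by apply: filterS h2 => z; apply; exact: clamp_itv.
  exact: (cvg_comp _ _ h (cw v _ x (clamp_itv t))).
- by apply: compact_setX; exact: segment_compact.
exists T; split => // [x|u v|x].
- have [|y yK ->] := @periodic2_square _ T _ x; last exact: uT.
  by move=> u v; have p t := pw _ (clamp_itv t) u v;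
    split; apply: eT => t; rewrite /J /w'; have [pu pv] := p t; rewrite ?pu ?pv.
- by have p t := pw _ (clamp_itv t) u v;
    split; apply: eT => t; rewrite /J /w'; have [pu pv] := p t; rewrite ?pu ?pv.
- by have := hT x; rewrite /J /w' e0 e1.
Qed.
End TorusIso.

(** * Restriction to coordinate tori *)

Lemma SL3_frame_alternating (R : realType) (w : multivec R 6 3) A :
  SL3_frame w A -> alternating_form w.
Proof.
by move=> [_ hA]; rewrite (_ : w = pullback A (@rho_plus R)); [exact/alternating_pullback/alternating_rho_plus|exact/funext].
Qed.

Section PencilCvg.
Context {T : Type} {F : set_system T} {FF : Filter F} {R : realType}.

Lemma form2_cvg (P N : T -> 'rV[R]_3) P0 N0 u v : mcvg F P P0 -> mcvg F N N0 ->
  (fun z => form2 (P z) (N z) u v) @ F --> form2 P0 N0 u v.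
Proof.
move=> cP cN; rewrite /form2.
have cD i (c : R) : (fun z => (P z 0 i + N z 0 i) * c) @ F --> (P0 0 i + N0 0 i) * c.
  by apply: cvgM; [exact: (cvgD (cP 0 i) (cN 0 i))|exact: cvg_cst].
have cB i (c : R) : (fun z => (P z 0 i - N z 0 i) * c) @ F --> (P0 0 i - N0 0 i) * c.
  by apply: cvgM; [exact: (cvgB (cP 0 i) (cN 0 i))|exact: cvg_cst].
exact: (cvgD (cvgD (cvgB (cvgD (cvgD (cD _ _) (cB _ _)) (cD _ _)) (cB _ _)) (cD _ _)) (cB _ _)).
Qed.

Lemma pencil_cvg (P K f : T -> 'rV[R]_3) P0 K0 f0 v :
  mcvg F P P0 -> mcvg F K K0 -> mcvg F f f0 ->
  (fun z => pencil (P z) (K z) (f z) v) @ F --> pencil P0 K0 f0 v.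
Proof.
move=> cP cK cf; rewrite /pencil.
have c1 (c : R) a b : (fun z => c * form2 (P z) (K z) a b) @ F --> c * form2 P0 K0 a b.
  by apply: cvgM; [exact: cvg_cst|exact: form2_cvg].
have c2 (c : R) a b : (fun z => c * form2 0 (f z) a b) @ F --> c * form2 0 f0 a b.
  by apply: cvgM; [exact: cvg_cst|apply: form2_cvg => //; exact: mcvg_cst].
exact: (cvgD (cvgD (cvgB (c1 _ _ _) (c1 _ _ _)) (c1 _ _ _)) (cvgD (cvgB (c2 _ _ _) (c2 _ _ _)) (c2 _ _ _))).
Qed.

Lemma mcvg_row3 (a b c : T -> R) a0 b0 c0 :
  a @ F --> (a0 : R) -> b @ F --> (b0 : R) -> c @ F --> (c0 : R) ->
  mcvg F (fun z => row3 (a z) (b z) (c z)) (row3 a0 b0 c0).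
Proof.
move=> ca cb cc i j; rewrite mxE; under eq_fun do rewrite mxE.
by case: ifP => // _; case: ifP.
Qed.

Context {s t : T -> R} {s0 t0 : R} (cs : s @ F --> s0) (ct : t @ F --> t0).

Let ccs : (fun z => cos (s z)) @ F --> cos s0. Proof. by apply: cvg_comp cs _; exact: continuous_cos. Qed.
Let css : (fun z => sin (s z)) @ F --> sin s0. Proof. by apply: cvg_comp cs _; exact: continuous_sin. Qed.
Let cct : (fun z => cos (t z)) @ F --> cos t0. Proof. by apply: cvg_comp ct _; exact: continuous_cos. Qed.
Let cst : (fun z => sin (t z)) @ F --> sin t0. Proof. by apply: cvg_comp ct _; exact: continuous_sin. Qed.

Lemma P_cvg : mcvg F (fun z => P_ (s z)) (P_ s0).
Proof.
by apply: mcvg_row3; [exact: (cvgM (cvg_cst _) ccs)|exact: (cvgM (cvg_cst _) css)|exact: cvg_cst].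
Qed.

Lemma K_cvg e : mcvg F (fun z => K_ e (s z) (t z)) (K_ e s0 t0).
Proof.
apply: mcvg_row3; last first; [|exact: cvg_cst|].
- exact: (cvgM (cvg_cst _) (cvgM ccs cst)).
- exact: (cvgM (cvg_cst _) (cvgM (cvgM css cst) (cvgB cct (cvg_cst _)))).
Qed.

Lemma f_cvg e : mcvg F (fun z => f_ e (s z) (t z)) (f_ e s0 t0).
Proof.
apply: mcvg_row3; [|exact: cst|exact: (cvgM (cvg_cst _) (cvgM css cct))].
have c2 : (fun z => 2 * cos (t z) ^+ 2 - 1) @ F --> 2 * cos t0 ^+ 2 - 1.
  by apply: cvgB; [exact: (cvgM (cvg_cst _) (cvgM cct cct))|exact: cvg_cst].
exact: (cvgD cct (cvgM (cvg_cst _) (cvgD (cvgM c2 (cvgB (cvg_cst _) ccs)) (cvgM ccs cct)))).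
Qed.

End PencilCvg.

Section Model.
Variable R : realType.
Implicit Types (e s t : R) (M A : 'M[R]_6) (x : R * R).

Lemma rho_frame e s t : e = 0 \/ e = 1 -> exists A, SL3_frame (rho e s t) A.
Proof.
move=> he; have e1 : e ^+ 2 <= 1 by case: he => ->; rewrite ?expr1n ?expr0n //= ler01.
by have [A fA _] := pencil_frame (rho_timelike s t e1) (f_neq0 s t he); exists A.
Qed.

Definition model e M : dform R 6 3 := fun x : 'rV[R]_6 =>
  pullback M (rho e (pi *+ 2 * (x *m M) 0 0) (pi *+ 2 * (x *m M) 0 1)).

Definition plane (k l : 'I_6) (x : R * R) : 'rV[R]_6 := x.1 *: delta_mx 0 k + x.2 *: delta_mx 0 l.

Lemma planeM k l x M j : (plane k l x *m M) 0 j = x.1 * M k j + x.2 * M l j.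
Proof.
by rewrite /plane mulmxDl -!scalemxAl -!rowE !mxE.
Qed.

Definition angle (a b : R) (x : R * R) : R := pi *+ 2 * (x.1 * a + x.2 * b).

Lemma angle_cvg a b x : angle a b z @[z --> x] --> angle a b x.
Proof.
have c1 : (fun z : R * R => z.1) @ x --> x.1 by exact: cvg_fst.
have c2 : (fun z : R * R => z.2) @ x --> x.2 by exact: cvg_snd.
exact: (cvgM (cvg_cst _) (cvgD (cvgM c1 (cvg_cst a)) (cvgM c2 (cvg_cst b)))).
Qed.

Lemma modelE e M k l x : model e M (plane k l x) =
  pullback M (rho e (angle (M k 0) (M l 0) x) (angle (M k 1) (M l 1) x)).
Proof. by rewrite /model !planeM. Qed.

Definition model_field e M k l (x : R * R) := para_complex (model e M (plane k l x)).

Lemma angle_cos (a b : bool) u v :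
  [/\ cos (angle a%:R b%:R (u + 1, v)) = cos (angle a%:R b%:R (u, v)),
      sin (angle a%:R b%:R (u + 1, v)) = sin (angle a%:R b%:R (u, v)),
      cos (angle a%:R b%:R (u, v + 1)) = cos (angle a%:R b%:R (u, v)) &
      sin (angle a%:R b%:R (u, v + 1)) = sin (angle a%:R b%:R (u, v))].
Proof.
have h (c : bool) (y : R) : cos (y + pi *+ 2 * c%:R) = cos y /\ sin (y + pi *+ 2 * c%:R) = sin y.
  case: c; rewrite ?mulr1 ?mulr0 ?addr0 //.
  by rewrite cosD2pi sinD2pi.
have e1 : angle a%:R b%:R (u + 1, v) = angle a%:R b%:R (u, v) + pi *+ 2 * a%:R by rewrite /angle /=; ring.
have e2 : angle a%:R b%:R (u, v + 1) = angle a%:R b%:R (u, v) + pi *+ 2 * b%:R by rewrite /angle /=; ring.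
by rewrite e1 e2; have [-> ->] := h a (angle a%:R b%:R (u, v));
  have [-> ->] := h b (angle a%:R b%:R (u, v)).
Qed.

Lemma angle_degenerate (a b a' b' : bool) x : a && b' = a' && b ->
  [\/ cos (angle a%:R a'%:R x) = 1, cos (angle b%:R b'%:R x) = 1 |
      angle a%:R a'%:R x = angle b%:R b'%:R x].
Proof.
have c0 : cos (angle 0 0 x) = 1 by rewrite /angle !mulr0 addr0 mulr0 cos0.
by case: a; case: b; case: a'; case: b' => // _; rewrite ?c0;
  first [exact: Or31 | exact: Or32 | exact: Or33].
Qed.

(** The image of a plane with a singular 0/1 matrix lies in one of the lines s = 0, t = 0 and s = t. *)
Lemma f_off_axis e (a b a' b' : bool) x : (e = 0) \/ (e = 1 /\ a && b' = a' && b) ->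
  let f := f_ e (angle a%:R a'%:R x) (angle b%:R b'%:R x) in f 0 0 != 0 \/ f 0 1 != 0.
Proof.
set s := angle _ _ _; set t := angle _ _ _ => he /=.
have [t0|] := eqVneq (sin t) 0; last by right; rewrite mxE.
left; rewrite mxE /=; have ht := cos2Dsin2 t.
have {}ht : cos t ^+ 2 = 1 by move: ht; rewrite t0 expr0n addr0.
have hc : cos t = 1 \/ cos t = - 1 by move: ht => /eqP; rewrite sqrf_eq1 => /orP[/eqP|/eqP]; auto.
case: he => [->|[-> ab]]; first by case: hc => ->; apply/eqP; lra.
have [s0|T0|st] : [\/ cos s = 1, cos t = 1 | s = t].
  exact: angle_degenerate.
- by rewrite s0; case: hc => ->; apply/eqP; lra.
- by rewrite T0; apply/eqP; lra.
- by rewrite st; case: hc => ->; apply/eqP; lra.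
Qed.

(** The vectors P, K and f can be moved along segments to constant vectors: P and f do not pass through 0
because f avoids the third axis, where its segment ends, and P is
orthogonal to the end of its own; K shrinks to 0 at least as fast as P. *)
Lemma trivial_plane e M k l (a b a' b' : bool) :
  (e = 0) \/ (e = 1 /\ a && b' = a' && b) -> 0 < \det M ->
  M k 0 = a%:R -> M l 0 = a'%:R -> M k 1 = b%:R -> M l 1 = b'%:R ->
  exists2 A, A \in unitmx & torus_iso (model_field e M k l) (fun=> A *m I0 R *m invmx A).
Proof.
move=> he dM Ma Ma' Mb Mb'.
pose s := angle a%:R a'%:R; pose t := angle b%:R b'%:R.
have e1 : e ^+ 2 <= 1 by case: he => [->|[-> _]]; rewrite ?expr1n ?expr0n //= ler01.
pose q (c : R) x := pencil ((1 - c) *: P_ (s x) + c *: row3 0 0 3) ((1 - c) *: K_ e (s x) (t x))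
  ((1 - c) *: f_ e (s x) (t x) + c *: row3 0 0 1).
have fq (c : R) x : c \in `[0, 1] -> exists A, SL3_frame (q c x) A.
  rewrite in_itv /= => /andP[c0 c1].
  have [||A fA _] := @pencil_frame R ((1 - c) *: P_ (s x) + c *: row3 0 0 3) ((1 - c) *: K_ e (s x) (t x))
    ((1 - c) *: f_ e (s x) (t x) + c *: row3 0 0 1) ; [| |by exists A].
  - rewrite dot_sqD !dotZl !dotZr; have := rho_timelike (s x) (t x) e1.
    have -> : dot (P_ (s x)) (row3 0 0 3) = 0 by rewrite dot3 !mxE /=; ring.
    have -> : dot (row3 0 0 3 : 'rV[R]_3) (row3 0 0 3) = 9 by rewrite dot3 !mxE /=; ring.
    have := dot_ge0 (K_ e (s x) (t x)).
    move: (dot (K_ e _ _) _) (dot (P_ _) _) => k2 p2 k0 kp.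
    have [->|cn1] := eqVneq c 1; first by rewrite subrr !mul0r mulr0; lra.
    have {}c1 : 0 < 1 - c by rewrite subr_gt0 lt_neqAle cn1.
    have : 0 < (1 - c) * ((1 - c) * (p2 - k2)) by rewrite !mulr_gt0 // subr_gt0.
    have : 0 <= c * (c * 9) by rewrite !mulr_ge0.
    by move=> h1 h2; lra.
  - apply/eqP => /rowP h; have := h 0; have := h 1; have := h 2; rewrite !mxE /=.
    rewrite !mulr0 !addr0 => h2 h1 h0.
    have [c1'|cn1] := eqVneq c 1; first by move: h2; rewrite c1' subrr mul0r; lra.
    have {}cn1 : 1 - c != 0 by rewrite subr_eq0 eq_sym.
    have := @f_off_axis e a b a' b' x he; rewrite /= -/s -/t !mxE /=.
    by case => /negP; apply; rewrite -(inj_eq (mulfI cn1)) mulr0 ?h0 ?h1.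
have [A0 fA0] : exists A, SL3_frame (pencil (row3 0 0 3) 0 (row3 0 0 1 : 'rV[R]_3)) A.
  have i1 : (1 : R) \in `[0, 1] by rewrite in_itv /= ler01 lexx.
  have [A fA] := fq 1 (0, 0) i1.
  exists A; move: fA; rewrite /q subrr !scale0r !scale1r !add0r; done.
have fA := SL3_frame_pullback dM fA0.
exists (M *m A0); first by rewrite unitmxE unitfE gt_eqF //; case: fA.
have q0 x : pullback M (q 0 x) = model e M (plane k l x).
  by rewrite modelE Ma Ma' Mb Mb' /q subr0 !scale0r !scale1r !addr0.
have q1 x : pullback M (q 1 x) = pullback M (pencil (row3 0 0 3) 0 (row3 0 0 1)).
  by rewrite /q subrr !scale0r !scale1r !add0r.
have : torus_iso (fun x => para_complex (pullback M (q 0 x))) (fun x => para_complex (pullback M (q 1 x))).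
  apply: (@path_torus_iso R (fun c x => pullback M (q c x))) => [c x c01|c x c01|c _ u v|v c x _].
  - by have [A hA] := fq c x c01; apply: alternating_pullback; exact: SL3_frame_alternating hA.
  - by have [A hA] := fq c x c01; exists (M *m A); exact: SL3_frame_pullback.
  - have [h1 h2 h3 h4] := angle_cos a a' u v; have [h5 h6 h7 h8] := angle_cos b b' u v.
    by split; rewrite /q /P_ /K_ /f_ /s /t ?h1 ?h2 ?h3 ?h4 ?h5 ?h6 ?h7 ?h8.
  - apply: cvg_within_filter; rewrite /pullback /q.
    have c1 : (fun z : R * (R * R) => z.1) @ (c, x) --> c by exact: cvg_fst.
    have c2 : (fun z : R * (R * R) => z.2) @ (c, x) --> x by exact: cvg_snd.
    have c1' : (fun z : R * (R * R) => 1 - z.1) @ (c, x) --> 1 - c by exact: (cvgB (cvg_cst _) c1).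
    have cs : (fun z : R * (R * R) => s z.2) @ (c, x) --> s x.
      by apply: cvg_comp c2 _; exact: angle_cvg.
    have ct : (fun z : R * (R * R) => t z.2) @ (c, x) --> t x.
      by apply: cvg_comp c2 _; exact: angle_cvg.
    apply: pencil_cvg.
    - by apply: mcvgD; apply: mcvgZ => //; [exact: P_cvg|exact: mcvg_cst].
    - by apply: mcvgZ => //; exact: K_cvg.
    - by apply: mcvgD; apply: mcvgZ => //; [exact: f_cvg|exact: mcvg_cst].
rewrite /model_field; under eq_fun do rewrite q0.
by under [X in torus_iso _ X]eq_fun do rewrite q1 (para_complexE fA).
Qed.
End Model.

(** * The nontrivial restrictions *)

Section Nontrivial.
Variable R : realType.
Implicit Types (e s t c f : R) (M A : 'M[R]_6) (x : R * R).

Definition reflection : 'M[R]_6 := diag_mx (\row_j nth 0 [:: 1; 1; - 1; - 1; 1; 1] j).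

Lemma mul_reflection m (v : 'M[R]_(m, 6)) i j :
  (v *m reflection) i j = v i j * nth 0 [:: 1; 1; - 1; - 1; 1; 1] j.
Proof. by rewrite mul_mx_diag !mxE. Qed.

Lemma reflection_sqr : reflection *m reflection = 1%:M.
Proof.
apply/matrixP => i j; rewrite mul_reflection !mxE.
by case: (eqVneq i j) => [->|_]; rewrite ?mulr0n ?mul0r // !mulr1n;
  elim/ord6P: j => /=; rewrite ?mulr1 ?mulrNN ?mulr1.
Qed.

Lemma det_reflection : \det reflection = 1.
Proof.
rewrite det_diag !big_ord_recl big_ord0 !mxE /=; ring.
Qed.

(** All functions of (s, t) in the coefficients are even or odd, and the reflection changes the signs of
the basic 2-forms with the odd ones. *)
Lemma rho_opp e s t : rho e (- s) (- t) = pullback reflection (rho e s t).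
Proof.
apply/funext => v; rewrite /pullback /rho /pencil /form2 /pl !(mul_reflection, mxE) /=.
by rewrite !(cosN, sinN); ring.
Qed.

(** The frame of (3c ds + f dt) /\ e12 + (3c ds - f dt) /\ e34, which has positive determinant when
c f < 0. *)
Definition half_mx c f : 'M[R]_(3 + 3) := \matrix_(i, j)
  nth 0 (nth [::] [:: [:: 3 * c; 0; 0; 3 * c; 0; 0]; [:: f; 0; 0; - f; 0; 0];
    [:: 0; 1; 0; 0; 0; 0]; [:: 0; 0; 1; 0; 0; 0];
    [:: 0; 0; 0; 0; 1; 0]; [:: 0; 0; 0; 0; 0; 1]] i) j.

(** The involution whose 1-eigenspace is the kernel of the last three columns of [half_mx]. *)
Definition half_J c f : 'M[R]_6 := \matrix_(i, j)
  nth 0 (nth [::] [:: [:: 0; 3 * c / f; 0; 0; 0; 0]; [:: f / (3 * c); 0; 0; 0; 0; 0];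
    [:: 0; 0; 1; 0; 0; 0]; [:: 0; 0; 0; 1; 0; 0];
    [:: 0; 0; 0; 0; - 1; 0]; [:: 0; 0; 0; 0; 0; - 1]] i) j.

Lemma half_pencil c f : pullback (half_mx c f) (@rho_plus R) =1 pencil (row3 (3 * c) 0 0) 0 (row3 f 0 0).
Proof.
move=> v; rewrite /pullback rho_plusE !det_mx3.
have e i (j : 'I_6) : (v *m half_mx c f) i j = \sum_k v i k * half_mx c f k j by rewrite mxE.
have l0 i : lsubmx (v *m half_mx c f) i 0 = v i 0 * (3 * c) + v i 1 * f.
  by rewrite mxE e sum6 !mxE /=; ring.
have l1 i : lsubmx (v *m half_mx c f) i 1 = v i 2.
  by rewrite mxE e sum6 !mxE /=; ring.
have l2 i : lsubmx (v *m half_mx c f) i 2 = v i 3.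
  by rewrite mxE e sum6 !mxE /=; ring.
have r0 i : rsubmx (v *m half_mx c f) i 0 = v i 0 * (3 * c) - v i 1 * f.
  by rewrite mxE e sum6 !mxE /=; ring.
have r1 i : rsubmx (v *m half_mx c f) i 1 = v i 4.
  by rewrite mxE e sum6 !mxE /=; ring.
have r2 i : rsubmx (v *m half_mx c f) i 2 = v i 5.
  by rewrite mxE e sum6 !mxE /=; ring.
by rewrite !(l0, l1, l2, r0, r1, r2) /pencil /form2 /pl !mxE /=; ring.
Qed.

Lemma det_half_mx c f : c != 0 -> \det (half_mx c f) = - 6 * (c * f).
Proof.
move=> c0; pose D a : 'M[R]_3 := mx3 a 0 0 0 1 0 0 0 1; pose E a : 'M[R]_3 := mx3 a 0 0 0 0 0 0 0 0.
have dD a : \det (D a) = a by rewrite det_mx3 !mxE /=; ring.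
pose N : 'M[R]_(3 + 3) := block_mx (D (3 * c)) (E (3 * c)) (E f) (D (- f)).
have -> : half_mx c f = row_perm (tperm (1%R : 'I_6) 2%R * tperm (2%R : 'I_6) 3%R)%g N.
  have -> : N = \matrix_(i, j) nth 0 (nth [::] [:: [:: 3 * c; 0; 0; 3 * c; 0; 0];
      [:: 0; 1; 0; 0; 0; 0]; [:: 0; 0; 1; 0; 0; 0];
      [:: f; 0; 0; - f; 0; 0]; [:: 0; 0; 0; 0; 1; 0]; [:: 0; 0; 0; 0; 0; 1]] i) j.
    apply/matrixP => i j; rewrite [RHS]mxE /N.
    by case: (fintype.split_ordP i) => i' ->; case: (fintype.split_ordP j) => j' ->;
      rewrite ?block_mxEul ?block_mxEur ?block_mxEdl ?block_mxEdr mxE;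
      case: (ord3P i') => ->; case: (ord3P j') => ->.
  by apply/matrixP; elim/ord6P => j; rewrite [RHS]mxE permM !permE /= ?permE /= !mxE.
rewrite row_permE det_mulmx det_perm odd_permM !odd_tperm /= mul1r.
pose X : 'M[R]_3 := mx3 (f / (3 * c)) 0 0 0 0 0 0 0 0.
have -> : N = block_mx 1%:M 0 X 1%:M *m block_mx (D (3 * c)) (E (3 * c)) 0 (D (- 2 * f)).
  rewrite mulmx_block !(mulmx0, mul0mx, mul1mx, addr0, add0r).
  by congr block_mx; apply/matrixP => i j; rewrite !mxE !sum3 !mxE;
    case: (ord3P i) => ->; case: (ord3P j) => -> /=; field; rewrite ?c0.
by rewrite det_mulmx det_lblock det_ublock !det1 !dD; ring.
Qed.

Lemma I0_diag : I0 R = diag_mx (\row_j nth 0 [:: 1; 1; 1; - 1; - 1; - 1] j).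
Proof.
have -> : (\row_j nth 0 [:: 1; 1; 1; - 1; - 1; - 1] j : 'rV[R]_(3 + 3)) = row_mx (const_mx 1) (const_mx (- 1)).
  by apply/rowP => j; rewrite mxE; case: (fintype.split_ordP j) => k ->;
    rewrite ?row_mxEl ?row_mxEr mxE; case: (ord3P k) => ->.
rewrite (@diag_mx_row _ 3 3) !diag_const_mx raddfN; done.
Qed.

Lemma para_complex_eq (w : multivec R 6 3) A (J : 'M[R]_6) :
  SL3_frame w A -> J *m A = A *m I0 R -> para_complex w = J.
Proof.
move=> fA h; rewrite (para_complexE fA) -h mulmxK // unitmxE unitfE gt_eqF //; by case: fA.
Qed.

Lemma half_J_mx c f : c != 0 -> f != 0 -> half_J c f *m half_mx c f = half_mx c f *m I0 R.
Proof.
move=> c0 f0; apply/matrixP => i j; rewrite I0_diag mul_mx_diag [LHS]mxE sum6 [RHS]mxE.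
by elim/ord6P: i; elim/ord6P: j; rewrite !mxE /=; field; rewrite ?c0 ?f0.
Qed.

(** The sign of c f decides which of the two summands is the first one. *)
Lemma half_para c f : c * f != 0 ->
  para_complex (pencil (row3 (3 * c) 0 0) 0 (row3 f 0 0)) =
  if c * f < 0 then half_J c f else - half_J c f.
Proof.
move=> cf0; have [c0 f0] : c != 0 /\ f != 0 by apply/andP; rewrite -negb_or -mulf_eq0.
have hJ := half_J_mx c0 f0; have dA := det_half_mx f c0.
case: ifPn => cf; [apply: (@para_complex_eq _ (half_mx c f))|apply: (@para_complex_eq _ (half_mx c f *m swap6 R))] => //.
- by split; [rewrite dA; lra|exact: half_pencil].
- have {cf cf0}cf : 0 < c * f by rewrite lt_neqAle eq_sym cf0 leNgt.
  split; first by rewrite det_mulmx dA /swap6 det_antidiag !det1; lra.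
  by move=> v; rewrite -half_pencil -pullback_comp /pullback; exact: rho_plus_swap.
- rewrite mulNmx mulmxA hJ -!mulmxA -mulmxN; congr (_ *m _).
  change (- ((block_mx 1%:M 0 0 (- 1%:M) : 'M[R]_(3 + 3)) *m swap6 R) = swap6 R *m block_mx 1%:M 0 0 (- 1%:M)).
  rewrite /swap6 !mulmx_block !(mulmx0, mul0mx, mulmx1, mul1mx, addr0, add0r, mulmxN, mulNmx).
  by rewrite opp_block_mx opprK !oppr0.
Qed.

Lemma half_value s t : sin s = 0 -> sin t = 0 ->
  rho 1 s t = pencil (row3 (3 * cos s) 0 0) 0 (row3 (cos t + 1 - cos s + cos s * cos t) 0 0).
Proof.
move=> s0 t0; have ht : cos t ^+ 2 = 1 by have := cos2Dsin2 t; rewrite t0 expr0n addr0.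
have hP : P_ s = row3 (3 * cos s) 0 0 by rewrite /P_ s0 mulr0.
have hK : K_ 1 s t = 0 by apply/rowP => j; rewrite !mxE s0 t0 !mulr0 !mul0r mulr0; case: ifP => //; case: ifP.
have hf : f_ 1 s t = row3 (cos t + 1 - cos s + cos s * cos t) 0 0.
  rewrite /f_ s0 t0 mul0r mulr0 ht; congr row3; ring.
by rewrite /rho hP hK hf.
Qed.

Lemma fixed_origin (v : 'rV[R]_6) : v *m para_complex (rho 1 0 0) = v -> v *m reflection = v.
Proof.
rewrite half_value ?sin0 // cos0 half_para; last by apply/eqP; lra.
rewrite ifN; last by rewrite -leNgt; lra.
move=> /rowP h; have := h 2; have := h 3; rewrite !mulmxN !mxE !sum6 !mxE /= => h3 h2.
by apply/rowP => j; rewrite mul_reflection; elim/ord6P: j; rewrite /= ?mulr1 //; lra.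
Qed.

Lemma moved_half s t : sin s = 0 -> sin t = 0 -> ~ (cos s = 1 /\ cos t = 1) ->
  exists v : 'rV[R]_6, v *m para_complex (rho 1 s t) = v /\ v *m reflection <> v.
Proof.
move=> s0 t0 N; exists (delta_mx 0 2); split; last first.
  by move=> /rowP /(_ 2); rewrite mul_reflection !mxE /=; lra.
have sgn (u : R) : sin u = 0 -> cos u = 1 \/ cos u = - 1.
  move=> u0; have := cos2Dsin2 u; rewrite u0 expr0n addr0 => /eqP.
  by rewrite sqrf_eq1 => /orP[/eqP|/eqP]; auto.
have h : cos s * (cos t + 1 - cos s + cos s * cos t) = - 2.
  by case: (sgn s s0) N => ->; case: (sgn t t0) => -> N; [case: N|ring..].
have h0 : - 2 < 0 :> R by lra.
rewrite half_value // half_para h; last by apply/eqP; lra.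
by rewrite h0; apply/rowP => j; rewrite mxE sum6 !mxE /=; elim/ord6P: j; rewrite /=; ring.
Qed.

Lemma cos_half (n : nat) : cos (pi * n%:R : R) = (-1) ^+ n /\ sin (pi * n%:R : R) = 0.
Proof.
elim: n => [|n [IHc IHs]]; first by rewrite mulr0 cos0 sin0.
by rewrite -[n.+1]addn1 natrD mulrDr mulr1 cosDpi sinDpi IHc IHs oppr0 addn1 exprS mulN1r.
Qed.

Lemma half_angle (m n : nat) : odd m || odd n ->
  exists v : 'rV[R]_6, v *m para_complex (rho 1 (pi * m%:R) (pi * n%:R)) = v /\ v *m reflection <> v.
Proof.
move=> mn; have [cm sm] := cos_half m; have [cn sn] := cos_half n.
apply: moved_half => //; rewrite cm cn -!(signr_odd _ m) -!(signr_odd _ n).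
by move: mn; case: (odd m) => /= [_ [h _]|-> [_ h]]; move: h; rewrite expr1; lra.
Qed.

(** The minor is 1 or -1, so the three nonzero half periods of the plane go to those of (s, t) in some
order.  The reflection fixes the 1-eigenspace at the origin and moves the vector e2 of it at the other
half periods. *)
Theorem nontrivial_plane M A k l (a b a' b' : bool) :
  a && b' (+) a' && b -> 0 < \det M -> A \in unitmx ->
  M k 0 = a%:R -> M l 0 = a'%:R -> M k 1 = b%:R -> M l 1 = b'%:R ->
  ~ torus_iso (model_field 1 M k l) (fun=> A *m I0 R *m invmx A).
Proof.
move=> odd_minor dM uA Ma Ma' Mb Mb' /torus_iso_sym [T [cT uT pT hT]].
have uM : M \in unitmx by rewrite unitmxE unitfE gt_eqF.
pose s x := angle a%:R a'%:R x; pose t x := angle b%:R b'%:R x.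
pose J x := para_complex (rho 1 (s x) (t x)).
have one : (1 : R) = 0 \/ (1 : R) = 1 by right.
have JM x : model_field 1 M k l x *m M = M *m J x.
  have [B fB] := rho_frame (s x) (t x) one.
  by rewrite /model_field modelE Ma Ma' Mb Mb' (para_complex_pullback dM fB) mulmxKV.
have half2 (x y : R) : angle x y (2^-1, 0) = pi * x /\ angle x y (0, 2^-1) = pi * y /\
    angle x y (2^-1, 2^-1) = pi * (x + y).
  by rewrite /angle /=; split; [|split]; field.
apply: (@no_constant_model R J reflection A (fun x => T x *m M) uA) => [x|x|u v|u v|x|||u v|v|||].
- by apply: mcvgM; [exact: cT|exact: mcvg_cst].
- by rewrite unitmx_mul uT.
- by have [-> _] := pT u v.
- by have [_ ->] := pT u v.
- by rewrite mulmxA hT -!mulmxA JM.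
- exact: reflection_sqr.
- exact: tr_diag_mx.
- have sN (x y u' v' : R) : angle x y (- u', - v') = - angle x y (u', v') by rewrite /angle /=; ring.
  have [B fB] := rho_frame (s (u, v)) (t (u, v)) one.
  have iR : invmx reflection = reflection.
    have uR : reflection \in unitmx by case/mulmx1_unit: reflection_sqr.
    by apply: (can_inj (mulKmx uR)); rewrite mulmxV // reflection_sqr.
  rewrite /J /s /t !sN rho_opp (para_complex_pullback _ fB) ?iR //.
  by rewrite det_reflection ltr01.
- have a0 (x y : R) : angle x y (0, 0) = 0 by rewrite /angle /= !mul0r addr0 mulr0.
  by rewrite /J /s /t !a0; exact: fixed_origin.
- rewrite /J /s /t (half2 _ _).1 (half2 _ _).1; apply: (@half_angle a b).
  by clear -odd_minor; move: odd_minor; case: a; case: b => //; rewrite andbF.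
- rewrite /J /s /t (half2 _ _).2.1 (half2 _ _).2.1; apply: (@half_angle a' b').
  by clear -odd_minor; move: odd_minor; case: a'; case: b' => //; rewrite andbF.
- rewrite /J /s /t (half2 _ _).2.2 (half2 _ _).2.2 -!natrD; apply: (@half_angle (a + a') (b + b')).
  by clear -odd_minor; move: odd_minor; case: a; case: b; case: a'; case: b'.
Qed.
End Nontrivial.

(** * Perturbation by a closed form *)

Lemma cube_compact (R : realType) n : compact ([set v | forall i, `[0, 1]%classic (v 0 i)] : set 'rV[R]_n).
Proof. exact: (@rV_compact R n (fun=> `[0, 1]%classic) (fun=> @segment_compact R 0 1)). Qed.

Section Perturb.
Variable R : realType.
Implicit Types (e : R) (M A : 'M[R]_6).

(** Only the first two columns matter for the dependence on the point; their entries are integers, so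
that the pulled back form is periodic. *)
Definition bit_frame (a b : seq bool) M : Prop :=
  0 < \det M /\ forall i : 'I_6, M i 0 = (nth false a i)%:R /\ M i 1 = (nth false b i)%:R.

Lemma wave_sum_pull k M (s : seq (wave R 6 k)) x v :
  wave_sum [seq wave_d q | q <- [seq wave_pull M q | q <- s]] x v =
  wave_sum [seq wave_d q | q <- s] (x *m M) (v *m M).
Proof.
rewrite /wave_sum !big_map; apply: eq_bigr => q _ /=.
by rewrite /pairing mulmxA -mul_mx_row mulmxA.
Qed.

Lemma model_waves e M x v :
  model e M x v = wave_sum [seq wave_d q | q <- [seq wave_pull M q | q <- eta e]] x v.
Proof. by rewrite wave_sum_pull rho_eta. Qed.

Lemma in_map (X Y : Type) (F : X -> Y) (s : seq X) y :
  List.In y [seq F q | q <- s] -> exists q, F q = y /\ List.In q s.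
Proof. by elim: s => //= q s IH [<-|/IH[q' [<- h]]]; [exists q; auto|exists q'; auto]. Qed.

Lemma in_flatten (X Y : Type) (F : X -> seq Y) (s : seq X) y :
  List.In y (flatten [seq F q | q <- s]) -> exists q, List.In y (F q).
Proof.
by elim: s => //= q s IH h; case: (List.in_app_or _ _ _ h) => [h'|/IH //]; exists q.
Qed.

Lemma eta_integral e a b M : bit_frame a b M ->
  forall q, List.In q [seq wave_pull M q | q <- eta e] -> integral_freq q.
Proof.
move=> [_ hM] q hq m; have [w [<- wE]] := in_map hq.
have [p hp] := in_flatten wE.
have -> : freq (wave_pull M w) = M *m term_freq p.
  by case: hp => [<-|[<-|[]]].
rewrite /pairing mulmxA st_colE.
have int_col (f : 'I_6 -> bool) j : (forall i, M i j = (f i)%:R) -> exists z : int, (map_mx intr m *m M) 0 j = z%:~R.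
  move=> hf; exists (\sum_i m 0 i *+ f i).
  rewrite mxE raddf_sum; apply: eq_bigr => i _; rewrite mxE hf.
  by case: (f i); rewrite ?mulr1 ?mulr0.
have [z hz] := int_col (fun i => nth false a i) 0 (fun i => (hM i).1).
have [z' hz'] := int_col (fun i => nth false b i) 1 (fun i => (hM i).2).
exists (fs p * z + ft p * z'); rewrite hz hz' intrD !intrM; ring.
Qed.

Lemma model_torus e a b M : bit_frame a b M -> torus_form (model e M) /\ closed_form (model e M).
Proof.
move=> hM; have E : model e M = wave_sum [seq wave_d q | q <- [seq wave_pull M q | q <- eta e]].
  by apply/funext => x; apply/funext => v; rewrite model_waves.
rewrite E; split; last exact: wave_sum_closed.
apply: torus_wave_sum => q hq m; have [w [<- wE]] := in_map hq.
exact: (eta_integral hM wE m).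
Qed.

Lemma model_exact e a b M : bit_frame a b M ->
  exists2 h : dform R 6 2, torus_form h & forall x v, model e M x v = extd h x v.
Proof.
move=> hM; exists (wave_sum [seq wave_pull M q | q <- eta e]).
  exact: torus_wave_sum (eta_integral hM).
by move=> x v; rewrite model_waves extd_wave_sum.
Qed.

Definition pulled_omega M : 'M[R]_6 := M *m omega_mx R *m M^T.

Lemma model_gram e M x : e = 0 \/ e = 1 -> 0 < \det M ->
  exists2 A, SL3_frame (model e M x) A & gram (para_complex (model e M x)) (pulled_omega M) \in unitmx.
Proof.
move=> he dM; have e1 : e ^+ 2 <= 1 by case: he => ->; rewrite ?expr1n ?expr0n //= ler01.
set s := pi *+ 2 * (x *m M) 0 0; set t := pi *+ 2 * (x *m M) 0 1.
have [A fA uG] := pencil_gram (rho_timelike s t e1) (f_neq0 s t he) (rho_P2 s).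
exists (M *m A); first exact: SL3_frame_pullback.
rewrite /model -/s -/t (para_complex_pullback dM fA).
have uM : M \in unitmx by rewrite unitmxE unitfE gt_eqF.
move: uG; rewrite -/(rho e s t); move: (para_complex _) => J uG.
suff -> : gram (M *m J *m invmx M) (pulled_omega M) = M *m gram J (omega_mx R) *m M^T.
  by rewrite !unitmx_mul unitmx_tr uM uG.
rewrite /gram /pulled_omega mulmxBr mulmxBl !mulmxA mulmxKV // !trmx_mul -!mulmxA.
by rewrite (mulmxA M^T (invmx M)^T) (_ : M^T *m (invmx M)^T = 1%:M) ?mul1mx // -trmx_mul mulVmx ?trmx1.
Qed.

Lemma unit_cube (X : Type) (f : 'rV[R]_6 -> X) :
  (forall x (m : 'rV[int]_6), f (x + map_mx intr m) = f x) ->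
  forall x, exists2 y : 'rV[R]_6, (forall i, y 0 i \in `[0, 1]) & f x = f y.
Proof.
move=> pf x; exists (\row_i (x 0 i - (Num.floor (x 0 i))%:~R)).
  move=> i; rewrite mxE in_itv /= subr_ge0 Num.Theory.floor_le /= lerBlDl ltW // -intrD1.
  exact: Num.Theory.floorD1_gt.
rewrite -[RHS](pf _ (\row_i Num.floor (x 0 i))); congr f.
by apply/rowP => i; rewrite !mxE subrK.
Qed.

Definition perturbed e M (xi : dform R 6 3) (d : R) : dform R 6 3 := lin_form 1 d (model e M) xi.

(** Being in the orbit of rho_plus and having a nondegenerate symmetric form are open conditions, and
the torus is compact. *)
Theorem perturbed_frame e a b M xi : e = 0 \/ e = 1 -> bit_frame a b M -> torus_form xi ->
  exists2 d0 : R, 0 < d0 & forall d, `|d| < d0 -> forall x,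
    (exists A, SL3_frame (perturbed e M xi d x) A) /\
    gram (para_complex (perturbed e M xi d x)) (pulled_omega M) \in unitmx.
Proof.
move=> he hM txi; have [tm _] := model_torus e hM.
have tp d := torus_form_lin 1 d tm txi.
pose good (d : R) (x : 'rV[R]_6) := (exists A, SL3_frame (perturbed e M xi d x) A) /\
    gram (para_complex (perturbed e M xi d x)) (pulled_omega M) \in unitmx.
pose K : set 'rV[R]_6 := [set v | forall i, `[0, 1]%classic (v 0 i)].
have cK : compact K by exact: cube_compact.
have [//|] := ((compact_near_coveringP _).1 cK _ (nbhs (0 : R)) good _).
  move=> x _; have [A fA uG] := model_gram x he hM.1.
  pose F := filter_prod (nbhs x) (nbhs (0 : R)).
  have FF : Filter F by exact: filter_prod_filter.
  pose w (q : 'rV[R]_6 * R) := perturbed e M xi q.2 q.1.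
  have aw q : alternating_form (w q) by have [h _ _] := tp q.2; exact: h.
  have cw v : (fun q => w q v) @ F --> model e M x v.
    have cont (h : dform R 6 3) : torus_form h -> (fun q : 'rV[R]_6 * R => h q.1 v) @ F --> h x v.
      move=> [_ _ /(_ v 0%N) ch].
      have c1 : (fun q : 'rV[R]_6 * R => q.1) @ F --> x by exact: cvg_fst.
      exact: (cvg_comp _ _ c1 (ch x)).
    have c2 : (fun q : 'rV[R]_6 * R => q.2) @ F --> (0 : R) by exact: cvg_snd.
    have -> : model e M x v = 1 * model e M x v + 0 * xi x v by rewrite mul1r mul0r addr0.
    exact: (cvgD (cvgM (cvg_cst _) (cont _ tm)) (cvgM c2 (cont _ txi))).
  have [B _ fB] := SL3_frame_near aw cw fA.
  have cJ := @para_complex_cvg _ F FF R w _ A aw cw fA.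
  have cG : mcvg F (fun q => gram (para_complex (w q)) (pulled_omega M))
      (gram (para_complex (model e M x)) (pulled_omega M)).
    have cW : mcvg F (fun=> pulled_omega M) (pulled_omega M) by exact: mcvg_cst.
    exact: (mcvgD (mcvgM cJ cW) (mcvgN (mcvgM cW (mcvg_tr cJ)))).
  have uw : \forall q \near F, gram (para_complex (w q)) (pulled_omega M) \in unitmx.
    exact: near_unitmx cG uG.
  apply: filterS2 fB uw => q fq uq; split=> //; by exists (B q).
move=> d0 /= d0p hd; exists d0 => // d dd x.
have [|y yK E] := @unit_cube _ (perturbed e M xi d) _ x.
  by move=> z m; apply/funext => v; have [_ pp _] := tp d; exact: pp.
rewrite E; apply: (hd d _ y) => //.
by rewrite /= sub0r normrN.
Qed.

Lemma plane_periodic k l (u v : R) :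
  plane k l (u + 1, v) = plane k l (u, v) + map_mx intr (delta_mx 0 k) /\
  plane k l (u, v + 1) = plane k l (u, v) + map_mx intr (delta_mx 0 l).
Proof.
have e (i : 'I_6) : map_mx intr (delta_mx 0 i : 'rV[int]_6) = delta_mx 0 i :> 'rV[R]_6.
  by apply/rowP => j; rewrite !mxE; case: (_ && _).
by rewrite !e /plane /= !scalerDl !scale1r; split; rewrite ?addrA // addrAC.
Qed.

Lemma torus_form_plane (w : dform R 6 3) k l : torus_form w -> periodic2 (fun x => w (plane k l x)).
Proof.
move=> [_ pw _] u v; have [-> ->] := plane_periodic k l u v.
by split; apply/funext => z; rewrite pw.
Qed.

Lemma plane_continuous k l : continuous (plane (R := R) k l).
Proof.
move=> x; have c1 : (fun z : R * R => z.1) @ x --> x.1 by exact: cvg_fst.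
have c2 : (fun z : R * R => z.2) @ x --> x.2 by exact: cvg_snd.
have h1 : x.1 *: (delta_mx 0 k : 'rV[R]_6) @[x --> x] --> x.1 *: (delta_mx 0 k : 'rV[R]_6) by exact: cvgZr_tmp.
have h2 : x.2 *: (delta_mx 0 l : 'rV[R]_6) @[x --> x] --> x.2 *: (delta_mx 0 l : 'rV[R]_6) by exact: cvgZr_tmp.
exact: (cvgD h1 h2).
Qed.
End Perturb.

(** * Realisation in every cohomology class *)

Section Realize.
Variable R : realType.
Implicit Types (e : R) (M A : 'M[R]_6).

Lemma SL3_frame_scale (w : multivec R 6 3) A (k : R) : 0 < k -> SL3_frame w A ->
  SL3_frame (fun v => k ^+ 3 * w v) (k *: A).
Proof.
move=> k0 [dA hA]; split; first by rewrite detZ mulr_gt0 // exprn_gt0.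
move=> v; rewrite -hA /pullback -scalemxAr !rho_plusE.
have lZ (X : 'M[R]_(3, 3 + 3)) : lsubmx (k *: X) = k *: lsubmx X by apply/matrixP => i j; rewrite !mxE.
have rZ (X : 'M[R]_(3, 3 + 3)) : rsubmx (k *: X) = k *: rsubmx X by apply/matrixP => i j; rewrite !mxE.
by rewrite lZ rZ !detZ mulrDr.
Qed.

Lemma para_complex_scale (w : multivec R 6 3) A (k : R) : 0 < k -> SL3_frame w A ->
  para_complex (fun v => k ^+ 3 * w v) = para_complex w.
Proof.
move=> k0 fA; have uA : A \in unitmx by rewrite unitmxE unitfE gt_eqF //; case: fA.
apply: para_complex_eq (SL3_frame_scale k0 fA) _.
by rewrite (para_complexE fA) -scalemxAr -scalemxAl mulmxKV.
Qed.

Lemma homotopic_torus_iso (w0 w1 : dform R 6 3) k l : homotopic w0 w1 ->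
  torus_iso (fun x => para_complex (w0 (plane k l x))) (fun x => para_complex (w1 (plane k l x))).
Proof.
move=> [H [hH cH <- <-]]; apply: (@path_torus_iso R (fun t x => H t (plane k l x))).
- by move=> t x /hH[[aH _ _] _].
- by move=> t x /hH[_ fH].
- by move=> t /hH[tH _]; exact: torus_form_plane.
move=> v t x t01; have /subspace_continuousP h := cH v.
have {}h := h (t, plane k l x) (conj t01 I).
pose g (z : R * (R * R)) : R * 'rV[R]_6 := (z.1, plane k l z.2).
suff hg : g @ within (fun z : R * (R * R) => z.1 \in `[0, 1]) (nbhs (t, x)) -->
    within (`[0, 1]%classic `*` setT) (nbhs (t, plane k l x)) by exact: (cvg_comp _ _ hg h).
move=> B wB.
have c1 : (fun z : R * (R * R) => (z.1, plane k l z.2)) @ (t, x) --> (t, plane k l x).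
  apply: cvg_to_pair; first exact: cvg_fst.
  have c2 : (fun z : R * (R * R) => z.2) @ (t, x) --> x by exact: cvg_snd.
  exact: (cvg_comp _ _ c2 (plane_continuous (x := x))).
have h2 : nbhs (t, x) [set z : R * (R * R) | (`[0, 1]%classic `*` setT) (z.1, plane k l z.2) ->
  B (z.1, plane k l z.2)] := c1 _ wB.
change (nbhs (t, x) [set z : R * (R * R) | z.1 \in `[0, 1] -> B (g z)]).
by apply: filterS h2 => z Bz z01; apply: Bz.
Qed.

Lemma pulled_omegaE M (a b : 'rV[R]_6) :
  pullback M (@omega_form R) (col_mx a b) = (a *m pulled_omega M *m b^T) 0 0.
Proof.
have ra : row 0 (col_mx a b : 'M[R]_(2, 6)) = a.
  apply/rowP => j; rewrite mxE -[RHS](col_mxEu a b).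
  by congr (col_mx _ _ _ _); apply/val_inj.
have rb : row 1 (col_mx a b : 'M[R]_(2, 6)) = b.
  apply/rowP => j; rewrite mxE -[RHS](col_mxEd a b).
  by congr (col_mx _ _ _ _); apply/val_inj.
rewrite /pullback /omega_form !row_mul ra rb -omega_mxE trmx_mul /pulled_omega !mulmxA.
by [].
Qed.

(** A large multiple k^3 model + xi is k^3 times a small perturbation of the model, and has the class of
xi because the model is exact.  The segment from the model to the perturbation consists of forms with
frames. *)
Theorem realization e a b M (xi : dform R 6 3) :
  e = 0 \/ e = 1 -> bit_frame a b M -> torus_form xi -> closed_form xi ->
  exists w : dform R 6 3, [/\ SL3_form w, closed_form w, extendible w, deRham_class xi w &
    forall k l, torus_iso (model_field e M k l) (fun x => para_complex (w (plane k l x)))].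
Proof.
move=> he hM txi cxi; have [d0 d0p hd] := perturbed_frame he hM txi.
have [tm cm] := model_torus e hM.
(* k >= 1 and k > 1 / d0 imply k^-3 < d0 *)
pose k : R := 1 + d0^-1; have k1 : 1 < k by rewrite ltrDl invr_gt0.
have k0 : 0 < k by apply: lt_trans k1.
have k3 : k ^+ 3 != 0 by rewrite expf_neq0 // gt_eqF.
pose d := (k ^+ 3)^-1; have dp : 0 < d by rewrite invr_gt0 exprn_gt0.
have dd0 : d < d0.
  rewrite /d invf_plt ?posrE ?exprn_gt0 //; apply: lt_le_trans (_ : k <= _).
    by rewrite ltrDr.
  by rewrite -[X in X <= _]expr1 ler_eXn2l // ltW.
have hdd c : c \in `[0, 1] -> `|c * d| < d0.
  rewrite in_itv /= => /andP[c0 c1]; rewrite ger0_norm; last by rewrite mulr_ge0 // ltW.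
  by apply: le_lt_trans dd0; rewrite ler_piMl // ltW.
have one : (1 : R) \in `[0, 1] by rewrite in_itv /= ler01 lexx.
pose w := lin_form (k ^+ 3) 1 (model e M) xi.
have wE x : w x = fun v => k ^+ 3 * perturbed e M xi (1 * d) x v.
  apply/funext => v; rewrite /w /perturbed /lin_form.
  move: (model e M x v) (xi x v) => p q.
  by rewrite /d mul1r mulrDr mul1r mulrA mul1r mulfV // mul1r.
have tw : torus_form w by exact: torus_form_lin.
have cw : closed_form w by move=> x v; rewrite extd_lin // cm cxi !mulr0 addr0.
have fw x : exists2 A, SL3_frame (w x) A & para_complex (w x) = para_complex (perturbed e M xi (1 * d) x).
  have [[A fA] _] := hd _ (hdd _ one) x; exists (k *: A); rewrite wE.
    exact: SL3_frame_scale.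
  exact: para_complex_scale fA.
exists w; split=> //.
- by split=> // x; have [A fA _] := fw x; exists A.
- exists (fun _ => pullback M (@omega_form R)).
    split=> [x|//|v]; last exact: smooth_cst.
    apply: alternating_pullback; exact: omega_form_alternating.
  move=> x; split; last by apply: negative_top_omega; case: hM.
  have [A fA JE] := fw x; have [_ uG] := hd _ (hdd _ one) x.
  apply: (Iform_signature fA (W := pulled_omega M)) => [u v||].
  + exact: pulled_omegaE.
  + by rewrite /pulled_omega !trmx_mul trmxK omega_mx_skew mulNmx mulmxN mulmxA.
  + by rewrite JE.
- split=> //; have [h th hE] := model_exact e hM.
  exists (lin_form (k ^+ 3) 0 h h); first exact: torus_form_lin.
  by move=> x v; rewrite extd_lin // -hE /w /lin_form mul1r addrK mul0r addr0.
- move=> i j.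
  have : torus_iso (fun x => para_complex (perturbed e M xi (0 * d) (plane i j x)))
      (fun x => para_complex (perturbed e M xi (1 * d) (plane i j x))).
    have tp c := torus_form_lin 1 (c * d) tm txi.
    apply: (@path_torus_iso R (fun c x => perturbed e M xi (c * d) (plane i j x))) => [c x _|c x c01|c _|v c x _].
    + by have [h _ _] := tp c; exact: h.
    + by have [] := hd _ (hdd _ c01) (plane i j x).
    + exact: (torus_form_plane i j (tp c)).
    + apply: cvg_within_filter.
      have c1 : (fun z : R * (R * R) => z.1) @ (c, x) --> c by exact: cvg_fst.
      have c2 : (fun z : R * (R * R) => z.2) @ (c, x) --> x by exact: cvg_snd.
      have c3 : (fun z : R * (R * R) => plane i j z.2) @ (c, x) --> plane i j x.
        exact: (cvg_comp _ _ c2 (plane_continuous (x := x))).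
      have cont (h : dform R 6 3) : torus_form h ->
          (fun z : R * (R * R) => h (plane i j z.2) v) @ (c, x) --> h (plane i j x) v.
        by move=> [_ _ /(_ v 0%N) ch]; exact: (cvg_comp _ _ c3 (ch (plane i j x))).
      exact: (cvgD (cvgM (cvg_cst _) (cont _ tm)) (cvgM (cvgM c1 (cvg_cst _)) (cont _ txi))).
  have -> : (fun x => para_complex (perturbed e M xi (0 * d) (plane i j x))) = model_field e M i j.
    apply/funext => x; congr para_complex; apply/funext => v.
    by rewrite /perturbed /lin_form !mul0r mul1r addr0.
  suff -> : (fun x => para_complex (w (plane i j x))) =
      fun x => para_complex (perturbed e M xi (1 * d) (plane i j x)) by [].
  by apply/funext => x; have [_ _ ->] := fw (plane i j x).
Qed.
End Realize.

(** * The 652 classes *)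

(** The minor of the rows k and l, modulo 2. *)
Definition minor (a b : seq bool) (k l : nat) : bool :=
  nth false a k && nth false b l (+) nth false a l && nth false b k.

Lemma bit_frame_exists (R : realType) (a b : seq bool) (k l : 'I_6) :
  minor a b k l -> exists M : 'M[R]_6, bit_frame a b M.
Proof.
move=> kl; pose V : 'M[R]_(2 + 4, 2) := \matrix_(i, j) (nth false (if j == 0 then a else b) i)%:R.
have rV : \rank V = 2%N.
  pose W : 'M[R]_(2, 6) := \matrix_(i, j) (j == if i == 0 then k else l)%:R.
  have WV i j : (W *m V) i j = V (if i == 0 then k else l) j.
    rewrite mxE (bigD1 (if i == 0 then k else l)) //= big1 => [|m mN].
      by rewrite mxE eqxx mul1r addr0.
    by rewrite mxE (negPf mN) mul0r.
  have : W *m V \in unitmx.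
    rewrite unitmxE unitfE det_mx2 !WV !mxE /= subr_eq0.
    move: kl; rewrite /minor; move: (nth _ a k) (nth _ a l) (nth _ b k) (nth _ b l).
    by case; case; case; case => //= _; rewrite ?mulr1 ?mulr0 ?mul0r ?oner_eq0 // eq_sym oner_eq0.
  rewrite -row_free_unit -row_leq_rank => h; apply/eqP; rewrite eqn_leq rank_leq_col.
  exact: leq_trans h (mxrankM_maxr _ _).
pose c := \det (col_ebase V) * \det (row_ebase V).
have c0 : c != 0.
  rewrite mulf_neq0 //.
    by have := col_ebase_unit V; rewrite unitmxE unitfE.
  by have := row_ebase_unit V; rewrite unitmxE unitfE.
(* corrects the sign of the determinant *)
pose D : 'M[R]_(1 + 3) := block_mx (Num.sg c)%:M 0 0 1%:M.
pose M : 'M[R]_(2 + 4) := col_ebase V *m block_mx (row_ebase V) 0 0 D.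
have lM : lsubmx M = V.
  rewrite /M block_mxEh mul_mx_row row_mxKl -[RHS](mulmx_ebase V) rV pid_mx_col -mulmxA.
  by rewrite mul_col_mx mul1mx mul0mx.
have dD : \det D = Num.sg c by rewrite det_ublock det_scalar1 det1 mulr1.
have dM : 0 < \det M.
  by rewrite /M det_mulmx det_ublock mulrA -/c dD mulrC -normrEsg normr_gt0.
exists M; split=> //.
move=> i; have e (j : 'I_2) : M i (lshift 4 j) = (nth false (if j == 0 then a else b) i)%:R.
  have -> : M i (lshift 4 j) = lsubmx M i j by rewrite [RHS]mxE.
  by rewrite lM mxE.
by rewrite -(e 0) -(e 1); split; congr (M i _); apply/val_inj.
Qed.

Section Separation.
Variable R : realType.

(** The parameter e of the model, and the first two columns of M. *)
Definition datum : Type := bool * (seq bool * seq bool).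

(** Whether the restriction to the coordinate torus (k, l) is nontrivial. *)
Definition twist (q : datum) (k l : nat) : bool := q.1 && minor q.2.1 q.2.2 k l.

Definition realizes (q : datum) (w : dform R 6 3) : Prop := exists2 M : 'M[R]_6,
  bit_frame q.2.1 q.2.2 M &
  forall k l, torus_iso (model_field (q.1%:R) M k l) (fun x => para_complex (w (plane k l x))).

(** One of the two restrictions would be isomorphic to a constant field, the other one is not. *)
Lemma twist_torus_iso q q' (w w' : dform R 6 3) (k l : 'I_6) :
  realizes q w -> realizes q' w' ->
  torus_iso (fun x => para_complex (w (plane k l x))) (fun x => para_complex (w' (plane k l x))) ->
  twist q k l -> twist q' k l.
Proof.
move=> [M [dM hM] iM] [M' [dM' hM'] iM'] h.
rewrite /twist => /andP[q1 mq]; apply: contraT; rewrite negb_and => N.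
have [|A uA iA] := @trivial_plane R (q'.1%:R) M' k l (nth false q'.2.1 k) (nth false q'.2.2 k)
    (nth false q'.2.1 l) (nth false q'.2.2 l) _ dM' (hM' k).1 (hM' l).1 (hM' k).2 (hM' l).2.
  move: N; case: (q'.1) => [/= N|_]; last by left.
  right; split=> //; move: N; rewrite /minor.
  by case: (_ && _) => /=; case: (_ && _).
have := @nontrivial_plane R M A k l _ _ _ _ mq dM uA (hM k).1 (hM l).1 (hM k).2 (hM l).2.
case; have {}iM := iM k l; move: iM; rewrite q1 => iM.
exact: torus_iso_trans iM (torus_iso_trans h (torus_iso_trans (torus_iso_sym (iM' k l)) iA)).
Qed.
Lemma twist_homotopic q q' (w w' : dform R 6 3) (k l : 'I_6) :
  realizes q w -> realizes q' w' -> homotopic w w' -> twist q k l = twist q' k l.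
Proof.
move=> rq rq' h; have i := homotopic_torus_iso k l h.
by apply/idP/idP; [exact: twist_torus_iso rq rq' i|exact: twist_torus_iso rq' rq (torus_iso_sym i)].
Qed.
End Separation.

Fixpoint bit_vectors (n : nat) : seq (seq bool) :=
  if n is m.+1 then [seq c :: v | c <- [:: true; false], v <- bit_vectors m] else [:: [::]].

(** Reduced row echelon bases: each of the 651 planes in F_2^6 occurs once. *)
Definition echelon_pairs : seq (seq bool * seq bool) :=
  [seq p <- [seq (a, b) | a <- bit_vectors 6, b <- bit_vectors 6] |
    (index true p.1 < index true p.2 < 6)%N && ~~ nth false p.1 (index true p.2)].

(** The columns of the first entry only have to extend to an invertible matrix. *)
Definition data : seq datum :=
  (false, ([:: true], [:: false; true])) :: [seq (true, p) | p <- echelon_pairs].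

Definition pattern (q : datum) : seq bool := [seq twist q k l | k <- iota 0 6, l <- iota 0 6].

Lemma size_data : size data = 652%N. Proof. by vm_compute. Qed.

(** A plane is determined by its Pluecker coordinates, and over F_2 these have no scale. *)
Lemma pattern_uniq : uniq [seq pattern q | q <- data]. Proof. by vm_compute. Qed.

Lemma data_minor : all (fun q => has (fun k => has (minor q.2.1 q.2.2 k) (iota 0 6)) (iota 0 6)) data.
Proof. by vm_compute. Qed.

Lemma data_frame (R : realType) q : q \in data -> exists M : 'M[R]_6, bit_frame q.2.1 q.2.2 M.
Proof.
move=> qd; have /hasP[k k6 /hasP[l l6 h]] := allP data_minor q qd.
move: k6 l6; rewrite !mem_iota /= => k6 l6.
exact: (@bit_frame_exists R _ _ (Ordinal k6) (Ordinal l6)).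
Qed.

Lemma torus_zero (R : realType) :
  let z : dform R 6 3 := fun _ _ => 0 in torus_form z /\ closed_form z.
Proof.
split.
  split=> [x|//|v]; last exact: smooth_cst.
  by split=> // *; rewrite !mulr0 addr0.
move=> x v; rewrite /extd big1 // => i _; rewrite (_ : 'D_(row i v) _ x = 0) ?mulr0 //.
exact: derive_cst.
Qed.

Theorem mainTheorem9 (R : realType) :
  at_least_homotopy_classes 652
    [set rho : dform R 6 3 | closed_form rho /\ extendible rho] /\
  (forall xi : dform R 6 3, torus_form xi -> closed_form xi ->
     at_least_homotopy_classes 652
       [set rho : dform R 6 3 |
         [/\ closed_form rho, extendible rho & deRham_class xi rho]]).
Proof.
suff main (xi : dform R 6 3) : torus_form xi -> closed_form xi ->
     at_least_homotopy_classes 652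
       [set rho : dform R 6 3 |
         [/\ closed_form rho, extendible rho & deRham_class xi rho]].
  split=> //; have [t0 c0] := torus_zero R; have [rho [h1 h2]] := main _ t0 c0.
  by exists rho; split=> // i; have [? []] := h1 i.
move=> txi cxi; pose q0 : datum := (false, ([::], [::])).
pose q (i : 'I_652) := nth q0 data i.
have qd i : q i \in data by rewrite mem_nth // size_data.
have ex i : exists w : dform R 6 3, [/\ SL3_form w, closed_form w, extendible w, deRham_class xi w &
    realizes (q i) w].
  have [M hM] := data_frame R (qd i).
  have he : (q i).1%:R = 0 :> R \/ (q i).1%:R = 1 :> R by case: ((q i).1); auto.
  have [w [? ? ? ? iw]] := realization he hM txi cxi.
  by exists w; split=> //; exists M.
have [rho hrho] := choice ex; exists rho; split=> [i|i j ij h].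
  by have [? ? ? ? ?] := hrho i.
have [_ _ _ _ ri] := hrho i; have [_ _ _ _ rj] := hrho j.
have e : pattern (q i) = pattern (q j).
  apply/eq_in_allpairs => k l; rewrite !mem_iota /= => k6 l6.
  exact: (twist_homotopic (Ordinal k6) (Ordinal l6) ri rj h).
move/negP: ij; apply; rewrite -val_eqE /=.
rewrite -(nth_uniq [::] _ _ pattern_uniq) ?size_map ?size_data ?ltn_ord //.
by rewrite !(nth_map q0) ?size_data ?ltn_ord // -/(q i) -/(q j) e.
Qed.
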